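(* Suppose that $G$ is consistent and positive definite. Then $c^*(f)=\gamma^*(f)$ and $c_*(f)=\gamma_*(f)$ for every $f\in\mathcal F^+$. Hence $c^*$ and $c_*$ are sequentially order continuous from below (on $\mathcal E^+$-measurable functions in the case of $c_*$): $$c^*(\sup_n f_n)=\sup_n c^*(f_n)$$ for every increasing sequence of functions $f_n\in\mathcal F^+$, and $$c_*(\sup_n f_n)=\sup_n c_*(f_n)$$ for every increasing sequence of $\mathcal E^+$-measurable functions $f_n\in\mathcal F^+$.
   Context: $X$ is a nonempty locally compact Hausdorff space, $\mathcal M^+$ the set of positive Radon measures on $X$ with the vague topology (coarsest topology making $\mu\mapsto\int\varphi\,d\mu$ continuous for every continuous compactly supported $\varphi$). $G:X\times X\to[0,+\infty]$ is a kernel: lower semicontinuous (l.s.c.), symmetric, and $G(x,x)>0$ for all $x$. For $\mu\in\mathcal M^+$: $G\mu(x)=\int G(x,y)\,d\mu(y)$, $\|\mu\|=(\int G\mu\,d\mu)^{1/2}$; $\mathcal E^+=\{\mu\in\mathcal M^+:\|\mu\|<+\infty\}$, $\mathcal E^+_1=\{\mu\in\mathcal M^+:\|\mu\|\le1\}$. $\mathcal F^+$: all functions $X\to[0,+\infty]$. $\mathcal G$: l.s.c. functions in $\mathcal F^+$. $\mathcal H_0$: finite-valued upper semicontinuous functions $X\to[0,+\infty[$ of compact support. $\mathcal C_0^+=\mathcal G\cap\mathcal H_0$. A function is $\mathcal E^+$-measurable if it is measurable with respect to every $\mu\in\mathcal E^+$. Energy capacity: $c(\varphi)=\max\{\int\varphi\,d\mu:\mu\in\mathcal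 E_1^+\}$ for $\varphi\in\mathcal C_0^+$; $c(h)=\inf\{c(\varphi):\varphi\in\mathcal C_0^+,\varphi\ge h\}$ for $h\in\mathcal H_0$; $c(g)=\sup\{c(\varphi):\varphi\in\mathcal C_0^+,\varphi\le g\}$ for $g\in\mathcal G$. For $f\in\mathcal F^+$: $c_*(f)=\sup\{c(h):h\in\mathcal H_0,h\le f\}$, $c^*(f)=\inf\{c(g):g\in\mathcal G,g\ge f\}$; $c^*(E)=c^*(1_E)$ for $E\subset X$. q.e. means: except on a set $E$ with $c^*(E)=0$. For $f\in\mathcal F^+$ let $\Gamma^*(f)=\{\lambda\in\mathcal E^+: G\lambda\ge f\text{ q.e.}\}$ and $\Gamma_*(f)=\{\lambda\in\mathcal E^+:\int G\lambda\,d\nu\ge\int_*f\,d\nu\text{ for all }\nu\in\mathcal E^+\}$ ($\int_*$ is the lower integral). Dual capacities: $\gamma^*(f)=\inf\{\|\lambda\|:\lambda\in\Gamma^*(f)\}$, $\gamma_*(f)=\inf\{\|\lambda\|:\lambda\in\Gamma_*(f)\}$, with infimum of the empty set equal to $+\infty$. $G$ is consistent if for every $\lambda\in\mathcal E^+$ the function $\mu\mapsto\int G\lambda\,d\mu$ on $\mathcal E^+_1$ is finite and vaguely continuous. $G$ is positive definite if $\int G\mu\,d\nu\le\|\mu\|\,\|\nu\|$ for all $\mu,\nu\in\mathcal E^+$. *)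

(* Defs.v *)
From HB Require Import structures.
From mathcomp Require Import all_boot all_order all_algebra.
From mathcomp Require Import all_classical all_reals all_analysis measurable_realfun.

Set Implicit Arguments.
Unset Strict Implicit.
Unset Printing Implicit Defensive.
Import Order.TTheory GRing.Theory Num.Theory numFieldNormedType.Exports.

Local Open Scope classical_set_scope.
Local Open Scope ring_scope.
Local Open Scope ereal_scope.

Notation borel X := (g_sigma_algebraType (@open X)).

Section radon.
Context (R : realType) (X : ptopologicalType).

(* X is meant to be locally compact Hausdorff, so that compact sets are Borel
   and "finite on compact sets" is the same as "locally finite". Inner
   regularity is required on all Borel sets: these measures are in bijection
   with the positive linear functionals on the continuous functions of compact
   support, and no sigma-finiteness is implied. *)
Definition is_radon (mu : set (borel X) -> \bar R) : Prop :=
  (forall K : set X, compact K -> mu K < +oo) /\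
  (forall A : set (borel X), measurable A ->
     mu A = ereal_sup [set mu K | K in [set K : set X | compact K /\ K `<=` A]]).

Record radon_measure := RadonMeasure {
  radon_val :> {measure set (borel X) -> \bar R} ;
  radon_valP : is_radon radon_val }.

Definition has_compact_support (T : nmodType) (h : X -> T) : Prop :=
  compact (closure [set x | h x != 0%R]).

Record Cc := MkCc {
  Cc_fun :> X -> R ;
  Cc_continuous : continuous Cc_fun ;
  Cc_compact : has_compact_support Cc_fun }.

Definition vague_eval (mu : radon_measure) : {ptws Cc -> R} :=
  fun phi => (\int[mu]_x phi x)%R.

HB.instance Definition _ := gen_eqMixin radon_measure.
HB.instance Definition _ := gen_choiceMixin radon_measure.
(* The vague topology: the coarsest one for which all the coordinates
   mu |-> \int phi dmu of vague_eval are continuous. *)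
HB.instance Definition _ :=
  Topological.copy radon_measure (initial_topology vague_eval).

Definition upper_semicontinuous (h : X -> \bar R) : Prop :=
  lower_semicontinuous (fun x => - h x).

Definition Fplus : set (X -> \bar R) := [set f | forall x, 0 <= f x].

Definition lscF : set (X -> \bar R) :=
  [set g | Fplus g /\ lower_semicontinuous g].

Definition uscH0 : set (X -> \bar R) :=
  [set h | Fplus h /\ (forall x, h x < +oo) /\ upper_semicontinuous h /\
           compact (closure [set x | h x != 0])].

Definition C0plus : set (X -> \bar R) := lscF `&` uscH0.

Definition lower_integral (nu : radon_measure) (f : X -> \bar R) : \bar R :=
  ereal_sup [set \int[nu]_x g x | g in
    [set g : borel X -> \bar R |
      measurable_fun setT g /\ forall x, 0 <= g x <= f x]].

(* Measurability with respect to (the completion of) a Radon measure is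
   local, i.e. it is tested on compact sets. *)
Definition radon_measurable (mu : radon_measure) (f : X -> \bar R) : Prop :=
  forall K : set X, compact K ->
    exists2 g : borel X -> \bar R, measurable_fun setT g &
      {ae mu, forall x, K x -> f x = g x}.

End radon.

Section kernel.
Context (R : realType) (X : ptopologicalType) (G : X -> X -> \bar R).

Definition is_kernel : Prop :=
  [/\ forall x y, 0 <= G x y,
      lower_semicontinuous (fun p : X * X => G p.1 p.2),
      forall x y, G x y = G y x
    & forall x, 0 < G x x].

Definition potential (mu : radon_measure R X) (x : X) : \bar R :=
  \int[mu]_y G x y.

Definition mutual_energy (mu nu : radon_measure R X) : \bar R :=
  \int[nu]_x potential mu x.

Definition enorm (mu : radon_measure R X) : \bar R :=
  sqrte (mutual_energy mu mu).

Definition Eplus : set (radon_measure R X) := [set mu | enorm mu < +oo].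

Definition Eplus1 : set (radon_measure R X) := [set mu | enorm mu <= 1].

Definition Eplus_measurable (f : X -> \bar R) : Prop :=
  forall mu, Eplus mu -> radon_measurable mu f.

Definition consistent : Prop := forall lambda, Eplus lambda ->
  (forall mu, Eplus1 mu -> mutual_energy lambda mu \is a fin_num) /\
  {within Eplus1, continuous (mutual_energy lambda)}.

Definition positive_definite : Prop := forall mu nu, Eplus mu -> Eplus nu ->
  mutual_energy mu nu <= enorm mu * enorm nu.

Definition capC (phi : X -> \bar R) : \bar R :=
  ereal_sup [set \int[mu]_x phi x | mu in Eplus1].

Definition capH (h : X -> \bar R) : \bar R :=
  ereal_inf [set capC phi | phi in
    [set phi | C0plus phi /\ forall x, h x <= phi x]].

Definition capG (g : X -> \bar R) : \bar R :=
  ereal_sup [set capC phi | phi in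
    [set phi | C0plus phi /\ forall x, phi x <= g x]].

Definition lower_cap (f : X -> \bar R) : \bar R :=
  ereal_sup [set capH h | h in [set h | uscH0 h /\ forall x, h x <= f x]].

Definition upper_cap (f : X -> \bar R) : \bar R :=
  ereal_inf [set capG g | g in [set g | lscF g /\ forall x, f x <= g x]].

Definition upper_cap_set (E : set X) : \bar R :=
  upper_cap (fun x => (\1_E x)%:E).

Definition quasi_everywhere (P : X -> Prop) : Prop :=
  exists2 E : set X, upper_cap_set E = 0 & forall x, ~ E x -> P x.

Definition upper_Gamma (f : X -> \bar R) : set (radon_measure R X) :=
  [set lambda | Eplus lambda /\
     quasi_everywhere (fun x => f x <= potential lambda x)].

Definition lower_Gamma (f : X -> \bar R) : set (radon_measure R X) :=
  [set lambda | Eplus lambda /\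
     forall nu, Eplus nu -> lower_integral nu f <= mutual_energy lambda nu].

Definition upper_gamma (f : X -> \bar R) : \bar R :=
  ereal_inf [set enorm lambda | lambda in upper_Gamma f].

Definition lower_gamma (f : X -> \bar R) : \bar R :=
  ereal_inf [set enorm lambda | lambda in lower_Gamma f].

End kernel.

(* Main.v *)
Require Import Defs.
From HB Require Import structures.
From mathcomp Require Import all_boot all_order all_algebra.
From mathcomp Require Import all_classical all_reals all_analysis measurable_realfun.
From mathcomp Require Import ring lra.
Import Order.TTheory GRing.Theory Num.Theory numFieldNormedType.Exports.
Local Open Scope classical_set_scope.
Local Open Scope ring_scope.
Local Open Scope ereal_scope.

Set Implicit Arguments.
Unset Strict Implicit.
Unset Printing Implicit Defensive.

(* The unit ball Eplus1 is vaguely compact: a vague ultrafilter limit exists by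
   the Riesz representation theorem, since G(x, x) > 0 bounds the mass of each
   compact set, and the energy is vaguely lower semicontinuous because G is the
   supremum of finite sums of tensor products of continuous functions.

   If mu0 maximizes the integral of h in H_0 over Eplus1, the first variation
   at mu0 shows that lambda = c(h) mu0 satisfies int h dnu <= int G lambda dnu
   for all nu of finite energy. By consistency the inequalities obtained for an
   upward directed family of functions survive in a vague cluster point of the
   corresponding lambdas, which yields gamma_* <= c_*, and, for g lower
   semicontinuous, a lambda of norm <= c(g) (up to epsilon) dominating g in
   mean. To get G lambda >= g quasi-everywhere, Dini's theorem on Eplus1
   provides phi <= G lambda continuous of compact support such that
   int (G lambda - phi) dmu is uniformly small on Eplus1; the exceptional set
   is then covered by the open set {g > phi + d}, of small capacity.

   For an increasing sequence f_n with near-optimal lambda_n, the same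
   compactness is applied to v_n = inf_(k >= n) G lambda_k >= f_n. *)

(** * Topology *)

(** Radon measures here need not be sigma-finite, and a lower semicontinuous [G] need not be
    measurable for the product sigma-algebra, so Fubini's theorem does not apply directly. Symmetry
    and semicontinuity of the energy are both read off finite tensor minorants of [G], whose
    iterated integrals are products.

    Domination quasi-everywhere is not visibly stable under vague limits, whereas an inequality
    [F nu <= energy lambda nu] with [nu] fixed is: by symmetry and consistency its right-hand side
    is vaguely continuous in [lambda] on multiples of [Eplus1]. Limits are therefore taken in the
    mean, and the price is the return to quasi-everywhere. That return needs some topological
    structure of the dominated function, which an arbitrary [f_n] lacks; hence its replacement by
    [v_n], an infimum of potentials.

    Positive definiteness provides finiteness of mutual energies and
    [energy lambda mu <= enorm lambda] on [Eplus1], from which [upper_cap <= upper_gamma] and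
    [lower_cap <= lower_gamma] follow. *)

(** If no [P i] contained [A], the complements of the [P i] in [A] would generate a proper filter,
    and a cluster point of it would contradict the local hypothesis. Most compactness arguments
    below take this form; [I] is arbitrary so that it can range over functions, neighbourhoods,
    lists or real bounds. *)
Lemma compact_directed (T : topologicalType) (I : Type) (A : set T) (D : set I)
    (P : I -> set T) : compact A -> D !=set0 ->
  (forall i j, D i -> D j -> exists2 k, D k & P i `|` P j `<=` P k) ->
  (forall x, A x -> exists2 i, D i & exists2 U, nbhs x U & U `&` A `<=` P i) ->
  exists2 i, D i & A `<=` P i.
Proof.
move=> cA D0 dirP locP; apply: contrapT => noi.
pose F := filter_from D (fun i => A `\` P i).
have FP : ProperFilter F.
  apply: filter_from_proper.
    apply: filter_from_filter => // i j Di Dj.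
    have [k Dk ijk] := dirP _ _ Di Dj; exists k => // x [Ax nPk].
    by split; split => // Px; apply: nPk; apply: ijk; [left|right].
  move=> i Di; apply: contrapT => /set0P/negP/negPn/eqP AP0.
  by apply: noi; exists i => //; rewrite -setD_eq0.
have FA : F A by have [i Di] := D0; exists i => // x [].
have [x [Ax clx]] := cA _ FP FA.
have [i Di [U xU UP]] := locP _ Ax.
have Fi : F (A `\` P i) by exists i.
by have [y [[Ay nPy] Uy]] := clx _ _ Fi xU; apply: nPy; apply: UP.
Qed.

Section locally_compact_hausdorff.
Context (R : realType) (X : ptopologicalType).
Hypotheses (hausX : hausdorff_space X) (lcX : locally_compact [set: X]).

Lemma compact_nbhs_in (x : X) (U : set X) : nbhs x U ->
  exists2 C, compact C /\ C `<=` U & nbhs x C.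
Proof.
move=> xU.
have regX : regular_space X.
  have cr := @locally_compact_completely_regular X R lcX hausX.
  exact: (@completely_regular_regular R X cr).
have [V xV VU] := regX x U xU.
have [W] := @lcX x Logic.I; rewrite withinET => xW [cW clW].
exists (W `&` closure V).
  split; first exact: compact_closedI cW (@closed_closure _ _).
  by move=> y [_ /VU].
by apply: filterI => //; apply: filterS xV; exact: subset_closure.
Qed.

Lemma compact_support_off (T : nmodType) (f : X -> T) (C : set X) :
  compact C -> (forall x, ~ C x -> f x = 0%R) -> has_compact_support f.
Proof.
move=> cC f0; apply: (subclosed_compact _ cC); first exact: closed_closure.
rewrite (closure_id C).1; last exact: compact_closed.
by apply: closureS => x /= fx; apply: contrapT => /f0/eqP; rewrite (negPf fx).
Qed.

(** A compact witness off which [f] vanishes combines more easily under pointwise operations than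
    the closure of the non-vanishing set, which [cc_compact_support] recovers. *)
Definition cc (f : X -> R) : Prop :=
  continuous f /\ exists2 C, compact C & forall x, ~ C x -> f x = 0%R.

Lemma cc_compact_support (f : X -> R) : cc f -> has_compact_support f.
Proof. by move=> [_ [C cC f0]]; exact: compact_support_off f0. Qed.

Lemma continuous_cmax (f g : X -> R) : continuous f -> continuous g ->
  continuous (fun x => Num.max (f x) (g x)).
Proof. by move=> cf cg x; exact: (@continuous_max R X f g x (cf x) (cg x)). Qed.

Lemma continuous_cmin (f g : X -> R) : continuous f -> continuous g ->
  continuous (fun x => Num.min (f x) (g x)).
Proof. by move=> cf cg x; exact: (@continuous_min R X f g x (cf x) (cg x)). Qed.

Lemma cc0 : cc (fun=> 0%R).
Proof. by split; [exact: cst_continuous | exists set0 => //; exact: compact0]. Qed.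

Lemma cc_map2 (h : R -> R -> R) (f g : X -> R) : h 0%R 0%R = 0%R ->
  cc f -> cc g -> continuous (fun x => h (f x) (g x)) ->
  cc (fun x => h (f x) (g x)).
Proof.
move=> h0 [_ [C cC fC]] [_ [D cD gD]] ch; split => //.
exists (C `|` D); first exact: compactU.
by move=> x /not_orP[nC nD]; rewrite fC// gD.
Qed.

Lemma ccD (f g : X -> R) : cc f -> cc g -> cc (fun x => f x + g x)%R.
Proof.
move=> cf cg; apply: (@cc_map2 (fun a b => a + b)%R) => //; first exact: addr0.
by move=> x; apply: (@continuousD R R X); [exact: cf.1|exact: cg.1].
Qed.

Lemma ccB (f g : X -> R) : cc f -> cc g -> cc (fun x => f x - g x)%R.
Proof.
move=> cf cg; apply: (@cc_map2 (fun a b => a - b)%R) => //; first exact: subr0.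
by move=> x; apply: (@continuousB R R X); [exact: cf.1|exact: cg.1].
Qed.

Lemma cc_max (f g : X -> R) : cc f -> cc g -> cc (fun x => Num.max (f x) (g x)).
Proof.
move=> cf cg; apply: (@cc_map2 Num.max) => //; first exact: maxxx.
exact: continuous_cmax cf.1 cg.1.
Qed.

Lemma cc_min (f g : X -> R) : cc f -> cc g -> cc (fun x => Num.min (f x) (g x)).
Proof.
move=> cf cg; apply: (@cc_map2 Num.min) => //; first exact: minxx.
exact: continuous_cmin cf.1 cg.1.
Qed.

Lemma ccMl (f g : X -> R) : continuous f -> cc g -> cc (fun x => f x * g x)%R.
Proof.
move=> cf [cg [D cD gD]]; split.
  by move=> x; apply: (@continuousM R X); [exact: cf|exact: cg].
by exists D => // x nD; rewrite gD// mulr0.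
Qed.

Lemma ccZ (c : R) (g : X -> R) : cc g -> cc (fun x => c * g x)%R.
Proof. by apply: ccMl; exact: cst_continuous. Qed.

Lemma cc_sum (I : Type) (s : seq I) (f : I -> X -> R) :
  (forall i, cc (f i)) -> cc (fun x => \sum_(i <- s) f i x)%R.
Proof.
move=> cf; elim: s => [|i s ih].
  rewrite (_ : (fun _ => _) = (fun=> 0%R)); first exact: cc0.
  by apply/funext => x; rewrite big_nil.
rewrite (_ : (fun _ => _) = (fun x => f i x + \sum_(j <- s) f j x)%R).
  exact: ccD.
by apply/funext => x; rewrite big_cons.
Qed.

(** Complete regularity separates only a point from a closed set. Sums of the resulting bumps form a
    directed family, each carried with a compact subset of [U] off which it vanishes; by compactness
    one sum exceeds 1 on [K], and it is truncated at 1. *)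
Lemma urysohn_cc (K U : set X) : compact K -> open U -> K `<=` U ->
  exists f : X -> R, [/\ cc f, forall x, (0 <= f x <= 1)%R,
    forall x, K x -> f x = 1%R &
    exists2 C, compact C /\ C `<=` U & forall x, ~ C x -> f x = 0%R].
Proof.
move=> cK oU KU.
pose D := [set fC : (X -> R) * set X | [/\ continuous fC.1,
  forall x, (0 <= fC.1 x)%R, compact fC.2, fC.2 `<=` U &
  forall x, ~ fC.2 x -> fC.1 x = 0%R]].
pose P (fC : (X -> R) * set X) := [set x | 1 < fC.1 x]%R.
have [|||[f C] [/= cf f0 cC CU fC] fK] := @compact_directed _ _ K D P cK.
- exists (fun=> 0%R, set0); split => //=; first exact: cst_continuous.
  exact: compact0.
- move=> [f C] [g E] [/= cf f0 cC CU fC] [/= cg g0 cE EU gE].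
  exists (fun x => f x + g x, C `|` E)%R.
    split => //=.
    + by move=> x; apply: (@continuousD R R X); [exact: cf|exact: cg].
    + by move=> x; rewrite addr_ge0.
    + exact: compactU.
    + by move=> x [/CU|/EU].
    + by move=> x /not_orP[/fC -> /gE ->]; rewrite addr0.
  move=> x [] /=; rewrite /P /=; first by have := g0 x; lra.
  by have := f0 x; lra.
- move=> x Kx.
  have [C [cC CU] xC] : exists2 C, compact C /\ C `<=` U & nbhs x C.
    by apply: compact_nbhs_in; apply: open_nbhs_nbhs; split => //; exact: KU.
  have cr := @locally_compact_completely_regular X R lcX hausX.
  have /(@uniform_separatorP _ R)[g [cg g01 gx gC]] :
      uniform_separator [set x] (~` C°).
    by apply: cr; [apply: open_closedC; exact: open_interior | apply].
  (* The factor 2 makes the bump exceed 1 strictly on the neighbourhood of [x] where [g < 1/2]. *)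
  exists (fun y => 2 * (1 - g y), C)%R.
    split => //=.
    + move=> y; apply: (@continuousM R X); first exact: cst_continuous.
      by apply: (@continuousB R R X); [exact: cst_continuous|exact: cg].
    + move=> y; have /g01 : range g (g y) by exists y.
      by rewrite /= in_itv /=; lra.
    + move=> y nCy.
      have -> : g y = 1%R by apply: gC; exists y => // /interior_subset.
      by rewrite subrr mulr0.
  have gx0 : g x = 0%R by apply: gx; exists x.
  exists [set y | (g y < 1/2)%R]; last first.
    by move=> y [/= gy _]; rewrite /P /=; lra.
  apply: open_nbhs_nbhs; split => /=; last by rewrite gx0; lra.
  rewrite (_ : [set y | _] = g @^-1` [set r | r < 1/2]%R)//.
  by apply: open_comp => //; exact: open_lt.
have c1 : continuous (fun x => Num.min (f x) 1%R).
  by apply: continuous_cmin => //; exact: cst_continuous.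
have z1 x : ~ C x -> Num.min (f x) 1%R = 0%R.
  by move=> /fC ->; rewrite /Num.min ltr01.
exists (fun x => Num.min (f x) 1%R); split.
- by split => //; exists C.
- by move=> x; rewrite le_min f0 ler01 /= ge_min lexx orbT.
- by move=> x Kx; have /ltW := fK _ Kx; rewrite /P/=; exact: min_r.
- by exists C.
Qed.

Lemma disjoint_compact_separation (K L : set X) : compact K -> compact L ->
  K `&` L = set0 ->
  exists f : X -> R, [/\ continuous f, forall x, (0 <= f x <= 1)%R,
    forall x, K x -> f x = 1%R & forall x, L x -> f x = 0%R].
Proof.
move=> cK cL KL0.
have oL : open (~` L) by apply: closed_openC; exact: compact_closed.
have KL : K `<=` ~` L.
  by move=> x Kx Lx; have : (K `&` L) x by []; rewrite KL0.
have [f [[cf _] f01 fK [C [_ CL] fC]]] := urysohn_cc cK oL KL.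
by exists f; split => // x Lx; apply: fC => /CL.
Qed.

End locally_compact_hausdorff.

(** * Semicontinuous functions *)

Lemma lte_addP (R : realType) (a : R) (x y : \bar R) : a%:E < x + y ->
  x != -oo -> y != -oo ->
  exists b c : R, [/\ b%:E < x, c%:E < y & (a <= b + c)%R].
Proof.
case: x y => [x||] [y||]//= + _ _; rewrite ?lte_fin => h.
- exists (x - (x + y - a) / 2)%R, (y - (x + y - a) / 2)%R.
  by rewrite !lte_fin; split; lra.
- by exists (x - 1)%R, (a - x + 1)%R; rewrite lte_fin ltry; split => //; lra.
- by exists (a - y + 1)%R, (y - 1)%R; rewrite lte_fin ltry; split => //; lra.
- by exists a, 0%R; rewrite !ltry; split => //; lra.
Qed.

(** Typically [M] is the mass of a compact set or the integral of a cut-off function, and [e] a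
    uniform error allowed there. The [+ 1] in the denominator covers [M = 0]. *)
Lemma lte_add_slack (R : realType) (a M : R) (x : \bar R) : a%:E < x ->
  (0 <= M)%R -> exists2 e : R, (0 < e)%R & (a + e * M)%:E < x.
Proof.
case: x => [x||]//= + M0; last by exists 1%R; rewrite ?ltry.
rewrite lte_fin => ax; have M1 : (0 < 2 * (M + 1))%R by lra.
exists ((x - a) / (2 * (M + 1)))%R; first by rewrite divr_gt0// subr_gt0.
rewrite lte_fin (_ : _ * M = (x - a) * (M / (2 * (M + 1))))%R; last first.
  by field; lra.
have : (M / (2 * (M + 1)) < 1)%R by rewrite ltr_pdivrMr//; lra.
by nra.
Qed.

Lemma ereal_sup_addr_le (R : realType) (S : set \bar R) (b c : \bar R) :
  S !=set0 -> (forall x, S x -> 0 <= x) -> 0 <= b ->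
  (forall x, S x -> x + b <= c) -> ereal_sup S + b <= c.
Proof.
move=> [x0 Sx0] S0 b0 H; case: b b0 H => [b||]// b0 H.
  by rewrite -leeBrDr//; apply: ge_ereal_sup => x /H; rewrite leeBrDr.
have := H _ Sx0; rewrite addey; last by have := S0 _ Sx0; case: x0 {Sx0}.
by rewrite leye_eq => /eqP ->; rewrite leey.
Qed.

Section semicontinuous.
Context (R : realType) (X : ptopologicalType).
Implicit Types f g h : X -> \bar R.

Lemma uscP h : upper_semicontinuous h <-> forall x (a : R), h x < a%:E ->
  exists2 V, nbhs x V & forall y, V y -> h y < a%:E.
Proof.
split=> H x a hx.
  have [|V xV HV] := H x (- a)%R; first by rewrite EFinN lteN2.
  by exists V => // y /HV; rewrite EFinN lteN2.
have [|V xV HV] := H x (- a)%R; first by rewrite EFinN lteNr.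
by exists V => // y /HV; rewrite EFinN lteNr.
Qed.

Lemma lsc_measurable f : lower_semicontinuous f ->
  measurable_fun [set: borel X] f.
Proof.
move=> scif; apply: (measurability _ (ErealGenOInfty.measurableE R)).
move=> /= _ [_ [a ->]] <-; apply: measurableI => //.
apply: sub_sigma_algebra.
by rewrite preimage_itvoy; move/lower_semicontinuousP : scif; exact.
Qed.

Lemma usc_measurable f : upper_semicontinuous f ->
  measurable_fun [set: borel X] f.
Proof.
move=> /lsc_measurable mf; rewrite (_ : f = (fun x => - - f x));
  last by apply/funext => x; rewrite oppeK.
exact: measurableT_comp mf.
Qed.

Lemma lscD f g : lower_semicontinuous f -> lower_semicontinuous g ->
  (forall x, f x != -oo) -> (forall x, g x != -oo) ->
  lower_semicontinuous (fun x => f x + g x).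
Proof.
move=> lf lg f0 g0 x a /lte_addP[]// b [c [bf cg abc]].
have [V xV VP] := lf _ _ bf; have [W xW WP] := lg _ _ cg.
exists (V `&` W); first exact: filterI.
move=> y [/VP by_ /WP cy]; apply: (@le_lt_trans _ _ (b%:E + c%:E)).
  by rewrite -EFinD lee_fin.
exact: lteD.
Qed.

Lemma continuous_lsc (f : X -> R) : continuous f ->
  lower_semicontinuous (EFin \o f).
Proof.
move=> cf; apply/lower_semicontinuousP => a.
rewrite (_ : [set x | _] = f @^-1` [set r | a < r]%R); last first.
  by apply/seteqP; split => x /=; rewrite lte_fin.
by apply: open_comp => //; exact: open_gt.
Qed.

Lemma continuous_usc (f : X -> R) : continuous f ->
  upper_semicontinuous (EFin \o f).
Proof.
move=> cf; rewrite /upper_semicontinuous.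
rewrite (_ : (fun _ => _) = EFin \o (fun x => - f x)%R); last by apply/funext.
by apply: continuous_lsc => x; apply: (@continuousN R R X); exact: cf.
Qed.

Lemma uscD f g : upper_semicontinuous f -> upper_semicontinuous g ->
  (forall x, f x < +oo) -> (forall x, g x < +oo) ->
  upper_semicontinuous (fun x => f x + g x).
Proof.
move=> uf ug f0 g0; rewrite /upper_semicontinuous.
rewrite (_ : (fun x => _) = (fun x => - f x + - g x)); last first.
  apply/funext => x; rewrite oppeD// /adde_def.
  by move: (f0 x) (g0 x); case: (f x) => [?||]; case: (g x).
by apply: lscD => // x; [move: (f0 x)|move: (g0 x)]; [case: (f x)|case: (g x)].
Qed.

Lemma usc_max f g : upper_semicontinuous f -> upper_semicontinuous g ->
  upper_semicontinuous (fun x => maxe (f x) (g x)).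
Proof.
move=> /uscP uf /uscP ug; apply/uscP => x a; rewrite gt_max => /andP[fa ga].
have [V xV VP] := uf _ _ fa; have [W xW WP] := ug _ _ ga.
exists (V `&` W); first exact: filterI.
by move=> y [/VP fy /WP gy]; rewrite gt_max fy.
Qed.

Lemma lsc_ereal_sup (I : Type) (D : set I) (f : I -> X -> \bar R) :
  (forall i, D i -> lower_semicontinuous (f i)) ->
  lower_semicontinuous (fun x => ereal_sup [set f i x | i in D]).
Proof.
move=> lf x a /ereal_sup_gt[_ [i Di <-] afi].
have [V xV VP] := lf _ Di _ _ afi; exists V => // y /VP /lt_le_trans; apply.
by apply: ereal_sup_ubound; exists i.
Qed.

Hypothesis hausX : hausdorff_space X.

Lemma open_borel (U : set X) : open U -> measurable (U : set (borel X)).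
Proof. exact: sub_sigma_algebra. Qed.

Lemma compact_borel (K : set X) : compact K -> measurable (K : set (borel X)).
Proof.
move=> cK; rewrite -[K]setCK; apply: measurableC; apply: open_borel.
by apply: closed_openC; exact: compact_closed.
Qed.

Lemma uscH0P h : uscH0 h <-> [/\ forall x, 0 <= h x, forall x, h x < +oo,
  upper_semicontinuous h &
  exists2 C, compact C & forall x, ~ C x -> h x = 0].
Proof.
split => [[h0 [hy [uh ch]]]|[h0 hy uh [C cC hC]]].
  split => //; exists (closure [set x | h x != 0]) => // x.
  move=> nhx; apply/eqP/negPn/negP => hx; apply: nhx.
  exact: subset_closure.
do 3!split => //; exact: (@compact_support_off X hausX (\bar R) h C).
Qed.

Lemma uscH0_0 : uscH0 (fun _ : X => 0 : \bar R).
Proof.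
apply/uscH0P; split => //; last by exists set0 => //; exact: compact0.
by apply: (@continuous_usc (fun=> 0%R)); exact: cst_continuous.
Qed.

Lemma uscH0D f g : uscH0 f -> uscH0 g -> uscH0 (fun x => f x + g x).
Proof.
move=> /uscH0P[f0 fy uf [C cC fC]] /uscH0P[g0 gy ug [D cD gD]]; apply/uscH0P.
split; [by move=> x; exact: adde_ge0|by move=> x; exact: lte_add_pinfty| |].
  exact: uscD.
exists (C `|` D); first exact: compactU.
by move=> x /not_orP[/fC -> /gD ->]; rewrite adde0.
Qed.

Lemma uscH0_max f g : uscH0 f -> uscH0 g -> uscH0 (fun x => maxe (f x) (g x)).
Proof.
move=> /uscH0P[f0 fy uf [C cC fC]] /uscH0P[g0 gy ug [D cD gD]]; apply/uscH0P.
split; [by move=> x; rewrite le_max f0|by move=> x; rewrite gt_max fy gy| |].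
  exact: usc_max.
exists (C `|` D); first exact: compactU.
by move=> x /not_orP[/fC -> /gD ->]; rewrite maxxx.
Qed.

Lemma uscH0_indic (r : R) (K : set X) : (0 <= r)%R -> compact K ->
  uscH0 (fun x => (r * \1_K x)%:E).
Proof.
move=> r0 cK; apply/uscH0P; split.
- by move=> x; rewrite lee_fin mulr_ge0.
- by move=> x; rewrite ltry.
- apply/uscP => x a; rewrite lte_fin => ra.
  have [Kx|nKx] := pselect (K x).
    exists setT; first exact: filterT.
    move=> y _; apply: le_lt_trans (_ : (r * \1_K x)%:E < _); last first.
      by rewrite lte_fin.
    rewrite lee_fin ler_wpM2l// !indicE (mem_set Kx).
    by case: (y \in K).
  exists (~` K).
    apply: open_nbhs_nbhs; split => //; apply: closed_openC.
    exact: compact_closed.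
  move=> y nKy; rewrite lte_fin indicE (memNset nKy).
  by move: ra; rewrite indicE (memNset nKx).
- by exists K => // x nKx; rewrite indicE (memNset nKx) mulr0.
Qed.

Lemma cc_C0plus (f : X -> R) : cc f -> (forall x, 0 <= f x)%R ->
  C0plus (EFin \o f).
Proof.
move=> [cf [C cC fC]] f0; split.
  by split => [x|]; [rewrite lee_fin|exact: continuous_lsc].
apply/uscH0P; split.
- by move=> x; rewrite lee_fin.
- by move=> x; rewrite ltry.
- exact: continuous_usc.
- by exists C => // x nCx /=; rewrite fC.
Qed.

End semicontinuous.

(** * Integration against Radon measures *)

Import HBNNSimple.

(** The identity holds for nonnegative simple functions and passes to [f] by monotone convergence,
    so values and integrals may be infinite. *)
Lemma integral_mrestr_ge0 d (T : measurableType d) (R : realType)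
    (mu : {measure set T -> \bar R}) (D : set T) (mD : measurable D)
    (f : T -> \bar R) : measurable_fun setT f -> (forall x, 0 <= f x) ->
  \int[mrestr mu mD]_x f x = \int[mu]_(x in D) f x.
Proof.
move=> mf f0.
have nnE (h : {nnsfun T >-> R}) :
    \int[mrestr mu mD]_x (h x)%:E = \int[mu]_(x in D) (h x)%:E.
  under [LHS]eq_integral do rewrite fimfunE -fsumEFin//.
  under [RHS]eq_integral do rewrite fimfunE -fsumEFin//.
  rewrite [LHS]ge0_integral_fsum//; last 2 first.
  - by move=> r; exact/measurable_EFinP/measurableT_comp.
  - by move=> n x _; rewrite EFinM nnfun_muleindic_ge0.
  rewrite [RHS]ge0_integral_fsum//; last 2 first.
  - by move=> r; exact/measurable_EFinP/measurable_funTS/measurableT_comp.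
  - by move=> n x _; rewrite EFinM nnfun_muleindic_ge0.
  apply: eq_fsbigr => r _.
  rewrite integralZl_indic_nnsfun// integral_indic//.
  by rewrite integralZl_indic_nnsfun// integral_indic// /mrestr setIT.
pose f_ := nnsfun_approx measurableT mf.
transitivity (limn (fun n => \int[mrestr mu mD]_x (f_ n x)%:E)).
  rewrite -monotone_convergence//=.
  - apply: eq_integral => x _; apply/esym/cvg_lim => //=.
    exact: cvg_nnsfun_approx.
  - by move=> n; exact/measurable_EFinP.
  - by move=> n x _; rewrite lee_fin.
  - by move=> x _ a b ab; rewrite lee_fin; exact/lefP/nd_nnsfun_approx.
transitivity (limn (fun n => \int[mu]_(x in D) (f_ n x)%:E)).
  by congr (limn _); apply/funext => n; exact: nnE.
rewrite -monotone_convergence//=.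
- apply: eq_integral => x _; apply/cvg_lim => //=.
  exact: cvg_nnsfun_approx.
- by move=> n; apply: measurable_funTS; exact/measurable_EFinP.
- by move=> n x _; rewrite lee_fin.
- by move=> x _ a b ab; rewrite lee_fin; exact/lefP/nd_nnsfun_approx.
Qed.

Section radon_integral.
Context (R : realType) (X : ptopologicalType).
Hypotheses (hausX : hausdorff_space X) (lcX : locally_compact [set: X]).
Implicit Types (mu : radon_measure R X).

Lemma is_radonP (m : {measure set (borel X) -> \bar R}) :
  (forall K : set X, compact K -> m K < +oo) ->
  (forall (A : set (borel X)) a, measurable A -> a < m A ->
     exists2 K : set X, compact K /\ K `<=` A & a < m K) -> is_radon m.
Proof.
move=> mK mA; split => // A mesA; apply/eqP; rewrite eq_le; apply/andP; split.
  rewrite leNgt; apply/negP => /mA -/(_ mesA)[K KA]; apply/negP; rewrite -leNgt.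
  by apply: ereal_sup_ubound; exists K.
apply: ge_ereal_sup => _ [K [cK KA] <-].
by apply: le_measure => //; rewrite inE//; exact: compact_borel.
Qed.

Lemma radon_inner mu (A : set (borel X)) a : measurable A -> a < mu A ->
  exists2 K : set X, compact K /\ K `<=` A & a < mu K.
Proof.
move=> mA; rewrite (radon_valP mu).2// => /ereal_sup_gt[_ [K KA <-] aK].
by exists K.
Qed.

Lemma radon_compact_fin mu (K : set X) : compact K -> mu K \is a fin_num.
Proof.
by move=> cK; rewrite ge0_fin_numE//; exact: (radon_valP mu).1.
Qed.

Lemma integral_EFin_indic mu (r : R) (A : set (borel X)) : (0 <= r)%R ->
  measurable A -> \int[mu]_x (r * \1_A x)%:E = r%:E * mu A.
Proof.
move=> r0 mA; under eq_integral do rewrite EFinM.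
rewrite ge0_integralZl_EFin//.
  by rewrite integral_indic// setIT.
by apply/measurable_EFinP; exact: measurable_indic.
Qed.

Lemma uscH0_measurable (h : X -> \bar R) : uscH0 h ->
  measurable_fun [set: borel X] h.
Proof. by move=> [_ [_ [+ _]]]; exact: usc_measurable. Qed.

Lemma lscF_measurable (g : X -> \bar R) : lscF g ->
  measurable_fun [set: borel X] g.
Proof. by move=> [_]; exact: lsc_measurable. Qed.

(** The sets are replaced by compact subsets one at a time. [S] accumulates the terms already
    replaced, and a single strict inequality for the running total avoids subtracting measures that
    may be infinite. *)
Lemma simple_inner_usc mu (l : seq (R * set (borel X))) (S a : \bar R) :
  (forall p, p \in l -> (0 <= p.1)%R /\ measurable p.2) -> 0 <= S ->
  a < \sum_(p <- l) p.1%:E * mu p.2 + S ->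
  exists u : X -> \bar R, [/\ uscH0 u,
    forall x, u x <= (\sum_(p <- l) p.1 * \1_(p.2) x)%:E &
    a < \int[mu]_x u x + S].
Proof.
elim: l S => [|[r A] l ih] S lP S0.
  rewrite big_nil add0e => aS; exists (fun=> 0); split.
  - exact: uscH0_0.
  - by move=> x; rewrite big_nil.
  - by rewrite integral0 add0e.
have [r0 mA] := lP (r, A) (mem_head _ _).
have {}lP p : p \in l -> (0 <= p.1)%R /\ measurable p.2.
  by move=> pl; apply: lP; rewrite in_cons pl orbT.
have l0 : 0 <= \sum_(p <- l) p.1%:E * mu p.2.
  rewrite big_seq; apply: sume_ge0 => p pl; apply: mule_ge0 => //.
  by rewrite lee_fin; exact: (lP _ pl).1.
rewrite big_cons /= => aS.
have [K [cK KA] aK] : exists2 K : set X, compact K /\ K `<=` A &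
    a < r%:E * mu K + (\sum_(p <- l) p.1%:E * mu p.2 + S).
  apply: contrapT => noK; move: aS; apply/negP; rewrite -leNgt.
  rewrite (radon_valP mu).2//= -addeA.
  rewrite -ereal_supZl//; last first.
    apply/set0P; exists (mu set0); exists set0 => //.
    by split; [exact: compact0|].
  apply: ereal_sup_addr_le => //.
  - exists (r%:E * mu set0); exists (mu set0) => //; exists set0 => //.
    by split; [exact: compact0|].
  - by move=> _ [_ [K _ <-] <-]; rewrite mule_ge0.
  - by rewrite adde_ge0.
  - move=> _ [_ [K KP <-] <-]; rewrite leNgt; apply/negP => aK.
    by apply: noK; exists K.
have [||u [uH ul au]] := ih (r%:E * mu K + S) lP.
- by rewrite adde_ge0// mule_ge0.
- by rewrite addeCA.
exists (fun x => u x + (r * \1_K x)%:E); split.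
- by apply: uscH0D => //; exact: uscH0_indic.
- move=> x; rewrite big_cons /= [leRHS]EFinD addeC leeD//.
  rewrite lee_fin ler_wpM2l// !indicE ler_nat.
  have [xK|] := boolP (x \in K) => //.
  by rewrite mem_set//; apply: KA; exact/set_mem.
- rewrite ge0_integralD//; last 4 first.
  + by move=> x _; exact: uH.1.
  + exact: uscH0_measurable.
  + by move=> x _; rewrite lee_fin mulr_ge0.
  + by apply: uscH0_measurable; exact: uscH0_indic.
  rewrite integral_EFin_indic//; last exact: compact_borel.
  by rewrite -addeA.
Qed.

(** Inner regularity on all Borel sets, not only on open ones, makes this true without
    sigma-finiteness: a simple minorant is replaced by a combination of indicators of compact
    sets. *)
Lemma borel_inner_usc mu (g : borel X -> \bar R) (a : \bar R) :
  measurable_fun setT g -> (forall x, 0 <= g x) -> a < \int[mu]_x g x ->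
  exists u : X -> \bar R, [/\ uscH0 u, forall x, u x <= g x &
    a < \int[mu]_x u x].
Proof.
move=> mg g0; rewrite ge0_integralTE// => /ereal_sup_gt[_ [h hg <-]].
rewrite sintegralE fsbig_finite//= => ah.
pose s := finmap.enum_fset (fset_set (range h)).
pose l := [seq (r, h @^-1` [set r] : set (borel X)) | r <- s].
have lP p : p \in l -> (0 <= p.1)%R /\ measurable p.2.
  move=> /mapP[r rs ->] /=; split => //.
  move: rs; rewrite /s in_fset_set// => /set_mem[x _ <-]; exact: fun_ge0.
have lE (F : R * set (borel X) -> \bar R) :
  \sum_(p <- l) F p = \sum_(r <- s) F (r, h @^-1` [set r]).
  by rewrite /l big_map.
have [||u [uH ul au]] := @simple_inner_usc mu l 0 a lP.
- by [].
- by rewrite adde0 lE.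
exists u; split => //; last by move: au; rewrite adde0.
move=> x; apply: (le_trans (ul x)); apply: le_trans (hg x).
rewrite lee_fin /l big_map /= [leRHS]fimfunE fsbig_finite//=.
Qed.

End radon_integral.

Lemma ge0_integralTD d (T : measurableType d) (R : realType)
    (mu : {measure set T -> \bar R}) (f g : T -> \bar R) :
  measurable_fun setT f -> measurable_fun setT g ->
  (forall x, 0 <= f x) -> (forall x, 0 <= g x) ->
  \int[mu]_x (f x + g x) = \int[mu]_x f x + \int[mu]_x g x.
Proof. by move=> mf mg f0 g0; rewrite ge0_integralD. Qed.

Lemma ge0_le_integralT d (T : measurableType d) (R : realType)
    (mu : {measure set T -> \bar R}) (f g : T -> \bar R) :
  measurable_fun setT f -> measurable_fun setT g ->
  (forall x, 0 <= f x) -> (forall x, f x <= g x) ->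
  \int[mu]_x f x <= \int[mu]_x g x.
Proof. by move=> mf mg f0 fg; apply: ge0_le_integral. Qed.

(** * Integrals of continuous and semicontinuous functions *)

Section cc_integral.
Context (R : realType) (X : ptopologicalType).
Hypotheses (hausX : hausdorff_space X) (lcX : locally_compact [set: X]).
Implicit Types (mu : radon_measure R X).

Lemma uscH0_bounded (h : X -> \bar R) : uscH0 h ->
  exists2 M : R, (0 <= M)%R & exists2 C, compact C &
    forall x, h x <= (M * \1_C x)%:E.
Proof.
move=> /uscH0P[]// h0 hy /uscP uh [C cC hC].
have [|||M M0 CM] := @compact_directed _ _ C [set M : R | 0 <= M]%R
  (fun M => [set x | h x < M%:E]) cC.
- by exists 0%R => /=.
- move=> M N M0 N0; exists (Num.max M N); first by rewrite /= le_max M0.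
  move=> x [] /= /lt_le_trans; apply; rewrite lee_fin le_max lexx ?orbT//.
- move=> x Cx; have [r r0 hr] : exists2 r : R, (0 <= r)%R & h x < r%:E.
    have := hy x; have := h0 x; case: (h x) => // r; rewrite lee_fin => r0 _.
    by exists (r + 1)%R; rewrite ?lte_fin; lra.
  by exists r => //; have [V xV VP] := uh _ _ hr; exists V => // y [/VP].
exists M => //; exists C => // x; rewrite indicE.
have [xC|xC] := boolP (x \in C); last first.
  by rewrite mulr0 hC// => Cx; rewrite mem_set in xC.
by rewrite mulr1 ltW//; apply: CM; exact/set_mem.
Qed.

Lemma uscH0_integral_fin mu (h : X -> \bar R) : uscH0 h ->
  \int[mu]_x h x \is a fin_num.
Proof.
move=> hH; have [M M0 [C cC hM]] := uscH0_bounded hH.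
rewrite ge0_fin_numE; last by apply: integral_ge0 => x _; exact: hH.1.
apply: (@le_lt_trans _ _ (\int[mu]_x (M * \1_C x)%:E)).
  apply: ge0_le_integral => //.
  - by move=> x _; exact: hH.1.
  - exact: uscH0_measurable.
  - by apply: uscH0_measurable; exact: uscH0_indic.
rewrite integral_EFin_indic//; last exact: compact_borel.
by apply: lte_mul_pinfty => //; exact: (radon_valP mu).1.
Qed.

Lemma cc_measurable (f : X -> R) : cc f ->
  measurable_fun [set: borel X] (f : borel X -> R).
Proof.
by move=> [/continuous_lsc/lsc_measurable + _] => /measurable_EFinP.
Qed.

Lemma cc_abs (f : X -> R) : cc f -> cc (fun x => `|f x|%R).
Proof.
move=> [cf [C cC fC]]; split.
  by move=> x; apply: (@continuous_comp _ _ _ f (fun r : R => `|r|%R));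
    [exact: cf|exact: (@norm_continuous _ R)].
by exists C => // x nC; rewrite fC// normr0.
Qed.

Lemma cc_integrable mu (f : X -> R) : cc f -> mu.-integrable setT (EFin \o f).
Proof.
move=> cf; apply/integrableP; split; first by apply/measurable_EFinP; exact: cc_measurable.
have aH := (cc_C0plus hausX (cc_abs cf) (fun=> normr_ge0 _)).2.
by have := uscH0_integral_fin mu aH; rewrite fin_numE ltey => /andP[].
Qed.

Lemma cc_integralE mu (f : X -> R) : cc f ->
  \int[mu]_x (f x)%:E = (\int[mu]_x f x)%R%:E.
Proof.
move=> cf; rewrite /Rintegral fineK//.
exact: (integrable_fin_num measurableT (cc_integrable mu cf)).
Qed.

Lemma cc_integralD mu (f g : X -> R) : cc f -> cc g ->
  (\int[mu]_x (f x + g x) = \int[mu]_x f x + \int[mu]_x g x)%R.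
Proof. by move=> cf cg; rewrite RintegralD//; exact: cc_integrable. Qed.

Lemma cc_integralB mu (f g : X -> R) : cc f -> cc g ->
  (\int[mu]_x (f x - g x) = \int[mu]_x f x - \int[mu]_x g x)%R.
Proof. by move=> cf cg; rewrite RintegralB//; exact: cc_integrable. Qed.

Lemma cc_integralZ mu (c : R) (f : X -> R) : cc f ->
  (\int[mu]_x (c * f x) = c * \int[mu]_x f x)%R.
Proof. by move=> cf; rewrite RintegralZl//; exact: cc_integrable. Qed.

Lemma cc_le_integral mu (f g : X -> R) : cc f -> cc g ->
  (forall x, f x <= g x)%R -> (\int[mu]_x f x <= \int[mu]_x g x)%R.
Proof. by move=> cf cg fg; apply: le_Rintegral => //; exact: cc_integrable. Qed.

Lemma lsc_minorant_at (g : X -> \bar R) (x : X) (r : R) : lscF g ->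
  r%:E < g x -> exists f : X -> R, [/\ cc f, forall y, (0 <= f y)%R,
    forall y, (f y)%:E <= g y & (r <= f x)%R].
Proof.
move=> [g0 /lower_semicontinuousP lg] rg.
have [f [cf f01 fx [C [cC CU] fC]]] :=
  @urysohn_cc R X hausX lcX [set x] [set y | r%:E < g y]
  (@compact_set1 _ _) (lg r) (fun y (yx : y = x) => eq_ind_r
     (fun z => r%:E < g z) rg yx).
exists (fun y => Num.max r 0 * f y)%R; split.
- exact: ccZ.
- by move=> y; rewrite mulr_ge0// ?le_max ?lexx ?orbT//; case/andP: (f01 y).
- move=> y; have [|ry] := pselect (C y); last by rewrite fC// mulr0; exact: g0.
  move=> /CU/= /ltW rg'; have : (Num.max r 0)%:E <= g y.
    by rewrite EFin_max ge_max rg' g0.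
  apply: le_trans; rewrite lee_fin ler_piMr//; last by case/andP: (f01 y).
  by rewrite le_max lexx orbT.
- by rewrite fx// mulr1 le_max lexx.
Qed.

(** Some minorant [u] in H_0 already has integral above [a]. On a compact set carrying [u], the
    continuous minorants of [g], directed under maximum, rise above [u - e] by compactness. *)
Lemma lsc_inner_cc mu (g : X -> \bar R) (a : R) : lscF g ->
  a%:E < \int[mu]_x g x -> exists f : X -> R, [/\ cc f,
    forall x, (0 <= f x)%R, forall x, (f x)%:E <= g x &
    (a < \int[mu]_x f x)%R].
Proof.
move=> lg ag; have [g0 lscg] := lg.
have [u [uH ug au]] := borel_inner_usc hausX (lscF_measurable lg) g0 ag.
have [u0 uy /uscP uu [C cC uC]] := (uscH0P hausX u).1 uH.
have muC := radon_compact_fin mu cC.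
(* The uniform error [e] on [C] costs [e * mu C], which must fit between [a] and the integral of
   [u]. *)
have [e e0 aeu] := lte_add_slack au (fine_ge0 (measure_ge0 mu C)).
have [|||f [cf f0 fg] Cf] := @compact_directed _ _ C
  [set f : X -> R | [/\ cc f, forall x, (0 <= f x)%R & forall x, (f x)%:E <= g x]]
  (fun f => [set x | u x < (f x + e)%:E]) cC.
- by exists (fun=> 0%R); split => //; exact: cc0.
- move=> f k [cf f0 fg] [ck k0 kg].
  exists (fun x => Num.max (f x) (k x)).
    split; first exact: cc_max.
    + by move=> x; rewrite le_max f0.
    + by move=> x; rewrite EFin_max ge_max fg kg.
  move=> x [] /= /lt_le_trans; apply; rewrite lee_fin lerD2r le_max lexx//.
  by rewrite orbT.
- move=> x Cx; have := uy x; have := u0 x; have := ug x.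
  case ux : (u x) => [r||]// rg r0 _.
  have e3 : (0 < e / 3)%R by rewrite divr_gt0.
  have [|f [cf f0 fg rf]] := @lsc_minorant_at g x (r - e / 3)%R lg.
    by apply: lt_le_trans rg; rewrite lte_fin ltrBlDr ltrDl.
  exists f => //.
  have [|V xV VP] := uu x (r + e / 3)%R; first by rewrite ux lte_fin ltrDl.
  exists (V `&` [set y | f x - e / 3 < f y]%R).
    apply: filterI => //; apply: (cvgr_gt (f x) (cf.1 x)).
    by rewrite ltrBlDr ltrDl.
  move=> y [[/VP uyr /= fy] _]; apply: lt_trans uyr _; rewrite lte_fin; lra.
exists f; split => //; rewrite -lte_fin -cc_integralE//.
have mf : measurable_fun [set: borel X] (EFin \o f).
  by apply/measurable_EFinP; exact: cc_measurable.
have : \int[mu]_x u x <= \int[mu]_x (f x)%:E + e%:E * mu C.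
  have eH := uscH0_indic hausX (ltW e0) cC.
  rewrite -integral_EFin_indic//; [|exact: ltW|exact: compact_borel].
  rewrite -ge0_integralTD//; last 2 first.
  - exact: uscH0_measurable eH.
  - exact: eH.1.
  apply: ge0_le_integralT => //.
  - exact: uscH0_measurable.
  - by apply: emeasurable_funD => //; exact: uscH0_measurable eH.
  - move=> x; rewrite indicE; have [xC|xC] := boolP (x \in C).
      by rewrite mulr1 -EFinD ltW//; apply: Cf; exact/set_mem.
    rewrite mulr0 adde0 uC ?lee_fin//.
    by move=> Cx; rewrite mem_set in xC.
rewrite -(fineK muC) -EFinM => /(lt_le_trans aeu).
by rewrite cc_integralE// -EFinD !lte_fin ltrD2r.
Qed.

(** With [t] a continuous majorant of [h] of compact support, [t - h] is lower semicontinuous, and a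
    minorant [f] of it from [lsc_inner_cc] yields the majorant [t - f] of [h]. *)
Lemma usc_outer_cc mu (h : X -> \bar R) (a : R) : uscH0 h ->
  \int[mu]_x h x < a%:E -> exists f : X -> R, [/\ cc f,
    forall x, (0 <= f x)%R, forall x, h x <= (f x)%:E &
    (\int[mu]_x f x < a)%R].
Proof.
move=> hH ha; have [h0 hy uh _] := (uscH0P hausX h).1 hH.
have [M M0 [C cC hM]] := uscH0_bounded hH.
have [k [ck k01 kC _]] := @urysohn_cc R X hausX lcX C setT cC openT (@subsetT _ _).
pose t x := (M * k x)%R.
have ct : cc t by exact: ccZ.
have ht x : h x <= (t x)%:E.
  apply: (le_trans (hM x)); rewrite lee_fin ler_wpM2l// indicE.
  have [xC|xC] := boolP (x \in C); last by case/andP: (k01 x).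
  by rewrite kC//; exact/set_mem.
pose w x := (t x)%:E - h x.
have hfin x : h x \is a fin_num by rewrite ge0_fin_numE.
have lw : lscF w.
  split; first by move=> x; rewrite /w leeBrDr// add0e.
  apply: lscD => // [|x]; first exact: continuous_lsc ct.1.
  by move: (hfin x); case: (h x).
have wE : \int[mu]_x w x + \int[mu]_x h x = (\int[mu]_x t x)%R%:E.
  rewrite -(ge0_integralTD mu (lscF_measurable lw) (uscH0_measurable hH) lw.1 h0).
  rewrite -cc_integralE//; apply: eq_integral => x _.
  by rewrite /w subeK.
have hI := uscH0_integral_fin mu hH.
have [|f [cf f0 fw af]] := @lsc_inner_cc mu w (\int[mu]_x t x - a)%R lw.
  move: wE ha; rewrite -(fineK hI); case: (\int[mu]_x w x) => [r||]//= [].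
  by rewrite !lte_fin => <-; lra.
exists (fun x => t x - f x)%R; split.
- exact: ccB.
- move=> x; rewrite subr_ge0 -lee_fin; apply: (le_trans (fw x)).
  by rewrite /w leeBlDr// leeDl.
- move=> x; move: (hfin x) (fw x); rewrite /w; case: (h x) => // r _.
  by rewrite -EFinB !lee_fin; lra.
- by rewrite cc_integralB//; lra.
Qed.

End cc_integral.

(** * Radon measures from contents *)

Lemma ereal_inf_addr_ge (R : realType) (S : set \bar R) (b c : \bar R) :
  (forall x, S x -> 0 <= x) -> 0 <= b ->
  (forall x, S x -> c <= x + b) -> c <= ereal_inf S + b.
Proof.
move=> S0 b0 H; have inf0 : 0 <= ereal_inf S by apply: le_ereal_inf_tmp.
case: b b0 H => [b||]// b0 H; last by rewrite addey ?leey//; case: ereal_inf inf0.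
by rewrite -leeBlDr//; apply: le_ereal_inf_tmp => x /H; rewrite leeBlDr.
Qed.

Section content_extension.
Context (R : realType) (X : ptopologicalType).
Hypotheses (hausX : hausdorff_space X) (lcX : locally_compact [set: X]).
Variable lam : set X -> \bar R.
Hypotheses (lam0 : lam set0 = 0) (lam_ge0 : forall K, 0 <= lam K)
  (le_lam : forall K L, K `<=` L -> lam K <= lam L)
  (lam_fin : forall K, compact K -> lam K < +oo)
  (lamU : forall K L, compact K -> compact L -> lam (K `|` L) <= lam K + lam L)
  (lamDU : forall K L, compact K -> compact L -> K `&` L = set0 ->
    lam K + lam L <= lam (K `|` L)).

Definition content_open (U : set X) :=
  ereal_sup [set lam K | K in [set K | compact K /\ K `<=` U]].

Definition content_outer (A : set X) :=
  ereal_inf [set content_open U | U in [set U | open U /\ A `<=` U]].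

(* The supremum over compact K makes the resulting measure inner regular on
   all Borel sets, whereas content_outer is only outer regular. *)
Definition content_essential (A : set X) :=
  ereal_sup [set content_outer (A `&` K) | K in compact].

Let le_open_lam (U K : set X) : compact K -> K `<=` U -> lam K <= content_open U.
Proof. by move=> cK KU; apply: ereal_sup_ubound; exists K. Qed.

Let content_open_ge0 U : 0 <= content_open U.
Proof. by rewrite -lam0; apply: le_open_lam => //; exact: compact0. Qed.

Let content_outer_ge0 A : 0 <= content_outer A.
Proof. by apply: le_ereal_inf_tmp => _ [U _ <-]. Qed.

Let le_content_outer : {homo content_outer : A B / A `<=` B >-> A <= B}.
Proof.
move=> A B AB; apply: le_ereal_inf_tmp => _ [U [oU BU] <-].
by apply: ereal_inf_lbound; exists U => //; split => //; exact: subset_trans BU.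
Qed.

Let content_outer_open U : open U -> content_outer U <= content_open U.
Proof. by move=> oU; apply: ereal_inf_lbound; exists U; [split|]. Qed.

Let content_outer0 : content_outer set0 = 0.
Proof.
apply/eqP; rewrite eq_le content_outer_ge0 andbT.
apply: (le_trans (content_outer_open open0)).
by apply: ge_ereal_sup => _ [K [_ +] <-]; rewrite subset0 => ->; rewrite lam0.
Qed.

Let lam_bigcup (K : nat -> set X) n : (forall i, compact (K i)) ->
  lam (\big[setU/set0]_(i < n) K i) <= \sum_(i < n) lam (K i).
Proof.
move=> cK; elim: n => [|n ih]; first by rewrite !big_ord0 lam0.
rewrite !big_ord_recr /=.
apply: (@le_trans _ _ (lam (\big[setU/set0]_(i < n) K i) + lam (K n))).
  by apply: lamU => //; exact: bigsetU_compact.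
by rewrite leeD2r.
Qed.

Let content_open_bigcup (U : nat -> set X) : (forall n, open (U n)) ->
  content_open (\bigcup_n U n) <= \sum_(n <oo) content_open (U n).
Proof.
move=> oU; apply: ge_ereal_sup => _ [K [cK KU] <-].
(* [(n, C)] encodes a finite family of compact sets [C i] inside [U i], of which only those with
   [i < n] count. Compact neighbourhoods supply the local condition of [compact_directed]. *)
pose D := [set nC : nat * (nat -> set X) |
  forall i, compact (nC.2 i) /\ nC.2 i `<=` U i].
pose P (nC : nat * (nat -> set X)) := \big[setU/set0]_(i < nC.1) nC.2 i.
have PE nC x : P nC x <-> exists2 i, (i < nC.1)%N & nC.2 i x.
  rewrite /P -bigcup_mkord; split; first by move=> [i]; exists i.
  by move=> [i ? ?]; exists i.
have [|||[n C] /= DC KC] := @compact_directed _ _ K D P cK.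
- by exists (0%N, fun=> set0) => i /=; split => //; exact: compact0.
- move=> [n C] [m E] /= DC DE; exists (maxn n m, fun i => C i `|` E i) => /=.
    move=> i /=; split.
      by apply: compactU; [exact: (DC i).1|exact: (DE i).1].
    by move=> x [/(DC i).2|/(DE i).2].
  move=> x [] /PE/= [i ilt ix]; apply/PE => /=; exists i.
  - by rewrite leq_max ilt.
  - by left.
  - by rewrite leq_max ilt orbT.
  - by right.
- move=> x /KU[n _ Ux].
  have [C [cC CU] xC] := @compact_nbhs_in R X hausX lcX x (U n)
    (open_nbhs_nbhs (conj (oU n) Ux)).
  exists (n.+1, fun i => if i == n then C else set0).
    by move=> i /=; case: eqP => [->//|_]; split => //; exact: compact0.
  by exists C => // y [Cy _]; apply/PE => /=; exists n => //; rewrite eqxx.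
apply: (le_trans (le_lam KC)); apply: (le_trans (lam_bigcup _ _)) => /=.
  by move=> i; exact: (DC i).1.
apply: (@le_trans _ _ (\sum_(i < n) content_open (U i))).
  by apply: lee_sum => i _; apply: le_open_lam; [exact: (DC i).1|exact: (DC i).2].
rewrite -(big_mkord xpredT (fun i => content_open (U i))).
exact: nneseries_lim_ge.
Qed.

Let content_outer_sigma_subadditive : sigma_subadditive content_outer.
Proof.
move=> A; apply/lee_addgt0Pr => e e0.
apply: le_trans (epsilon_trick _ _ (ltW e0)) => //.
pose P n (U : set X) := [/\ open U, A n `<=` U &
  content_open U <= content_outer (A n) + (e / (2 ^ n.+1)%:R)%:E].
have [U UP] : {U : nat -> set X & forall n, P n (U n)}.
  apply: (@choice _ _ P) => n.
  have en : (0 < e / (2 ^ n.+1)%:R)%R by rewrite divr_gt0.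
  have [fA|] := boolP (content_outer (A n) \is a fin_num).
    have [_ [U [oU AU] <-] /ltW UA] := lb_ereal_inf_adherent en fA.
    by exists U.
  rewrite ge0_fin_numE// -leNgt leye_eq => /eqP oo.
  by exists setT; split => //; [exact: openT|rewrite oo leey].
apply: (@le_trans _ _ (content_open (\bigcup_n U n))).
  apply: (@le_trans _ _ (content_outer (\bigcup_n U n))).
    by apply: le_content_outer; apply: subset_bigcup => n _; case: (UP n).
  by apply: content_outer_open; apply: bigcup_open => n _; case: (UP n).
apply: (le_trans (content_open_bigcup _)); first by move=> n; case: (UP n).
by apply: lee_nneseries => n *; [exact: content_open_ge0|case: (UP n)].
Qed.

Let content_outer_fin K : compact K -> content_outer K \is a fin_num.
Proof.
move=> cK; rewrite ge0_fin_numE//.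
have [f [[cf _] _ fK [C [cC _] fC]]] :=
  @urysohn_cc R X hausX lcX K setT cK openT (@subsetT _ _).
apply: (@le_lt_trans _ _ (content_open (f @^-1` [set r | 0 < r]%R))).
  apply: ereal_inf_lbound; exists (f @^-1` [set r | 0 < r]%R) => //; split.
    by apply: open_comp => //; exact: open_gt.
  by move=> x /fK /= ->.
apply: le_lt_trans (lam_fin cC); apply: ge_ereal_sup => _ [L [_ LU] <-].
apply: le_lam => x /LU /=; apply: contraPP => /fC ->.
by rewrite ltxx.
Qed.

HB.instance Definition _ := isOuterMeasure.Build R X content_outer
  content_outer0 content_outer_ge0 le_content_outer
  content_outer_sigma_subadditive.

(** The Caratheodory sets form a sigma-algebra, so open [U] suffice. Given an open [V] containing
    [A], exhaust the intersection of [V] and [U] by compact [K], then [V] minus [K] by compact [L]: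
    the two are disjoint and [lamDU] applies. *)
Let content_outer_caratheodory (A : set (borel X)) : measurable A ->
  content_outer.-caratheodory A.
Proof.
move: A; apply: smallest_sub.
  split; first exact: caratheodory_measurable_set0.
  - by move=> A mA; rewrite setTD; exact: caratheodory_measurable_setC.
  - by move=> F mF; exact: caratheodory_measurable_bigcup.
move=> U oU; apply: le_caratheodory_measurable => A.
apply: le_ereal_inf_tmp => _ [V [oV AV] <-].
apply: (@le_trans _ _ (content_open (V `&` U) + content_outer (A `&` ~` U))).
  apply: leeD => //; apply: (@le_trans _ _ (content_outer (V `&` U))).
    by apply: le_content_outer; exact: setSI.
  by apply: content_outer_open; exact: openI.
apply: ereal_sup_addr_le => //.
- by exists (lam set0); exists set0 => //; split => //; exact: compact0.
- by move=> _ [K _ <-].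
move=> _ [K [cK KVU] <-]; have cloK := compact_closed hausX cK.
apply: (@le_trans _ _ (content_open (V `&` ~` K) + lam K)).
  rewrite addeC; apply: leeD => //; apply: (@le_trans _ _ (content_outer (V `&` ~` K))).
    apply: le_content_outer => x [Ax nUx]; split; first exact: AV.
    by move=> /KVU[].
  by apply: content_outer_open; apply: openI => //; exact: closed_openC.
apply: ereal_sup_addr_le => //.
- by exists (lam set0); exists set0 => //; split => //; exact: compact0.
- by move=> _ [L _ <-].
move=> _ [L [cL LVK] <-]; apply: le_trans (le_open_lam (compactU cL cK) _).
  apply: lamDU => //; rewrite -subset0 => x [Lx Kx].
  by have [] := LVK _ Lx.
by move=> x [/LVK[]//|/KVU[]].
Qed.

Let content_essential_ge0 A : 0 <= content_essential A.
Proof.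
apply: le_ereal_sup_tmp; exists (content_outer (A `&` set0)) => //.
by exists set0 => //; exact: compact0.
Qed.

Let le_content_essential :
  {homo content_essential : A B / A `<=` B >-> A <= B}.
Proof.
move=> A B AB; apply: ge_ereal_sup => _ [K cK <-].
apply: le_ereal_sup_tmp; exists (content_outer (B `&` K)); first by exists K.
by apply: le_content_outer; exact: setSI.
Qed.

Let content_essential_le A : content_essential A <= content_outer A.
Proof.
by apply: ge_ereal_sup => _ [K cK <-]; apply: le_content_outer => x [].
Qed.

Let content_essential0 : content_essential set0 = 0.
Proof.
apply/eqP; rewrite eq_le content_essential_ge0 andbT.
by rewrite (le_trans (content_essential_le _))// content_outer0.
Qed.

Let content_essential_sigma_subadditive : sigma_subadditive content_essential.
Proof.
move=> A; apply: ge_ereal_sup => _ [K cK <-].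
rewrite setI_bigcupl; apply: (le_trans (content_outer_sigma_subadditive _)).
apply: lee_nneseries => // n _.
by apply: le_ereal_sup_tmp; exists (content_outer (A n `&` K)) => //; exists K.
Qed.

HB.instance Definition _ := isOuterMeasure.Build R X content_essential
  content_essential0 content_essential_ge0 le_content_essential
  content_essential_sigma_subadditive.

(** The suprema for the two pieces run over different compact sets [K] and [L]; testing
    [content_outer] on their union dominates both at once. *)
Let content_essential_caratheodory (A : set (borel X)) : measurable A ->
  content_essential.-caratheodory A.
Proof.
move=> mA; apply: le_caratheodory_measurable => E.
have E0 : [set content_outer (E `&` A `&` K) | K in compact] !=set0.
  by exists (content_outer (E `&` A `&` set0)), set0 => //; exact: compact0.
apply: ereal_sup_addr_le => //; first by move=> _ [K _ <-].
move=> _ [K cK <-]; rewrite addeC; apply: ereal_sup_addr_le => //.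
- by exists (content_outer (E `&` ~` A `&` set0)), set0 => //; exact: compact0.
- by move=> _ [L _ <-].
move=> _ [L cL <-].
apply: (@le_trans _ _ (content_outer (E `&` (K `|` L)))).
  rewrite (content_outer_caratheodory mA (E `&` (K `|` L))) addeC leeD//.
    by apply: le_content_outer => x [[Ex Ax] Kx]; do 2?split => //; left.
  by apply: le_content_outer => x [[Ex Ax] Lx]; do 2?split => //; right.
by apply: le_ereal_sup_tmp; exists (content_outer (E `&` (K `|` L))) => //;
  exists (K `|` L) => //; exact: compactU.
Qed.

Definition content_measure : set (borel X) -> \bar R := content_essential.

Let content_measure_sigma_additive : semi_sigma_additive content_measure.
Proof.
move=> F mF tF mUF; apply: caratheodory_measure_sigma_additive => //.
  by move=> i; exact: (content_essential_caratheodory (mF i)).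
exact: (content_essential_caratheodory mUF).
Qed.

HB.instance Definition _ := isMeasure.Build _ _ _ content_measure
  content_essential0 content_essential_ge0 content_measure_sigma_additive.

Theorem content_extension : exists mu : radon_measure R X,
  (forall K, compact K -> lam K <= mu K) /\
  (forall U, open U ->
    mu U <= ereal_sup [set lam K | K in [set K | compact K /\ K `<=` U]]).
Proof.
have muK K : compact K -> content_measure K = content_outer K.
  move=> cK; apply/eqP; rewrite eq_le content_essential_le.
  by apply: le_ereal_sup_tmp; exists (content_outer (K `&` K)); [exists K|
    rewrite setIid].
have mufin K : compact K -> content_measure K < +oo.
  by move=> cK; rewrite muK// -ge0_fin_numE//; exact: content_outer_fin.
have muinner (A : set (borel X)) a : measurable A -> a < content_measure A ->
    exists2 K : set X, compact K /\ K `<=` A & a < content_measure K.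
  move=> mA /ereal_sup_gt[_ [K cK <-]].
  case: a => [a||] aAK; last 2 first.
  - by rewrite ltNge leey in aAK.
  - exists set0; first by split => //; exact: compact0.
    by apply: lt_le_trans (content_essential_ge0 _).
  have fAK B : content_outer (B `&` K) \is a fin_num.
    rewrite ge0_fin_numE// (le_lt_trans (le_content_outer _ : _ <= content_outer K))//.
    by rewrite -ge0_fin_numE//; exact: content_outer_fin.
  have [e e0] := lte_add_slack aAK ler01; rewrite mulr1 => aeAK.
  (* Inner approximation of [A] within [K] is outer approximation of [K] minus [A]: removing from
     [K] an open [U] that covers [K] minus [A] with excess below [e] leaves a compact subset of [A]
     and loses less than [e]. *)
  have [_ [U [oU KAU] <-] UK] := lb_ereal_inf_adherent e0 (fAK (~` A)).
  have {}UK : content_open U < content_outer (~` A `&` K) + e%:E := UK.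
  exists (K `&` ~` U).
    split; first by apply: compact_closedI => //; exact: open_closedC.
    by move=> x [Kx nUx]; apply: contrapT => nAx; apply: nUx; exact: KAU.
  rewrite muK; last by apply: compact_closedI => //; exact: open_closedC.
  have KE := content_outer_caratheodory mA K.
  have KE' := content_outer_caratheodory (open_borel oU) K.
  have KU : content_outer (K `&` U) <= content_open U.
    by apply: le_trans (content_outer_open oU); exact: le_content_outer.
  have {KU} KU := le_lt_trans KU UK.
  rewrite (setIC K A) (setIC K (~` A)) in KE.
  rewrite (setIC K U) (setIC K (~` U)) in KE'.
  rewrite (setIC K U) in KU.
  rewrite (setIC K (~` U)).
  move: KE' KU aeAK; rewrite {}KE.
  move: (fAK A) (fAK (~` A)) (fAK U) (fAK (~` U)).
  case: (content_outer _) => // r1 _; case: (content_outer _) => // r2 _.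
  case: (content_outer _) => // r3 _; case: (content_outer _) => // r4 _.
  by rewrite -!EFinD => -[]; rewrite !lte_fin; lra.
exists (RadonMeasure (is_radonP hausX mufin muinner)); split => [K cK|U oU] /=.
  by rewrite muK//; apply: le_ereal_inf_tmp => _ [U [oU KU] <-]; exact: le_open_lam.
by apply: le_trans (content_outer_open oU); exact: content_essential_le.
Qed.

End content_extension.

(** * Riesz representation *)

Section riesz.
Context (R : realType) (X : ptopologicalType).
Hypotheses (hausX : hausdorff_space X) (lcX : locally_compact [set: X]).

Definition layer (C : set X) (f : X -> R) (e : R) (k : nat) : set X :=
  C `&` [set x | e *+ k <= f x]%R.

(* Slicing f into the layers [min(f, (k+1) e) - min(f, k e)] determines
   Lambda f up to [e * m C] from the values of m on the compact sets
   [f >= k e] alone. *)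
Lemma layer_bounds (m : set X -> R) (Lambda : (X -> R) -> R)
    (C : set X) (f : X -> R) (e : R) (N : nat) :
  (forall f g, cc f -> cc g ->
    Lambda (fun x => f x + g x)%R = (Lambda f + Lambda g)%R) ->
  (forall c f, cc f -> Lambda (fun x => c * f x)%R = (c * Lambda f)%R) ->
  (forall K f, compact K -> cc f -> (forall x, 0 <= f x)%R ->
    (forall x, K x -> 1 <= f x)%R -> (m K <= Lambda f)%R) ->
  (forall K f, compact K -> cc f -> (forall x, 0 <= f x <= 1)%R ->
    (forall x, ~ K x -> f x = 0%R) -> (Lambda f <= m K)%R) ->
  cc f -> (forall x, 0 <= f x)%R -> compact C ->
  (forall x, ~ C x -> f x = 0%R) -> (0 < e)%R ->
  (forall x, f x <= e *+ N)%R ->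
  (e * \sum_(k < N) m (layer C f e k.+1) <= Lambda f <=
   e * \sum_(k < N) m (layer C f e k.+1) + e * m (layer C f e 0))%R.
Proof.
move=> LD LZ LA LB cf f0 cC fC e0 fN; pose K := layer C f e.
rewrite -/(K 0%N); under eq_bigr do rewrite -/(K _).
have cK k : compact (K k).
  apply: compact_closedI => //.
  by apply: (@closed_comp _ _ f [set r | e *+ k <= r]%R) => [x _|];
    [exact: cf.1|exact: closed_ge].
have L0 : Lambda (fun=> 0%R) = 0%R.
  rewrite -[RHS](mul0r (Lambda (fun=> 0%R))) -LZ; last exact: cc0.
  by congr Lambda; apply/funext => x; rewrite mulr0.
have m0 : (0 <= m (K N))%R.
  rewrite -L0; apply: LB => //; first exact: cc0.
  by move=> x; rewrite lexx ler01.
pose g k x := Num.min (f x) (e *+ k)%R.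
have cg k : cc (g k).
  split; first by apply: continuous_cmin; [exact: cf.1|exact: cst_continuous].
  exists C => // x /fC; rewrite /g => ->.
  by apply: min_l; rewrite mulrn_wge0// ltW.
(* The upper bound is sharpened by the telescoping term [- m (K N)], with which the induction
   closes: the slice from [n] to [n.+1] contributes between [e * m (K n.+1)] and [e * m (K n)]. *)
suff : (e * \sum_(k < N) m (K k.+1) <= Lambda (g N) <=
        e * \sum_(k < N) m (K k.+1) + e * (m (K 0%N) - m (K N)))%R.
  rewrite (_ : g N = f); last by apply/funext => x; apply: min_l.
  by move: m0 => + /andP[-> /le_trans] => m0; apply; rewrite lerD2l ler_pM2l//; lra.
clear fN m0; elim: N => [|n /andP[ih1 ih2]].
  rewrite big_ord0 mulr0 add0r subrr mulr0.
  have -> : Lambda (g 0%N) = 0%R; last by rewrite lexx.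
  rewrite -[RHS]L0; congr Lambda; apply/funext => x; rewrite /g mulr0n.
  exact: min_r.
pose phi x := (e^-1 * (g n.+1 x - g n x))%R.
have cphi : cc phi by apply: ccZ; apply: ccB.
have gE : Lambda (g n.+1) = (Lambda (g n) + e * Lambda phi)%R.
  rewrite -LZ// -LD//; last exact: ccZ.
  by congr Lambda; apply/funext => x; rewrite /phi mulrA divff ?mul1r ?gt_eqF//; ring.
have phi01 x : (0 <= phi x <= 1)%R.
  have : (0 <= g n.+1 x - g n x <= e)%R.
    rewrite /g mulrS !minEle; set t := (e *+ n)%R.
    by do 2![case: ifPn]; rewrite -?ltNge; lra.
  rewrite /phi => /andP[g0 ge]; rewrite mulr_ge0 ?invr_ge0 ?(ltW e0)//=.
  by rewrite ler_pdivrMl// mulr1.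
have phi1 x : K n.+1 x -> (1 <= phi x)%R.
  move=> [_ /= fx]; rewrite /phi /g (min_r fx) min_r; last first.
    by apply: le_trans fx; rewrite mulrS lerDr ltW.
  by rewrite mulrS addrK mulVf// gt_eqF.
have phi0 x : ~ K n x -> phi x = 0%R.
  move=> nKx; rewrite /phi /g.
  have fx : (f x <= e *+ n)%R.
    have [Cx|nCx] := pselect (C x); last by rewrite fC// mulrn_wge0// ltW.
    by rewrite leNgt; apply/negP => /ltW ?; apply: nKx; split.
  rewrite !min_l ?subrr ?mulr0//.
  by apply: (le_trans fx); rewrite mulrS lerDr ltW.
have low : (m (K n.+1) <= Lambda phi)%R.
  by apply: LA => // x; case/andP: (phi01 x).
have up : (Lambda phi <= m (K n))%R by apply: LB.
rewrite big_ord_recr /= mulrDr gE; apply/andP; split.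
  by rewrite lerD// ler_pM2l.
move: ih2 up; set T := (e * \sum_(_ < _) _)%R => ih2 up.
have : (e * Lambda phi <= e * m (K n))%R by rewrite ler_pM2l.
by move: ih2; rewrite !mulrBr; lra.
Qed.

Variable L : (X -> R) -> R.
Hypotheses
  (LD : forall f g, cc f -> cc g -> L (fun x => f x + g x)%R = (L f + L g)%R)
  (LZ : forall c f, cc f -> L (fun x => c * f x)%R = (c * L f)%R)
  (L_ge0 : forall f, cc f -> (forall x, 0 <= f x)%R -> (0 <= L f)%R).

Let L0 : L (fun=> 0%R) = 0%R.
Proof.
rewrite -[RHS](mul0r (L (fun=> 0%R))) -LZ; last exact: cc0.
by congr L; apply/funext => x; rewrite mulr0.
Qed.

Let LB f g : cc f -> cc g -> L (fun x => f x - g x)%R = (L f - L g)%R.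
Proof.
move=> cf cg; rewrite -mulN1r -LZ// -LD//; last exact: ccZ.
by congr L; apply/funext => x; rewrite mulN1r.
Qed.

Let le_L f g : cc f -> cc g -> (forall x, f x <= g x)%R -> (L f <= L g)%R.
Proof.
move=> cf cg fg; rewrite -subr_ge0 -LB//; apply: L_ge0; first exact: ccB.
by move=> x; rewrite subr_ge0.
Qed.

Let majorant (K : set X) := [set f : X -> R | [/\ cc f,
  forall x, (0 <= f x)%R & forall x, K x -> (1 <= f x)%R]].

Let lam (K : set X) := ereal_inf [set (L f)%:E | f in majorant K].

Let lam_le K f : majorant K f -> lam K <= (L f)%:E.
Proof. by move=> Kf; apply: ereal_inf_lbound; exists f. Qed.

Let lam_ge0 K : 0 <= lam K.
Proof.
by apply: le_ereal_inf_tmp => _ [f [cf f0 _] <-]; rewrite lee_fin L_ge0.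
Qed.

Let lam0 : lam set0 = 0.
Proof.
apply/eqP; rewrite eq_le lam_ge0 andbT -[leRHS]/(0%R%:E) -L0; apply: lam_le.
by split => //; exact: cc0.
Qed.

Let le_lam K M : K `<=` M -> lam K <= lam M.
Proof.
move=> KM; apply: le_ereal_inf_tmp => _ [f [cf f0 Mf] <-]; apply: lam_le.
by split => // x /KM; exact: Mf.
Qed.

Let lam_fin K : compact K -> lam K < +oo.
Proof.
move=> cK; have [f [cf f01 fK _]] :=
  @urysohn_cc R X hausX lcX K setT cK openT (@subsetT _ _).
apply: le_lt_trans (lam_le (_ : majorant K f)) _; last exact: ltry.
by split => // x; [case/andP: (f01 x)|move=> /fK ->].
Qed.

Let lamU K M : compact K -> compact M -> lam (K `|` M) <= lam K + lam M.
Proof.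
move=> cK cM; apply: ereal_inf_addr_ge => //.
  by move=> _ [f [cf f0 _] <-]; rewrite lee_fin L_ge0.
move=> _ [f [cf f0 Kf] <-]; rewrite addeC; apply: ereal_inf_addr_ge.
- by move=> _ [g [cg g0 _] <-]; rewrite lee_fin L_ge0.
- by rewrite lee_fin L_ge0.
move=> _ [g [cg g0 Mg] <-]; rewrite -EFinD -LD//; apply: lam_le; split.
- exact: ccD.
- by move=> x; rewrite addr_ge0.
- by move=> x [/Kf|/Mg] h; [have := g0 x|have := f0 x]; lra.
Qed.

Let lamDU K M : compact K -> compact M -> K `&` M = set0 ->
  lam K + lam M <= lam (K `|` M).
Proof.
move=> cK cM KM0; apply: le_ereal_inf_tmp => _ [f [cf f0 Mf] <-].
have [g [cg g01 gK gM]] := @disjoint_compact_separation R X hausX lcX K M cK cM KM0.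
have cgf : cc (fun x => g x * f x)%R by exact: ccMl.
have c1g : cc (fun x => (1 - g x) * f x)%R.
  apply: ccMl => //= x; apply: (@continuousB R R X); last exact: cg.
  exact: cst_continuous.
have -> : L f = (L (fun x => g x * f x) + L (fun x => (1 - g x) * f x))%R.
  by rewrite -LD//; congr L; apply/funext => x; ring.
rewrite EFinD leeD//; apply: lam_le; split => // x.
- by rewrite mulr_ge0//; case/andP: (g01 x).
- by move=> Kx; rewrite gK// mul1r; apply: Mf; left.
- by rewrite mulr_ge0//; case/andP: (g01 x); rewrite subr_ge0.
- by move=> Mx; rewrite gM// subr0 mul1r; apply: Mf; right.
Qed.

(** The content is the infimum of [L] over continuous majorants of the indicator. [L] and the
    integral against the extending measure both satisfy the hypotheses of [layer_bounds] with the
    masses of compact sets as [m], so on a nonnegative [f] vanishing off [C] they differ by at most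
    [e * mu C], for every [e]. *)
Theorem riesz : exists mu : radon_measure R X,
  forall f, cc f -> (\int[mu]_x f x)%R = L f.
Proof.
have [mu [lam_mu mu_open]] :=
  content_extension hausX lcX lam0 lam_ge0 le_lam lam_fin lamU lamDU.
exists mu.
have muK_le K f : compact K -> majorant K f -> (fine (mu K) <= L f)%R.
  move=> cK [cf f0 Kf]; rewrite leNgt; apply/negP => Lm.
  have l0 := L_ge0 cf f0; set M := fine (mu K) in Lm.
  (* [c * M] is the midpoint of [L f] and [M], so [c < 1] and [L f / c < M]. The open set where
     [f > c] contains [K], and [f / c] is at least 1 on each of its compact subsets. *)
  pose c := ((L f + M) / (2 * M))%R; have M0 : (0 < M)%R by lra.
  have c0 : (0 < c)%R by rewrite divr_gt0//; lra.
  have c1 : (c < 1)%R by rewrite ltr_pdivrMr; lra.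
  have cM : (c * M = (L f + M) / 2)%R by rewrite /c; field; lra.
  have : mu K <= (c^-1 * L f)%:E.
    apply: (@le_trans _ _ (mu (f @^-1` [set r | c < r]%R))).
      apply: le_measure; rewrite ?inE.
      - exact: compact_borel.
      - apply: open_borel; apply: open_comp; last exact: open_gt.
        by move=> x _; exact: cf.1.
      - by move=> x /Kf /= /(lt_le_trans c1).
    apply: (le_trans (mu_open _ _)).
      by apply: open_comp; [move=> x _; exact: cf.1|exact: open_gt].
    apply: ge_ereal_sup => _ [M' [cM' M'U] <-]; rewrite -LZ//; apply: lam_le.
    split; first exact: ccZ.
    - by move=> x; rewrite mulr_ge0// invr_ge0 ltW.
    - by move=> x /M'U /= /ltW h; rewrite ler_pdivlMl// mulr1.
  rewrite -(fineK (radon_compact_fin mu cK)) lee_fin -/M ler_pdivlMl//.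
  by rewrite cM; lra.
have LleK K f : compact K -> cc f -> (forall x, 0 <= f x <= 1)%R ->
    (forall x, ~ K x -> f x = 0%R) -> (L f <= fine (mu K))%R.
  move=> cK cf f01 fK; rewrite -lee_fin fineK; last exact: radon_compact_fin.
  apply: le_trans (lam_mu _ cK); apply: le_ereal_inf_tmp => _ [g [cg g0 Kg] <-].
  rewrite lee_fin; apply: le_L => // x; have [Kx|nKx] := pselect (K x).
    by apply: le_trans (Kg _ Kx); case/andP: (f01 x).
  by rewrite fK.
have indicI K : compact K -> \int[mu]_x (\1_K x)%:E = (fine (mu K))%:E.
  move=> cK; rewrite integral_indic ?setIT ?fineK//.
    exact: radon_compact_fin.
  exact: compact_borel.
have mindic K : compact K -> measurable_fun [set: borel X] (EFin \o \1_K : X -> \bar R).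
  by move=> cK; apply/measurable_EFinP; apply: measurable_indic; exact: compact_borel.
have mcc f : cc f -> measurable_fun [set: borel X] (EFin \o f).
  by move=> cf; apply/measurable_EFinP; exact: cc_measurable.
have muIK K f : compact K -> cc f -> (forall x, 0 <= f x)%R ->
    (forall x, K x -> 1 <= f x)%R -> (fine (mu K) <= \int[mu]_x f x)%R.
  move=> cK cf f0 Kf; rewrite -lee_fin -indicI// -cc_integralE//.
  apply: ge0_le_integralT; [exact: mindic|exact: mcc|..] => x.
    by rewrite lee_fin.
  rewrite lee_fin indicE; have [/set_mem/Kf//|_] := boolP (x \in K).
  exact: f0.
have IleK K f : compact K -> cc f -> (forall x, 0 <= f x <= 1)%R ->
    (forall x, ~ K x -> f x = 0%R) -> (\int[mu]_x f x <= fine (mu K))%R.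
  move=> cK cf f01 fK; rewrite -lee_fin -indicI// -cc_integralE//.
  apply: ge0_le_integralT; [exact: mcc|exact: mindic|..] => x.
    by rewrite lee_fin; case/andP: (f01 x).
  rewrite lee_fin indicE; have [xK|xK] := boolP (x \in K).
    by case/andP: (f01 x).
  by rewrite fK// => Kx; rewrite mem_set in xK.
have pos f : cc f -> (forall x, 0 <= f x)%R -> (\int[mu]_x f x)%R = L f.
  move=> cf f0; have [_ [C cC fC]] := cf.
  have [b b0 [B cB fB]] := uscH0_bounded hausX (cc_C0plus hausX cf f0).2.
  have fb x : (f x <= b)%R.
    have := fB x; rewrite lee_fin => /le_trans; apply.
    by rewrite indicE ler_piMr//; case: (_ \in _).
  pose M := fine (mu C); have M0 : (0 <= M)%R by exact: fine_ge0.
  apply: contrapT => /eqP; rewrite -subr_eq0 -normr_gt0.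
  (* The denominator [M + 1] makes [e * M < d], whereas the two layer estimates would give
     [d <= e * M]. *)
  set d := `| _ |%R => d0; pose e := (d / (M + 1))%R.
  have e0 : (0 < e)%R by rewrite divr_gt0//; lra.
  have fN x : (f x <= e *+ (Num.truncn (b / e)).+1)%R.
    apply: (le_trans (fb x)); rewrite -mulr_natr -ler_pdivrMl// mulrC ltW//.
    exact: truncnS_gt.
  have bounds := layer_bounds _ _ _ _ cf f0 cC fC e0 fN.
  have /andP[L1 L2] := bounds (fun K => fine (mu K)) L LD LZ
    (fun K g cK cg g0 Kg => muK_le K g cK (And3 cg g0 Kg)) LleK.
  have /andP[I1 I2] := bounds (fun K => fine (mu K)) (fun g => \int[mu]_x g x)%R
    (cc_integralD hausX mu) (fun c g => @cc_integralZ R X hausX mu c g) muIK IleK.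
  have cK0 : compact (layer C f e 0).
    rewrite /layer (_ : [set x | _] = setT) ?setIT//.
    by apply/seteqP; split => // x _ /=; rewrite mulr0n.
  have m0 : (fine (mu (layer C f e 0)) <= M)%R.
    rewrite fine_le ?radon_compact_fin//; apply: le_measure; rewrite ?inE.
    - exact: compact_borel.
    - exact: compact_borel.
    - by move=> x [].
  have : (e * fine (mu (layer C f e 0)) <= e * M)%R by rewrite ler_pM2l.
  have eM : (e * M + e = d)%R by rewrite /e; field; lra.
  move: L1 L2 I1 I2; set S := (e * \sum_(_ < _) _)%R; set T := (e * fine _)%R.
  move=> L1 L2 I1 I2 TM; have : (d <= T)%R by rewrite ler_norml; lra.
  by lra.
move=> f cf; have cp : cc (fun x => Num.max (f x) 0%R) by apply: cc_max => //; exact: cc0.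
have cn : cc (fun x => Num.max (f x) 0%R - f x)%R by exact: ccB.
have fE : f = (fun x => Num.max (f x) 0 - (Num.max (f x) 0 - f x))%R.
  by apply/funext => x; rewrite opprB addrC subrK.
rewrite fE cc_integralB// LB// !pos// => x.
- by rewrite subr_ge0 le_max lexx.
- by rewrite le_max lexx orbT.
Qed.

End riesz.

(** * The vague topology *)

Lemma ptws_cvgP (I : Type) (V : topologicalType)
    (F : set_system {ptws I -> V}) (f : {ptws I -> V}) : Filter F ->
  F --> f <-> forall i, g i @[g --> F] --> f i.
Proof.
move=> FF; split => [/cvg_sup cF i A fA|cF].
  exact: cF (@initial_continuous _ _ (fun g : {ptws I -> V} => g i) f A fA).
apply/cvg_sup => i A /= [_ [[B oB <-] Bf BA]].
by apply: filterS BA _; apply: cF; exact: open_nbhs_nbhs.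
Qed.

Section vague.
Context (R : realType) (X : ptopologicalType).
Hypotheses (hausX : hausdorff_space X) (lcX : locally_compact [set: X]).
Implicit Types (mu nu : radon_measure R X).

Lemma vague_continuous (f : X -> R) : cc f ->
  continuous (fun mu : radon_measure R X => \int[mu]_x f x)%R.
Proof.
move=> cf mu.
pose F := MkCc cf.1 (cc_compact_support hausX cf).
apply: (@continuous_comp _ _ _ (@vague_eval R X)
  (fun g : {ptws Cc R X -> R} => g F)).
  exact: initial_continuous.
have [/(_ cvg_id) cF _] :=
  @ptws_cvgP (Cc R X) R (nbhs (vague_eval mu)) (vague_eval mu) _.
exact: cF F.
Qed.

Lemma vague_cvg (F : set_system (radon_measure R X)) mu : Filter F ->
  (forall f : X -> R, cc f ->
    (fun nu : radon_measure R X => \int[nu]_x f x)%R @ F -->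
    (\int[mu]_x f x)%R) ->
  F --> mu.
Proof.
move=> FF Fmu A /= [_ [[B oB <-] Bmu BA]].
have cvgF : @vague_eval R X @ F --> vague_eval mu.
  apply/ptws_cvgP => -[f cf sf]; apply: Fmu; split => //.
  exists (closure [set x | f x != 0%R]) => // x nx.
  by apply/eqP/negPn/negP => fx; apply: nx; exact: subset_closure.
have : F (@vague_eval R X @^-1` B) by apply: cvgF; exact: open_nbhs_nbhs.
exact: filterS.
Qed.

Lemma ultra_bounded_cvg (T : Type) (F : set_system T) (h : T -> R) (B : R) :
  UltraFilter F -> F [set t | `|h t| <= B]%R -> exists l : R, h @ F --> l.
Proof.
move=> FU FB; have FP := @ultra_proper _ _ FU.
have cB : compact `[(- B)%R, B]%classic by exact: segment_compact.
have hB : (h @ F) `[(- B)%R, B]%classic.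
  by apply: (@filterS _ F _ _ _ _ FB) => t /=; rewrite in_itv /= ler_norml.
have [l [_ cl]] := cB (h @ F) _ hB.
exists l => V lV; have [//|FnV] := in_ultra_setVsetC (h @^-1` V) FU.
by have [r []] := cl (~` V) V FnV lV.
Qed.

(** Along an ultrafilter every bounded real function converges, so the integrals of all test
    functions converge simultaneously and their limits form a positive linear functional. *)
Lemma radon_vague_limit (F : set_system (radon_measure R X)) :
  UltraFilter F ->
  (forall K, compact K -> exists M : R, F [set mu | mu K <= M%:E]) ->
  exists mu, F --> mu.
Proof.
move=> FU FK; have FP := @ultra_proper _ _ FU.
pose L (f : X -> R) := lim ((fun mu : radon_measure R X => \int[mu]_x f x)%R @ F).
have Lcvg f : cc f -> (fun mu : radon_measure R X => \int[mu]_x f x)%R @ F --> L f.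
  move=> cf; suff [l Hl] : exists l : R,
      (fun mu : radon_measure R X => \int[mu]_x f x)%R @ F --> l.
    by rewrite /L (cvg_lim _ Hl).
  have ca := cc_abs cf.
  have aH := (cc_C0plus hausX ca (fun=> normr_ge0 _)).2.
  have [b b0 [C cC fb]] := uscH0_bounded hausX aH.
  have [M FM] := FK _ cC.
  apply: (@ultra_bounded_cvg _ F _ (b * M)%R) => //.
  apply: filterS FM => mu /= muM.
  apply: (@le_trans _ _ (\int[mu]_x `|f x|)%R).
    have cN : cc (fun x => -1 * `|f x|)%R by exact: ccZ.
    rewrite ler_norml; apply/andP; split.
      rewrite -[X in (X <= _)%R]mulN1r -cc_integralZ//.
      by apply: cc_le_integral => // x; rewrite mulN1r lerNl -normrN ler_norm.
    by apply: cc_le_integral => // x; exact: ler_norm.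
  rewrite -lee_fin -cc_integralE//.
  apply: (@le_trans _ _ (\int[mu]_x (b * \1_C x)%:E)).
    apply: ge0_le_integralT.
    - exact: uscH0_measurable aH.
    - by apply: uscH0_measurable; exact: uscH0_indic.
    - by move=> x; rewrite lee_fin.
    - exact: fb.
  rewrite integral_EFin_indic//; last exact: compact_borel.
  by rewrite EFinM; apply: lee_wpmul2l.
have Lim f (l : R) : (fun mu : radon_measure R X => \int[mu]_x f x)%R @ F --> l -> L f = l.
  by move=> Hl; rewrite /L (cvg_lim _ Hl).
have [mu muL] : exists mu : radon_measure R X,
    forall f, cc f -> (\int[mu]_x f x)%R = L f.
  apply: riesz => //.
  - move=> f g cf cg; apply: Lim.
    under eq_fun do rewrite cc_integralD//.
    by apply: cvgD; exact: Lcvg.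
  - move=> c f cf; apply: Lim.
    under eq_fun do rewrite cc_integralZ//.
    by apply: cvgMr; exact: Lcvg.
  - move=> f cf f0; apply: (limr_ge (x := 0%R)).
      by apply/cvg_ex; exists (L f); exact: Lcvg.
    apply: nearW => mu; rewrite /Rintegral fine_ge0//.
    by apply: integral_ge0 => x _; rewrite lee_fin.
by exists mu; apply: vague_cvg => f cf; rewrite muL//; exact: Lcvg.
Qed.

End vague.

(** * Energy *)

Section kernel_energy.
Context (R : realType) (X : ptopologicalType).
Hypotheses (hausX : hausdorff_space X) (lcX : locally_compact [set: X]).
Variable G : X -> X -> \bar R.
Hypothesis kerG : is_kernel G.
Implicit Types (mu nu : radon_measure R X).

Local Notation pot := (potential G).
Local Notation energy := (mutual_energy G).

Lemma kernel_ge0 x y : 0 <= G x y.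
Proof. by case: kerG. Qed.

Lemma kernel_lsc_at x y (a : R) : a%:E < G x y ->
  exists2 U, nbhs x U & exists2 V, nbhs y V &
    forall x' y', U x' -> V y' -> a%:E < G x' y'.
Proof.
case: kerG => _ lG _ _ aG.
have [W [[U V] /= [xU yV] UVW] WG] := lG (x, y) a aG.
exists U => //; exists V => // x' y' Ux' Vy'.
by have /WG := UVW (x', y') (conj Ux' Vy').
Qed.

Lemma kernel_slice_lscF x : lscF (G x).
Proof.
split; first exact: kernel_ge0.
move=> y a /kernel_lsc_at[U xU [V yV UV]]; exists V => // y' Vy'.
by apply: UV => //; exact: nbhs_singleton.
Qed.

Lemma potential_ge0 mu x : 0 <= pot mu x.
Proof. by apply: integral_ge0 => y _; exact: kernel_ge0. Qed.

Lemma mutual_energy_ge0 mu nu : 0 <= energy mu nu.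
Proof. by apply: integral_ge0 => x _; exact: potential_ge0. Qed.

(** Joint lower semicontinuity of [G] gives, by a tube argument over the compact support of [f], one
    [psi] lying below [G x'] for all [x'] near [x]. Both the semicontinuity of potentials and the
    tensor approximation rest on it. *)
Lemma kernel_local_minorant mu x (b : R) : b%:E < pot mu x ->
  exists psi : X -> R, [/\ cc psi, forall y, (0 <= psi y)%R,
    (b < \int[mu]_y psi y)%R &
    exists2 U, nbhs x U & forall x', U x' -> forall y, (psi y)%:E <= G x' y].
Proof.
move=> bx.
have [f [cf f0 fG bf]] := lsc_inner_cc hausX lcX (kernel_slice_lscF x) bx.
have [_ [C cC fC]] := cf.
have [k [ck k01 kC _]] := @urysohn_cc R X hausX lcX C setT cC openT (@subsetT _ _).
have k0 : (0 <= \int[mu]_y k y)%R.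
  apply: fine_ge0; apply: integral_ge0 => y _.
  by rewrite lee_fin; case/andP: (k01 y).
have [e e0] := lte_add_slack (bf : b%:E < (\int[mu]_x f x)%R%:E) k0.
rewrite lte_fin => bef.
(* Lowering [f] by [e] on [C], where [k = 1], leaves room for semicontinuity to act uniformly; [e]
   is small enough for the integral to stay above [b]. *)
pose psi y := Num.max (f y - e * k y)%R 0%R.
have cpsi : cc psi by apply: cc_max; [apply: ccB => //; exact: ccZ|exact: cc0].
have psi0 y : (0 <= psi y)%R by rewrite le_max lexx orbT.
have [|||U xU CU] := @compact_directed _ _ C [set U | nbhs x U]
  (fun U => [set y | forall x', U x' -> (psi y)%:E <= G x' y]) cC.
- by exists setT; exact: filterT.
- move=> U V xU xV; exists (U `&` V); first exact: filterI.
  by move=> y [] /= H x' [Ux' Vx']; exact: H.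
- move=> y Cy.
  have [|U xU [V yV UV]] := @kernel_lsc_at x y (f y - e / 2)%R.
    by apply: lt_le_trans (fG y); rewrite lte_fin ltrBlDr ltrDl divr_gt0.
  exists U => //.
  exists (V `&` [set z | f z < f y + e / 2]%R).
    apply: filterI => //; apply: (cvgr_lt (f y) (cf.1 y)).
    by rewrite ltrDl divr_gt0.
  move=> z [[Vz /= fz] Cz] x' Ux'; rewrite /psi EFin_max ge_max kernel_ge0 andbT.
  apply: le_trans (ltW (UV _ _ Ux' Vz)); rewrite lee_fin kC// mulr1; lra.
exists psi; split => //.
  apply: (@lt_le_trans _ _ (\int[mu]_x (f x - e * k x))%R).
    by rewrite cc_integralB ?cc_integralZ//; [lra|exact: ccZ].
  apply: cc_le_integral => //; first by apply: ccB => //; exact: ccZ.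
  by move=> y; rewrite le_max lexx.
exists U => // x' Ux' y; have [Cy|nCy] := pselect (C y); first exact: CU.
rewrite /psi fC// max_r ?kernel_ge0//.
by rewrite subr_le0 mulr_ge0 ?(ltW e0)//; case/andP: (k01 y).
Qed.

Lemma potential_lscF mu : lscF (pot mu).
Proof.
split; first exact: potential_ge0.
move=> x b /kernel_local_minorant[psi [cpsi psi0 bpsi [U xU UG]]].
exists U => // x' Ux'; apply: (@lt_le_trans _ _ (\int[mu]_y (psi y)%:E)).
  by rewrite cc_integralE// lte_fin.
apply: ge0_le_integralT.
- by apply/measurable_EFinP; exact: cc_measurable.
- by apply: lscF_measurable; exact: kernel_slice_lscF.
- by move=> y; rewrite lee_fin.
- exact: UG.
Qed.

Definition ccp := {f : X -> R | cc f /\ forall x, (0 <= f x)%R}.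

Lemma ccp_cc (p : ccp) : cc (sval p).
Proof. by case: p => f []. Qed.

Lemma ccp_ge0 (p : ccp) x : (0 <= sval p x)%R.
Proof. by case: p => f [_ /=]. Qed.

Lemma ccp_integral_ge0 (p : ccp) mu : (0 <= \int[mu]_x sval p x)%R.
Proof.
apply: fine_ge0; apply: integral_ge0 => y _; rewrite lee_fin; exact: ccp_ge0.
Qed.

Definition tensor_eval (l : seq (ccp * ccp)) (x y : X) : R :=
  (\sum_(p <- l) sval p.1 x * sval p.2 y)%R.

(** The double integral of [tensor_eval l x y] against [mu] in [y] and [nu] in [x], evaluated factor
    by factor: no product measure is involved, and vague continuity in both measures is visible. *)
Definition tensor_energy (l : seq (ccp * ccp)) mu nu : R :=
  (\sum_(p <- l) (\int[mu]_y sval p.2 y) * (\int[nu]_x sval p.1 x))%R.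

Definition tensor_minorant (l : seq (ccp * ccp)) :=
  forall x y, (tensor_eval l x y)%:E <= G x y.

Lemma cc_lsum (I : Type) (l : seq I) (c : I -> R) (f : I -> X -> R) mu :
  (forall i, cc (f i)) ->
  (\int[mu]_x (\sum_(i <- l) c i * f i x) =
   \sum_(i <- l) c i * \int[mu]_x f i x)%R.
Proof.
move=> cf; elim: l => [|i l ih].
  under eq_Rintegral do rewrite big_nil.
  by rewrite big_nil /Rintegral integral0.
under eq_Rintegral do rewrite big_cons.
rewrite big_cons -ih cc_integralD ?cc_integralZ//; first exact: ccZ.
by apply: cc_sum => j; exact: ccZ.
Qed.

Lemma tensor_energy_le l mu nu : tensor_minorant l ->
  (tensor_energy l mu nu)%:E <= energy mu nu.
Proof.
move=> lG.
have cl2 (p : ccp * ccp) : cc (sval p.2) by exact: ccp_cc.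
have cl1 (p : ccp * ccp) : cc (sval p.1) by exact: ccp_cc.
rewrite /tensor_energy -cc_lsum// -cc_integralE//; last first.
  by apply: cc_sum => p; exact: ccZ.
apply: ge0_le_integralT.
- apply/measurable_EFinP; apply: cc_measurable.
  by apply: cc_sum => p; exact: ccZ.
- exact: lscF_measurable (potential_lscF mu).
- move=> x; rewrite lee_fin sumr_ge0// => p _; rewrite mulr_ge0//.
    exact: ccp_integral_ge0.
  exact: ccp_ge0.
move=> x; under eq_bigr do rewrite mulrC.
rewrite -cc_lsum// -cc_integralE//; last by apply: cc_sum => p; exact: ccZ.
apply: ge0_le_integralT.
- apply/measurable_EFinP; apply: cc_measurable.
  by apply: cc_sum => p; exact: ccZ.
- exact: lscF_measurable (kernel_slice_lscF x).
- move=> y; rewrite lee_fin sumr_ge0// => p _; rewrite mulr_ge0//;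
    exact: ccp_ge0.
- exact: lG.
Qed.

(** A continuous [phi] below [pot mu] is distributed by a partition of unity over finitely many
    local minorants of the slices of [G]. Each gets the coefficient [phi / m], with [m] its integral
    against [mu]; this is at most 1 where the corresponding bump lives, so the sum stays below [G],
    and its integral in [y] returns [phi]. *)
Lemma tensor_energy_gt mu nu (a : R) : a%:E < energy mu nu ->
  exists2 l, tensor_minorant l & (a < tensor_energy l mu nu)%R.
Proof.
move=> aE.
have [f [cf f0 fG af]] := lsc_inner_cc hausX lcX (potential_lscF mu) aE.
have [_ [C cC fC]] := cf.
have [k [ck k01 kC _]] := @urysohn_cc R X hausX lcX C setT cC openT (@subsetT _ _).
have k0 : (0 <= \int[nu]_y k y)%R.
  apply: fine_ge0; apply: integral_ge0 => y _.
  by rewrite lee_fin; case/andP: (k01 y).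
have [e e0] := lte_add_slack (af : a%:E < (\int[nu]_x f x)%R%:E) k0.
rewrite lte_fin => aef.
pose phi y := Num.max (f y - e * k y)%R 0%R.
have cphi : cc phi by apply: cc_max; [apply: ccB => //; exact: ccZ|exact: cc0].
have phi0 y : (0 <= phi y)%R by rewrite le_max lexx orbT.
have aphi : (a < \int[nu]_x phi x)%R.
  apply: (@lt_le_trans _ _ (\int[nu]_x (f x - e * k x))%R).
    by rewrite cc_integralB ?cc_integralZ//; [lra|exact: ccZ].
  apply: cc_le_integral => //; first by apply: ccB => //; exact: ccZ.
  by move=> y; rewrite le_max lexx.
have phiC x : ~ C x -> phi x = 0%R.
  move=> nCx; rewrite /phi fC// max_r// subr_le0 mulr_ge0 ?(ltW e0)//.
  by case/andP: (k01 x).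
pose Q (p : ccp * ccp) := forall x, sval p.1 x != 0%R ->
  (phi x <= \int[mu]_y sval p.2 y)%R /\ forall y, (sval p.2 y)%:E <= G x y.
pose S (l : seq {p | Q p}) x := (\sum_(p <- l) sval (sval p).1 x)%R.
have S_ge0 l x : (0 <= S l x)%R.
  by apply: sumr_ge0 => p _; exact: ccp_ge0.
have [|||l _ lC] := @compact_directed _ _ C setT
    (fun l => [set x | 1 < S l x]%R) cC.
- by exists [::].
- move=> l1 l2 _ _; exists (l1 ++ l2) => // x; rewrite /S /= big_cat /=.
  rewrite -/(S l1 x) -/(S l2 x); have := S_ge0 l1 x; have := S_ge0 l2 x.
  by move=> ? ? [|]; lra.
- move=> x Cx.
  have fx : (f x - e / 2)%:E < pot mu x.
    by apply: lt_le_trans (fG x); rewrite lte_fin ltrBlDr ltrDl divr_gt0.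
  have [psi [cpsi psi0 bpsi [U xU UG]]] := kernel_local_minorant fx.
  pose V := (U `&` [set z | f z - e * k z < \int[mu]_y psi y]%R)°.
  have xV : nbhs x V.
    apply: nbhs_interior; apply: filterI => //.
    have ch : cc (fun z => f z - e * k z)%R by apply: ccB => //; exact: ccZ.
    apply: (cvgr_lt (f x - e * k x)%R (ch.1 x)).
    by rewrite kC// mulr1; lra.
  have [u [cu u01 ux [D [cD DV] uD]]] := @urysohn_cc R X hausX lcX [set x] V
    (@compact_set1 _ _) (@open_interior _ _)
    (fun y (yx : y = x) => eq_ind_r V (nbhs_singleton xV) yx).
  have c2u : cc (fun z => 2 * u z)%R by exact: ccZ.
  have u20 z : (0 <= 2 * u z)%R by rewrite mulr_ge0//; case/andP: (u01 z).
  pose p : ccp * ccp := (exist _ _ (conj c2u u20), exist _ _ (conj cpsi psi0)).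
  have Qp : Q p.
    move=> z /= uz; have /DV/interior_subset[Uz /= /ltW phiz] : D z.
      by apply: contrapT => /uD u0; move: uz; rewrite u0 mulr0 eqxx.
    split; last by move=> y; exact: UG.
    by rewrite /phi ge_max phiz; exact: (ccp_integral_ge0 p.2 mu).
  exists [:: exist _ p Qp] => //.
  exists [set z | 1 < 2 * u z]%R.
    by apply: (cvgr_gt (2 * u x)%R (c2u.1 x)); rewrite ux// mulr1; lra.
  by move=> z [/= uz _]; rewrite /S big_cons big_nil addr0.
pose m (p : ccp * ccp) := (\int[mu]_y sval p.2 y)%R.
have m_ge0 p : (0 <= m p)%R by exact: ccp_integral_ge0.
(* [S l > 1] on [C], so [w] times the bumps sums to 1 there; the maximum with 1 keeps [w] continuous
   and the sum at most 1 elsewhere. *)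
pose w x := (Num.max 1 (S l x))^-1%R.
have cS : cc (S l) by apply: cc_sum => p; exact: ccp_cc.
have cw : continuous w.
  move=> x; apply: (@cvgV R X).
    by rewrite gt_eqF// lt_max ltr01.
  by apply: continuous_cmax => //; [exact: cst_continuous|exact: cS.1].
have w0 x : (0 <= w x)%R by rewrite invr_ge0 le_max ler01.
(* If [m] vanishes, its inverse is 0 by convention and the term drops out; nothing is lost, since
   then [phi] vanishes wherever the bump does not. *)
pose al (p : {p | Q p}) x := ((m (sval p))^-1 * (phi x * (w x * sval (sval p).1 x)))%R.
have cal p : cc (al p).
  by apply: ccZ; apply: ccMl; [exact: cphi.1|apply: ccMl => //; exact: ccp_cc].
have al0 p x : (0 <= al p x)%R.
  apply: mulr_ge0; first by rewrite invr_ge0.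
  by apply: mulr_ge0 => //; apply: mulr_ge0 => //; exact: ccp_ge0.
pose mk (p : {p | Q p}) : ccp * ccp := (exist _ (al p) (conj (cal p) (al0 p)), (sval p).2).
exists [seq mk p | p <- l].
- move=> x y; rewrite /tensor_eval big_map /=.
  case Gxy : (G x y) (kernel_ge0 x y) => [t||]; [|by move=> _; rewrite leey|by []].
  rewrite !lee_fin => t0.
  apply: (@le_trans _ _ (\sum_(p <- l) (w x * sval (sval p).1 x) * t)%R).
    apply: ler_sum => p _; rewrite /al; set u := sval (sval p).1 x.
    have u0 : (0 <= u)%R by exact: ccp_ge0.
    have [->|un0] := eqVneq u 0%R; first by rewrite !(mulr0,mul0r).
    have [phim] := svalP p x un0; rewrite -/(m (sval p)) in phim.
    move=> /(_ y); rewrite Gxy lee_fin => pt.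
    have p20 : (0 <= sval (sval p).2 y)%R by exact: ccp_ge0.
    have wu : (0 <= w x * u)%R by rewrite mulr_ge0.
    have r1 : ((m (sval p))^-1 * phi x <= 1)%R.
      have := m_ge0 (sval p); rewrite le_eqVlt => /orP[/eqP <-|mp].
        by rewrite invr0 mul0r ler01.
      by rewrite ler_pdivrMl// mulr1.
    apply: (@le_trans _ _ (w x * u * sval (sval p).2 y)%R).
      rewrite (_ : (_ * sval (sval p).2 y)%R = ((m (sval p))^-1 * phi x *
        (w x * u * sval (sval p).2 y))%R); last by ring.
      by rewrite ler_piMl// mulr_ge0.
    by rewrite ler_wpM2l.
  rewrite -mulr_suml -mulr_sumr -/(S l x) ler_piMl//.
  by rewrite /w mulrC ler_pdivrMr ?lt_max ?ltr01// mul1r le_max lexx orbT.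
- apply: (lt_le_trans aphi); rewrite /tensor_energy big_map /=.
  rewrite -cc_lsum; last by move=> p; exact: cal.
  apply: cc_le_integral => //; first by apply: cc_sum => p; exact: ccZ.
  move=> x; rewrite -/(m _).
  have -> : (\sum_(p <- l) m (sval p) * al p x = phi x * (w x * S l x))%R.
    rewrite /S !mulr_sumr; apply: eq_bigr => p _; rewrite /al.
    have [m0|mn0] := eqVneq (m (sval p)) 0%R; last by rewrite mulrA divff// mul1r.
    rewrite m0 mul0r; have [->|un0] := eqVneq (sval (sval p).1 x) 0%R.
      by rewrite !mulr0.
    have [] := svalP p x un0; rewrite -/(m (sval p)) m0 => phx _.
    by rewrite (_ : phi x = 0%R) ?mul0r//; apply/le_anti; rewrite phx phi0.
  have [Cx|nCx] := pselect (C x); last by rewrite phiC// mul0r.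
  rewrite /w max_r; last by apply/ltW; exact: lC.
  by rewrite mulVf ?mulr1// gt_eqF//; have := lC _ Cx; rewrite /=; lra.
Qed.

End kernel_energy.

(** * Scaling, sum and restriction of Radon measures *)

Section radon_operations.
Context (R : realType) (X : ptopologicalType).
Hypotheses (hausX : hausdorff_space X).
Implicit Types (mu nu : radon_measure R X).

Lemma radon_zero : exists rho : radon_measure R X,
  forall f : borel X -> \bar R, \int[rho]_x f x = 0.
Proof.
have Z : is_radon (@mzero _ (borel X) R).
  apply: is_radonP => // [K _|A a mA]; first exact: (ltry 0).
  by rewrite /= /mzero => a0; exists set0 => //; split => //; exact: compact0.
by exists (RadonMeasure Z) => f /=; rewrite integral_measure_zero.
Qed.

Lemma radon_scale mu (c : {nonneg R}) : exists rho : radon_measure R X,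
  forall f : borel X -> \bar R, measurable_fun setT f -> (forall x, 0 <= f x) ->
    \int[rho]_x f x = (c%:num)%:E * \int[mu]_x f x.
Proof.
have Z : is_radon (mscale c mu).
  apply: is_radonP => //.
    move=> K cK; rewrite /= /mscale/=.
    by apply: lte_mul_pinfty => //; [exact: (radon_valP mu).1].
  move=> A a mA; rewrite /= /mscale/= (radon_valP mu).2//.
  rewrite -ereal_supZl//; last first.
    apply/set0P; exists (mu set0); exists set0 => //.
    by split; [exact: compact0|].
  by move=> /ereal_sup_gt[_ [_ [K KA <-] <-] aK]; exists K.
by exists (RadonMeasure Z) => f mf f0 /=; rewrite ge0_integral_mscale.
Qed.

Lemma radon_add mu nu : exists rho : radon_measure R X,
  forall f : borel X -> \bar R, measurable_fun setT f -> (forall x, 0 <= f x) ->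
    \int[rho]_x f x = \int[mu]_x f x + \int[nu]_x f x.
Proof.
have Z : is_radon (measure_add mu nu).
  apply: is_radonP => //.
    move=> K cK; rewrite -[X in X < _]/(measure_add mu nu K) measure_addE.
    by apply: lte_add_pinfty; apply: (radon_valP _).1.
  move=> A a mA; rewrite -[X in _ < X -> _]/(measure_add mu nu A) measure_addE.
  move=> aA; apply: contrapT => noK.
  move: aA; apply/negP; rewrite -leNgt.
  have ne (m : radon_measure R X) : [set m K | K in [set K : set X | compact K /\ K `<=` A]] !=set0.
    by exists (m set0), set0 => //; split => //; exact: compact0.
  rewrite (radon_valP mu).2//.
  apply: ereal_sup_addr_le => //; first by move=> _ [K _ <-].
  move=> _ [K [cK KA] <-]; rewrite addeC (radon_valP nu).2//.
  apply: ereal_sup_addr_le => //; first by move=> _ [L _ <-].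
  move=> _ [L [cL LA] <-]; rewrite leNgt; apply/negP => aKL; apply: noK.
  exists (K `|` L).
    by split; [exact: compactU|move=> x [/KA|/LA]].
  apply: (lt_le_trans aKL).
  rewrite -[X in _ <= X]/(measure_add mu nu (K `|` L)) measure_addE addeC.
  by rewrite leeD// le_measure ?inE//;
    first [exact: compact_borel|exact: compact_borel (compactU cK cL)].
by exists (RadonMeasure Z) => f mf f0 /=; rewrite ge0_integral_measure_add.
Qed.

Lemma radon_restrict mu (A : set (borel X)) (mA : measurable A) :
  exists rho : radon_measure R X,
  forall f : borel X -> \bar R, measurable_fun setT f -> (forall x, 0 <= f x) ->
    \int[rho]_x f x = \int[mu]_(x in A) f x.
Proof.
have Z : is_radon (mrestr mu mA).
  apply: is_radonP => //.
    move=> K cK; rewrite /= /mrestr/=.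
    apply: le_lt_trans _ ((radon_valP mu).1 _ cK).
    have mK := compact_borel hausX cK.
    by apply: le_measure; rewrite ?inE//; exact: measurableI.
  move=> B a mB; rewrite /= /mrestr/= => /radon_inner[].
    exact: measurableI.
  move=> K [cK KAB] aK; exists K; first by split => // x /KAB[].
  by rewrite setIidl// => x /KAB[].
by exists (RadonMeasure Z) => f mf f0 /=; rewrite integral_mrestr_ge0.
Qed.

End radon_operations.

(** * The energy form and its unit ball *)

Section energy_space.
Context (R : realType) (X : ptopologicalType).
Hypotheses (hausX : hausdorff_space X) (lcX : locally_compact [set: X]).
Variable G : X -> X -> \bar R.
Hypothesis kerG : is_kernel G.
Implicit Types (mu nu : radon_measure R X).

Local Notation pot := (potential G).
Local Notation energy := (mutual_energy G).

(** Exchanging the factors of a tensor minorant gives another one, by symmetry of the kernel, and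
    exchanges the two measures in its energy. Approximation by such minorants replaces Fubini's
    theorem. *)
Lemma mutual_energyC mu nu : energy mu nu = energy nu mu.
Proof.
suff le m n : energy m n <= energy n m by apply/eqP; rewrite eq_le !le.
rewrite leNgt; apply/negP => nm.
have [a na am] : exists2 a : R, energy n m <= a%:E & a%:E < energy m n.
  case: (energy n m) nm (mutual_energy_ge0 kerG n m) => [r||]// nm _.
    by exists r.
  by rewrite ltNge leey in nm.
have [l lG al] := tensor_energy_gt hausX lcX kerG am.
pose l' := [seq (p.2, p.1) | p <- l].
have l'G : tensor_minorant G l'.
  move=> x y; rewrite /tensor_eval big_map /=; case: kerG => _ _ -> _.
  by under eq_bigr do rewrite mulrC; exact: lG.
have := tensor_energy_le hausX lcX kerG n m l'G.
rewrite /tensor_energy big_map /=; under eq_bigr do rewrite mulrC.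
by move=> /le_trans/(_ na); rewrite lee_fin leNgt al.
Qed.

Lemma energy_lsc mu (a : R) : a%:E < energy mu mu ->
  \forall nu \near mu, a%:E < energy nu nu.
Proof.
move=> amu; have [l lG al] := tensor_energy_gt hausX lcX kerG amu.
have cl : continuous (fun nu : radon_measure R X => tensor_energy l nu nu).
  move=> nu; rewrite /tensor_energy; elim: l {lG al} => [|p l ih].
    under eq_fun do rewrite big_nil.
    exact: cst_continuous.
  under eq_fun do rewrite big_cons.
  apply: (@continuousD R R (radon_measure R X)) => //.
  apply: (@continuousM R (radon_measure R X));
    by apply: vague_continuous => //; exact: ccp_cc.
have : \forall nu \near mu, (a < tensor_energy l nu nu)%R.
  exact: (cvgr_gt (tensor_energy l mu mu) (cl mu)).
apply: filterS => nu anu; apply: lt_le_trans (tensor_energy_le hausX lcX kerG nu nu lG).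
by rewrite lte_fin.
Qed.

Lemma enorm_le mu (c : R) : (0 <= c)%R ->
  (enorm G mu <= c%:E) = (energy mu mu <= (c ^+ 2)%:E).
Proof.
move=> c0; rewrite /enorm (_ : c%:E = sqrte (c ^+ 2)%:E) ?lee_sqrt//.
  by rewrite lee_fin sqr_ge0.
by rewrite EFin_expe sqrte_sqr gee0_abs// lee_fin.
Qed.

Lemma Eplus1P mu : Eplus1 G mu <-> energy mu mu <= 1.
Proof.
by rewrite /Eplus1 /= (_ : 1 = 1%:E)// enorm_le// expr1n.
Qed.

Lemma EplusP mu : Eplus G mu <-> energy mu mu < +oo.
Proof.
have e0 := mutual_energy_ge0 kerG mu mu.
rewrite /Eplus /= /enorm -ge0_fin_numE ?sqrte_ge0// sqrte_fin_num//.
by rewrite ge0_fin_numE.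
Qed.

Lemma Eplus1_Eplus mu : Eplus1 G mu -> Eplus G mu.
Proof. by move=> /Eplus1P mu1; apply/EplusP; exact: le_lt_trans mu1 (ltry 1). Qed.

Lemma potential_measurable mu : measurable_fun [set: borel X] (pot mu).
Proof. exact: lscF_measurable (potential_lscF hausX lcX kerG mu). Qed.

Lemma kernel_measurable x : measurable_fun [set: borel X] (G x).
Proof. exact: lscF_measurable (kernel_slice_lscF kerG x). Qed.

Lemma energy_scale mu (c : R) : (0 <= c)%R ->
  exists rho : radon_measure R X, [/\ energy rho rho = (c ^+ 2)%:E * energy mu mu,
    forall nu, energy rho nu = c%:E * energy mu nu &
    forall f : borel X -> \bar R, measurable_fun setT f -> (forall x, 0 <= f x) ->
    \int[rho]_x f x = c%:E * \int[mu]_x f x].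
Proof.
move=> c0; have [rho rhoE] := radon_scale hausX mu (NngNum c0).
have potE nu : energy rho nu = c%:E * energy mu nu.
  rewrite /mutual_energy -ge0_integralZl_EFin//.
  - apply: eq_integral => x _; rewrite /potential rhoE//.
      exact: kernel_measurable.
    exact: kernel_ge0.
  - by move=> x _; exact: potential_ge0.
  - exact: potential_measurable.
exists rho; split => //; rewrite potE {1}/mutual_energy rhoE.
- by rewrite muleA -EFinM -expr2.
- exact: potential_measurable.
- exact: potential_ge0.
Qed.

Lemma energy_add mu nu : exists rho : radon_measure R X, 
  energy rho rho = energy mu mu + energy nu nu + (energy mu nu + energy mu nu) /\
  forall f : borel X -> \bar R, measurable_fun setT f -> (forall x, 0 <= f x) ->
    \int[rho]_x f x = \int[mu]_x f x + \int[nu]_x f x.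
Proof.
have [rho rhoE] := radon_add hausX mu nu.
have potE m : energy rho m = energy mu m + energy nu m.
  rewrite /mutual_energy -ge0_integralTD; last 4 first.
  - exact: potential_measurable.
  - exact: potential_measurable.
  - exact: potential_ge0.
  - exact: potential_ge0.
  apply: eq_integral => x _; rewrite /potential rhoE//.
    exact: kernel_measurable.
  exact: kernel_ge0.
exists rho; split => //; rewrite potE !(mutual_energyC _ rho) !potE.
by rewrite (mutual_energyC nu mu) [RHS]addeACA; congr (_ + _); rewrite addeC.
Qed.

(** Since [G >= 0], restriction does not increase the energy; this is how inequalities in the mean
    are localized to a Borel set. *)
Lemma energy_restrict mu (A : set (borel X)) (mA : measurable A) :
  exists rho : radon_measure R X, 
  (Eplus1 G mu -> Eplus1 G rho) /\
  forall f : borel X -> \bar R, measurable_fun setT f -> (forall x, 0 <= f x) ->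
    \int[rho]_x f x = \int[mu]_(x in A) f x.
Proof.
have [rho rhoE] := radon_restrict hausX mu mA; exists rho; split => //.
move=> /Eplus1P mu1; apply/Eplus1P; apply: le_trans mu1.
have le f : measurable_fun [set: borel X] f -> (forall x, 0 <= f x) ->
    \int[rho]_x f x <= \int[mu]_x f x.
  by move=> mf f0; rewrite rhoE//; apply: ge0_subset_integral.
apply: (@le_trans _ _ (\int[mu]_x pot rho x)).
  apply: le; first exact: potential_measurable.
  exact: potential_ge0.
apply: ge0_le_integralT; [exact: potential_measurable|exact: potential_measurable|..].
  exact: potential_ge0.
move=> x; apply: le; first exact: kernel_measurable.
exact: kernel_ge0.
Qed.

Lemma Eplus1_compact_bound (K : set X) : compact K ->
  exists M : R, forall mu, Eplus1 G mu -> mu K <= M%:E.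
Proof.
move=> cK.
have [|||W [M [oW WM]] KW] := @compact_directed _ _ K
  [set W | exists M : R, open W /\ forall mu, Eplus1 G mu -> mu W <= M%:E] id cK.
- exists set0, 0%R; split; first exact: open0.
  by move=> mu _; rewrite measure0.
- move=> V W [M [oV VM]] [N [oW WN]]; exists (V `|` W) => //.
  exists (M + N)%R; split; first exact: openU.
  move=> mu mu1; apply: (@le_trans _ _ (mu V + mu W)).
    by apply: measureU2; exact: open_borel.
  by rewrite EFinD leeD ?VM ?WN.
- move=> x _; have [a a0 aG] : exists2 a : R, (0 < a)%R & a%:E < G x x.
    have : 0 < G x x by case: kerG.
    case: (G x x) => [r||]//; last by exists 1%R; rewrite ?ltr01 ?ltry.
    by rewrite lte_fin => r0; exists (r / 2)%R; rewrite ?lte_fin; lra.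
  have [U xU [V xV UVG]] := kernel_lsc_at kerG aG.
  have [C [cC _] xC] := @compact_nbhs_in R X hausX lcX x setT filterT.
  (* [G] exceeds [a] on the square of [W], so [a * m * m <= 1] for the mass [m] of [W]. The factor
     [C] makes [m] finite beforehand. *)
  pose W : set X := (U `&` V `&` C)°.
  exists W; last first.
    exists W; last by move=> y [].
    by apply: nbhs_interior; apply: filterI => //; exact: filterI.
  (* [m * m <= a^-1] implies [m <= 1 + a^-1], which spares a square root. *)
  exists (1 + a^-1)%R; split; first exact: open_interior.
  have oW : open W by exact: open_interior.
  have mW := open_borel oW.
  move=> mu /Eplus1P mu1.
  have WC : mu W <= mu C.
    apply: le_measure; rewrite ?inE//; first exact: compact_borel.
    by move=> y /interior_subset[].
  have muW : mu W \is a fin_num.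
    by rewrite ge0_fin_numE// (le_lt_trans WC)//; exact: (radon_valP mu).1.
  pose m := fine (mu W); have m0 : (0 <= m)%R by exact: fine_ge0.
  have : (a * m * m)%:E <= 1.
    apply: le_trans mu1.
    have lb x' : (a * m * \1_W x')%:E <= pot mu x'.
      rewrite indicE; have [/set_mem x'W|_] := boolP (x' \in W); last first.
        by rewrite mulr0 potential_ge0.
      rewrite mulr1 EFinM fineK// -(integral_EFin_indic _ (ltW a0) mW).
      apply: ge0_le_integralT.
      - by apply/measurable_EFinP; apply: measurable_funM => //; exact: measurable_indic.
      - exact: kernel_measurable.
      - by move=> y; rewrite lee_fin mulr_ge0// ltW.
      move=> y; rewrite indicE; have [/set_mem yW|_] := boolP (y \in W); last first.
        by rewrite mulr0 kernel_ge0.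
      rewrite mulr1 ltW// UVG//; first by case: (interior_subset x'W) => -[].
      by case: (interior_subset yW) => -[].
    have am0 : (0 <= a * m)%R by rewrite mulr_ge0// ltW.
    rewrite [X in X <= _]EFinM fineK// -(integral_EFin_indic _ am0 mW).
    apply: ge0_le_integralT => //.
    - by apply/measurable_EFinP; apply: measurable_funM => //; exact: measurable_indic.
    - exact: potential_measurable.
    - by move=> y; rewrite lee_fin mulr_ge0.
  rewrite -(fineK muW) -/m !lee_fin => amm.
  have : (m * m <= a^-1)%R by rewrite -(ler_pM2l a0) mulfV ?gt_eqF// mulrA.
  have : (0 <= a^-1)%R by rewrite invr_ge0 ltW.
  by nra.
exists M => mu mu1; apply: le_trans (WM _ mu1).
by apply: le_measure; rewrite ?inE//; [exact: compact_borel|exact: open_borel].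
Qed.

Lemma Eplus1_compact : compact (Eplus1 G).
Proof.
rewrite compact_ultra => F FU FE.
have FP := @ultra_proper _ _ FU.
have [|mu Fmu] := @radon_vague_limit R X hausX lcX F FU.
  move=> K /Eplus1_compact_bound[M HM]; exists M.
  by apply: filterS FE => mu; exact: HM.
exists mu; split => //; apply/Eplus1P; rewrite leNgt; apply/negP => mu1.
have /Fmu near1 := energy_lsc (mu1 : 1%:E < _).
have [nu [/Eplus1P nu1]] := filter_ex (filterI FE near1).
by rewrite /= ltNge nu1.
Qed.

End energy_space.

(** * Capacity *)

Section lsc_series.
Context (R : realType) (X : ptopologicalType).

Lemma lscFD (f g : X -> \bar R) : lscF f -> lscF g -> lscF (fun x => f x + g x).
Proof.
move=> [f0 lf] [g0 lg]; split; first by move=> x; exact: adde_ge0.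
apply: lscD => // x; rewrite gt_eqF//.
  exact: lt_le_trans (ltNy0) (f0 x).
exact: lt_le_trans (ltNy0) (g0 x).
Qed.

Lemma lscF_nneseries (g : nat -> X -> \bar R) : (forall n, lscF (g n)) ->
  lscF (fun x => \sum_(n <oo) g n x).
Proof.
move=> lg; split; first by move=> x; apply: nneseries_ge0 => n _ _; exact: (lg n).1.
rewrite (_ : (fun x => _) =
    fun x => ereal_sup [set \sum_(0 <= i < n) g i x | n in setT]).
  apply: lsc_ereal_sup => n _; elim: n => [|n ih].
    under eq_fun do rewrite big_geq//.
    by apply: (@continuous_lsc R X (fun=> 0%R)); exact: cst_continuous.
  under eq_fun do rewrite big_nat_recr//=.
  apply: lscD => //; first exact: (lg n).2.
    move=> x; rewrite gt_eqF//; apply: (lt_le_trans (ltNy0)).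
    by apply: sume_ge0 => i _; exact: (lg i).1.
  by move=> x; rewrite gt_eqF//; apply: (lt_le_trans (ltNy0)); exact: (lg n).1.
apply/funext => x; apply/cvg_lim => //.
apply: ereal_nondecreasing_cvgn; apply: ereal_nondecreasing_series => n _ _.
exact: (lg n).1.
Qed.

Lemma lscF_indic (U : set X) : open U -> lscF (fun x => (\1_U x)%:E : \bar R).
Proof.
move=> oU; split; first by move=> x; rewrite lee_fin.
move=> x a; rewrite lte_fin indicE => ax.
have [xU|xU] := boolP (x \in U); last first.
  exists setT; first exact: filterT.
  move=> y _; rewrite lte_fin (lt_le_trans ax)// (negPf xU) indicE.
  by case: (y \in U).
exists U; first by apply: open_nbhs_nbhs; split => //; exact/set_mem.
by move=> y Uy; rewrite lte_fin indicE mem_set// -xU.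
Qed.

End lsc_series.

Section capacity.
Context (R : realType) (X : ptopologicalType).
Hypotheses (hausX : hausdorff_space X) (lcX : locally_compact [set: X]).
Variable G : X -> X -> \bar R.
Hypothesis kerG : is_kernel G.
Implicit Types (mu nu : radon_measure R X).

Lemma le_capC (f g : X -> \bar R) :
  measurable_fun [set: borel X] f -> measurable_fun [set: borel X] g ->
  (forall x, 0 <= f x) -> (forall x, f x <= g x) -> capC G f <= capC G g.
Proof.
move=> mf mg f0 fg; apply: ge_ereal_sup => _ [mu mu1 <-].
apply: le_ereal_sup_tmp; exists (\int[mu]_x g x); first by exists mu.
exact: ge0_le_integralT.
Qed.

Lemma integral_le_capC (f : X -> \bar R) mu : Eplus1 G mu ->
  \int[mu]_x f x <= capC G f.
Proof. by move=> mu1; apply: ereal_sup_ubound; exists mu. Qed.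

Lemma Eplus1_nonempty : Eplus1 G !=set0.
Proof.
have [rho rho0] := radon_zero R hausX; exists rho; apply/Eplus1P => //.
by rewrite /mutual_energy rho0.
Qed.

Lemma capC_ge0 (f : X -> \bar R) : (forall x, 0 <= f x) -> 0 <= capC G f.
Proof.
move=> f0; have [mu mu1] := Eplus1_nonempty.
by apply: le_trans (integral_le_capC f mu1); apply: integral_ge0 => x _.
Qed.

Lemma uscH0_capC_fin (h : X -> \bar R) : uscH0 h -> capC G h \is a fin_num.
Proof.
move=> hH; rewrite ge0_fin_numE ?capC_ge0//; last exact: hH.1.
have [M M0 [C cC hM]] := uscH0_bounded hausX hH.
have [B CB] := Eplus1_compact_bound hausX lcX kerG cC.
apply: (@le_lt_trans _ _ (M * B)%:E); last exact: ltry.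
apply: ge_ereal_sup => _ [mu mu1 <-].
apply: (@le_trans _ _ (\int[mu]_x (M * \1_C x)%:E)).
  apply: ge0_le_integralT.
  - exact: uscH0_measurable hH.
  - by apply: uscH0_measurable; exact: uscH0_indic.
  - exact: hH.1.
  - exact: hM.
rewrite integral_EFin_indic//; last exact: compact_borel.
by rewrite EFinM lee_wpmul2l// ?lee_fin//; exact: CB.
Qed.

Lemma vague_nbhs_lt mu (f : X -> R) (r : R) : cc f -> (\int[mu]_x f x < r)%R ->
  nbhs mu [set nu : radon_measure R X | \int[nu]_x f x < r]%R.
Proof.
move=> cf fr.
exact: (cvgr_lt (\int[mu]_x f x)%R (@vague_continuous R X hausX f cf mu) _ fr).
Qed.

Lemma vague_nbhs_gt mu (f : X -> R) (r : R) : cc f -> (r < \int[mu]_x f x)%R ->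
  nbhs mu [set nu : radon_measure R X | r < \int[nu]_x f x]%R.
Proof.
move=> cf fr.
exact: (cvgr_gt (\int[mu]_x f x)%R (@vague_continuous R X hausX f cf mu) _ fr).
Qed.

(** The continuous majorants of [h] are directed downwards under minimum, and having integral below
    [r] is an open condition on [mu]; compactness of [Eplus1] gives one majorant good for every
    [mu], which exchanges infimum and supremum. With [capGE], the capacities take the form [capC],
    where monotonicity and subadditivity are immediate. *)
Lemma capHE (h : X -> \bar R) : uscH0 h -> capH G h = capC G h.
Proof.
move=> hH; have mh := uscH0_measurable hH.
apply/eqP; rewrite eq_le; apply/andP; split; last first.
  apply: le_ereal_inf_tmp => _ [f [fC hf] <-]; apply: le_capC => //.
    exact: uscH0_measurable fC.2.
  exact: hH.1.
have fin := uscH0_capC_fin hH; apply/lee_addgt0Pr => e e0.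
set r := (fine (capC G h) + e)%R.
have hr mu : Eplus1 G mu -> \int[mu]_x h x < r%:E.
  move=> /(integral_le_capC h) /le_lt_trans; apply.
  by rewrite /r EFinD fineK// lteDl.
have [|||f [cf f0 hf] fr] := @compact_directed _ _ (Eplus1 G)
  [set f : X -> R | [/\ cc f, forall x, (0 <= f x)%R & forall x, h x <= (f x)%:E]]
  (fun f => [set mu : radon_measure R X | \int[mu]_x f x < r]%R) (Eplus1_compact hausX lcX kerG).
- have [mu /hr /(usc_outer_cc hausX lcX hH)[f [cf f0 hf _]]] := Eplus1_nonempty.
  by exists f.
- move=> f g [cf f0 hf] [cg g0 hg].
  have cm : cc (fun x => Num.min (f x) (g x)) by exact: cc_min.
  exists (fun x => Num.min (f x) (g x)).
    by split => // x; [rewrite le_min f0 g0|rewrite EFin_min le_min hf hg].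
  move=> mu [] /=; apply: le_lt_trans; apply: cc_le_integral => // x.
    by rewrite ge_min lexx.
  by rewrite ge_min lexx orbT.
- move=> mu /hr /(usc_outer_cc hausX lcX hH)[f [cf f0 hf fr]]; exists f => //.
  exists [set nu : radon_measure R X | \int[nu]_x f x < r]%R; last by move=> nu [].
  exact: vague_nbhs_lt.
apply: (@le_trans _ _ (capC G (EFin \o f))).
  by apply: ereal_inf_lbound; exists (EFin \o f) => //; split => //; exact: cc_C0plus.
apply: ge_ereal_sup => _ [mu mu1 <-]; rewrite cc_integralE//.
apply: (@le_trans _ _ r%:E); first by rewrite lee_fin ltW//; exact: fr.
by rewrite /r EFinD fineK.
Qed.

Lemma capGE (g : X -> \bar R) : lscF g -> capG G g = capC G g.
Proof.
move=> lg; apply/eqP; rewrite eq_le; apply/andP; split.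
  apply: ge_ereal_sup => _ [f [fC fg] <-]; apply: le_capC => //.
  - exact: uscH0_measurable fC.2.
  - exact: lscF_measurable.
  - exact: fC.1.1.
apply: ge_ereal_sup => _ [mu mu1 <-]; rewrite leNgt; apply/negP => capg.
have [a ca ag] : exists2 a : R, capG G g <= a%:E & a%:E < \int[mu]_x g x.
  have : 0 <= capG G g.
    apply: le_ereal_sup_tmp; exists (capC G (EFin \o (fun=> 0%R : R))).
      exists (EFin \o (fun=> 0%R)) => //; split; last exact: lg.1.
      by apply: cc_C0plus => //; exact: cc0.
    by apply: capC_ge0 => x; rewrite lee_fin.
  case: (capG G g) capg => [r||]// rg _; first by exists r.
  by rewrite ltNge leey in rg.
have [f [cf f0 fg af]] := lsc_inner_cc hausX lcX lg ag.
suff : (a%:E < capG G g) by rewrite ltNge ca.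
apply: (@lt_le_trans _ _ (\int[mu]_x (f x)%:E)).
  by rewrite cc_integralE// lte_fin.
apply: (le_trans (integral_le_capC _ mu1)); apply: ereal_sup_ubound.
by exists (EFin \o f) => //; split => //; exact: cc_C0plus.
Qed.

Lemma capCD (f g : X -> \bar R) :
  measurable_fun [set: borel X] f -> measurable_fun [set: borel X] g ->
  (forall x, 0 <= f x) -> (forall x, 0 <= g x) ->
  capC G (fun x => f x + g x) <= capC G f + capC G g.
Proof.
move=> mf mg f0 g0; apply: ge_ereal_sup => _ [mu mu1 <-].
by rewrite ge0_integralTD// leeD//; exact: integral_le_capC.
Qed.

Lemma capC_nneseries (g : nat -> X -> \bar R) :
  (forall n, measurable_fun [set: borel X] (g n)) ->
  (forall n x, 0 <= g n x) ->
  capC G (fun x => \sum_(n <oo) g n x) <= \sum_(n <oo) capC G (g n).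
Proof.
move=> mg g0; apply: ge_ereal_sup => _ [mu mu1 <-].
rewrite integral_nneseries//; apply: lee_nneseries => n *.
  by apply: integral_ge0 => x _.
exact: integral_le_capC.
Qed.

(** Vanishing outer capacity, expressed with functions rather than open sets so that countably many
    exceptional sets can be handled by a series. *)
Definition cap_null (E : set X) := forall e : R, (0 < e)%R ->
  exists g, [/\ lscF g, forall x, E x -> 1 <= g x & capC G g <= e%:E].

Lemma upper_cap_set_eq0 (E : set X) : upper_cap_set G E = 0 <-> cap_null E.
Proof.
split=> [E0 e e0|nE].
  have : upper_cap_set G E < e%:E by rewrite E0.
  move=> /ereal_inf_lt[_ [g [lg Eg] <-]]; rewrite capGE// => /ltW ge.
  exists g; split => // x Ex; apply: le_trans (Eg x).
  by rewrite indicE mem_set.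
apply/eqP; rewrite eq_le; apply/andP; split.
  apply/lee_addgt0Pr => e /nE[g [lg Eg ge]]; rewrite add0e.
  apply: ge_ereal_inf; exists (capG G g); last by rewrite capGE.
  exists g => //; split => // x; rewrite indicE.
  have [/set_mem/Eg//|_] := boolP (x \in E); exact: lg.1.
apply: le_ereal_inf_tmp => _ [g [lg _] <-]; rewrite capGE//.
by apply: capC_ge0; exact: lg.1.
Qed.

Lemma sub_cap_null (E F : set X) : E `<=` F -> cap_null F -> cap_null E.
Proof.
by move=> EF nF e /nF[g [lg Fg ge]]; exists g; split => // x /EF; exact: Fg.
Qed.

Lemma cap_null_bigcup (E : nat -> set X) : (forall n, cap_null (E n)) ->
  cap_null (\bigcup_n E n).
Proof.
move=> nE e e0.
pose P n g := [/\ lscF g, forall x, E n x -> 1 <= g x &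
  capC G g <= (e / (2 ^ n.+1)%:R)%:E].
have [g gP] : {g : nat -> X -> \bar R & forall n, P n (g n)}.
  apply: (@choice _ _ P) => n; apply: nE.
  by rewrite divr_gt0.
have lg n : lscF (g n) by case: (gP n).
exists (fun x => \sum_(n <oo) g n x); split.
- exact: lscF_nneseries.
- move=> x [n _ Enx]; have [_ /(_ _ Enx) gn _] := gP n; apply: (le_trans gn).
  apply: (@le_trans _ _ (\sum_(0 <= i < n.+1) g i x)).
    rewrite big_nat_recr//= leeDr//; apply: sume_ge0 => i _; exact: (lg i).1.
  by apply: nneseries_lim_ge => i _ _; exact: (lg i).1.
- apply: le_trans (epsilon_trick0 xpredT (ltW e0)).
  apply: (le_trans (capC_nneseries _ _)).
  + by move=> n; exact: lscF_measurable.
  + by move=> n; exact: (lg n).1.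
  apply: lee_nneseries => n *; first by apply: capC_ge0; exact: (lg n).1.
  by case: (gP n).
Qed.

Lemma cap_nullU (E F : set X) : cap_null E -> cap_null F -> cap_null (E `|` F).
Proof.
move=> nE nF; rewrite -bigcup2E; apply: cap_null_bigcup => n.
have n0 : cap_null set0.
  by apply: sub_cap_null nE => x.
by rewrite /bigcup2; case: ifP => // _; case: ifP.
Qed.

(** The capacity of the indicator of an open [V] is the supremum of [mu V] over [Eplus1], so
    uniformly small mass means small capacity. [N] and [V] may vary with [e]. *)
Lemma cap_null_approx (E : set X) : (forall e : R, (0 < e)%R ->
    exists N V : set X, [/\ cap_null N, open V, E `<=` N `|` V &
      forall mu, Eplus1 G mu -> mu V <= e%:E]) -> cap_null E.
Proof.
move=> H e e0; have e2 : (0 < e / 2)%R by rewrite divr_gt0.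
have [N [V [nN oV ENV Ve]]] := H _ e2; have [g [lg Ng ge]] := nN _ e2.
have lV := @lscF_indic R X V oV.
exists (fun x => g x + (\1_V x)%:E); split.
- exact: lscFD.
- move=> x /ENV[/Ng h|Vx]; first by rewrite -[leLHS]adde0 leeD// lV.1.
  by rewrite -[leLHS]add0e leeD ?lg.1// indicE mem_set.
- apply: (le_trans (capCD (lscF_measurable lg) (lscF_measurable lV) lg.1 lV.1)).
  rewrite (splitr e) EFinD leeD//; apply: ge_ereal_sup => _ [mu mu1 <-].
  by rewrite integral_indic ?setIT; [exact: Ve| |exact: open_borel].
Qed.

(** By [capHE] the indicator of [K] has majorants in C_0^+ of arbitrarily small capacity: on compact
    sets, zero mass for each single [mu] already forces zero outer capacity. *)
Lemma cap_null_compact (K : set X) : compact K ->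
  (forall mu, Eplus1 G mu -> mu K = 0) -> cap_null K.
Proof.
move=> cK K0 e e0.
have KH : uscH0 (fun x => (1 * \1_K x)%:E : \bar R) by exact: uscH0_indic.
have : capH G (fun x => (1 * \1_K x)%:E) < e%:E.
  rewrite capHE//; apply: (@le_lt_trans _ _ 0).
    apply: ge_ereal_sup => _ [mu mu1 <-]; rewrite integral_EFin_indic//.
      by rewrite K0// mule0.
    exact: compact_borel.
  by rewrite lte_fin.
move=> /ereal_inf_lt[_ [f [fC Kf] <-] /ltW fe]; exists f; split => //.
  exact: fC.1.
by move=> x Kx; apply: le_trans (Kf x); rewrite mul1r indicE mem_set.
Qed.

End capacity.

(** * Dominating potentials *)

Section dominants.
Context (R : realType) (X : ptopologicalType).
Hypotheses (hausX : hausdorff_space X) (lcX : locally_compact [set: X]).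
Variable G : X -> X -> \bar R.
Hypotheses (kerG : is_kernel G) (consG : consistent G)
  (posG : positive_definite G).
Implicit Types (lambda mu nu : radon_measure R X).

Local Notation pot := (potential G).
Local Notation energy := (mutual_energy G).

Lemma enorm_fin mu : Eplus G mu -> enorm G mu \is a fin_num.
Proof. by move=> mu1; rewrite ge0_fin_numE// sqrte_ge0. Qed.

Lemma energy_fin mu nu : Eplus G mu -> Eplus G nu -> energy mu nu \is a fin_num.
Proof.
move=> Emu Enu; rewrite ge0_fin_numE; last exact: mutual_energy_ge0.
apply: le_lt_trans (posG Emu Enu) _; rewrite -ge0_fin_numE.
  by rewrite fin_numM// enorm_fin.
by rewrite mule_ge0// sqrte_ge0.
Qed.

Lemma energy_le_enorm lambda mu : Eplus G lambda -> Eplus1 G mu ->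
  energy lambda mu <= enorm G lambda.
Proof.
move=> El mu1; apply: (le_trans (posG El (Eplus1_Eplus kerG mu1))).
by rewrite -[leRHS]mule1 lee_wpmul2l// sqrte_ge0.
Qed.

Lemma enorm_le_Eplus mu (c : R) : enorm G mu <= c%:E -> Eplus G mu.
Proof. by move=> /le_lt_trans; apply; exact: ltry. Qed.

(** Consistency enters the argument here alone. The neighbourhood lives in the space of all measures
    but is tested on [Eplus1] only, as [compact_directed] requires. *)
Lemma energy_nbhs_lt nu mu (b : R) : Eplus G nu -> Eplus1 G mu ->
  energy nu mu < b%:E -> exists2 U, nbhs mu U &
  forall mu', U mu' -> Eplus1 G mu' -> energy nu mu' < b%:E.
Proof.
move=> Enu mu1 lt; have [_ cont] := consG Enu.
have /(_ _ mu1) cmu := (@subspace_continuousP _ _ _ _).1 cont.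
have : nbhs (energy nu mu) [set y | y < b%:E].
  by apply: open_nbhs_nbhs; split => //; exact: open_ereal_lt_ereal.
move=> /cmu; rewrite /= nbhs_simpl /within /= => H.
by exists [set mu' | Eplus1 G mu' -> energy nu mu' < b%:E].
Qed.

(** By [usc_outer_cc] the integral of [h] is vaguely upper semicontinuous in the measure, hence
    attains its supremum on the compact [Eplus1]. *)
Lemma capC_attained (h : X -> \bar R) : uscH0 h ->
  exists2 mu, Eplus1 G mu & \int[mu]_x h x = capC G h.
Proof.
move=> hH; have fin := uscH0_capC_fin hausX lcX kerG hH.
apply: contrapT => noh.
have lth mu : Eplus1 G mu -> \int[mu]_x h x < capC G h.
  move=> mu1; rewrite lt_neqAle integral_le_capC// andbT.
  by apply/eqP => hmu; apply: noh; exists mu.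
have ltr mu : Eplus1 G mu -> exists2 r : R, (r < fine (capC G h))%R &
    \int[mu]_x h x < r%:E.
  move=> /lth; have := uscH0_integral_fin hausX mu hH.
  rewrite -(fineK fin); case: (\int[mu]_x h x) => // s _; rewrite lte_fin => sc.
  exists ((s + fine (capC G h)) / 2)%R; first by lra.
  by rewrite lte_fin; lra.
have [|||r rc Er] := @compact_directed _ _ (Eplus1 G)
  [set r : R | r < fine (capC G h)]%R
  (fun r => [set mu : radon_measure R X | \int[mu]_x h x < r%:E])
  (Eplus1_compact hausX lcX kerG).
- have [mu /ltr[r rc _]] := Eplus1_nonempty hausX G; by exists r.
- move=> r s rc sc; exists (Num.max r s); first by rewrite /= gt_max rc.
  by move=> mu [] /lt_le_trans /=; apply; rewrite lee_fin le_max lexx ?orbT.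
- move=> mu /ltr[r rc hr]; exists r => //.
  have [f [cf f0 hf fr]] := usc_outer_cc hausX lcX hH hr.
  exists [set nu : radon_measure R X | \int[nu]_x f x < r]%R.
    exact: vague_nbhs_lt.
  move=> nu [/= fnu _]; apply: (@le_lt_trans _ _ (\int[nu]_x (f x)%:E)).
    apply: ge0_le_integralT => //.
    - exact: uscH0_measurable hH.
    - by apply/measurable_EFinP; exact: cc_measurable.
    - exact: hH.1.
  by rewrite cc_integralE// lte_fin.
suff : capC G h <= r%:E by rewrite -(fineK fin) lee_fin leNgt rc.
by apply: ge_ereal_sup => _ [mu mu1 <-]; apply: ltW; exact: Er.
Qed.

(* First variation at a maximizer mu0 of the integral of h on Eplus1: compare
   mu0 with the normalization of mu0 + t nu as t tends to 0. *)
Lemma dominant_exists (h : X -> \bar R) : uscH0 h -> exists lambda,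
  enorm G lambda <= capC G h /\
  forall nu, Eplus G nu -> \int[nu]_x h x <= energy lambda nu.
Proof.
move=> hH; have fin := uscH0_capC_fin hausX lcX kerG hH.
have [mu0 mu01 hmu0] := capC_attained hH.
have mh := uscH0_measurable hH; have h0 := hH.1.
set c := fine (capC G h); have c0 : (0 <= c)%R by apply/fine_ge0/capC_ge0.
have [lambda [lambdaE lambdaP _]] := energy_scale hausX lcX kerG mu0 c0.
exists lambda; split.
  rewrite -(fineK fin) -/c enorm_le// lambdaE.
  rewrite -[leRHS]mule1 lee_wpmul2l ?lee_fin ?sqr_ge0//.
  exact: (Eplus1P G mu0).1.
move=> nu Enu; rewrite lambdaP.
have efin := energy_fin (Eplus1_Eplus kerG mu01) Enu.
have nfin := energy_fin Enu Enu.
have hfin := uscH0_integral_fin hausX nu hH.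
rewrite -(fineK efin) -(fineK hfin) -EFinM lee_fin.
set e := fine (energy mu0 nu); set I := fine (\int[nu]_x h x).
set N := fine (energy nu nu).
have e0 : (0 <= e)%R by apply/fine_ge0/mutual_energy_ge0.
have N0 : (0 <= N)%R by apply/fine_ge0/mutual_energy_ge0.
have var (t : R) : (0 < t -> c + t * I <= c * (1 + t * e + t ^+ 2 * N / 2))%R.
  move=> t0; have [nut [nutE nutP nutI]] := energy_scale hausX lcX kerG nu (ltW t0).
  have [rho [rhoE rhoI]] := energy_add hausX lcX kerG mu0 nut.
  (* [q] bounds the energy of [mu0 + t nu], so dividing this measure by the square root [s] of [q]
     lands in [Eplus1]. *)
  pose q := (1 + t ^+ 2 * N + (t * e + t * e))%R.
  have te : (0 <= t * e)%R by rewrite mulr_ge0// ltW.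
  have tN : (0 <= t ^+ 2 * N)%R by rewrite mulr_ge0// sqr_ge0.
  have q1 : (1 <= q)%R by rewrite /q; lra.
  pose s := Num.sqrt q; have s0 : (0 < s)%R by rewrite sqrtr_gt0; lra.
  have ss : (s ^+ 2 = q)%R by rewrite sqr_sqrtr//; lra.
  have rhoq : energy rho rho <= q%:E.
    rewrite rhoE nutE (mutual_energyC hausX lcX kerG mu0 nut) nutP.
    rewrite (mutual_energyC hausX lcX kerG nu mu0) -(fineK efin) -(fineK nfin).
    rewrite -/e -/N /q !EFinD !EFinM leeD// leeD//.
    exact: (Eplus1P G mu0).1.
  have si0 : (0 <= s^-1)%R by rewrite invr_ge0 ltW.
  have [sigma [sigmaE _ sigmaI]] := energy_scale hausX lcX kerG rho si0.
  have sigma1 : Eplus1 G sigma.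
    apply/Eplus1P => //; rewrite sigmaE.
    apply: (@le_trans _ _ ((s^-1 ^+ 2)%:E * q%:E)).
      by rewrite lee_wpmul2l// lee_fin sqr_ge0.
    by rewrite -EFinM -ss exprVn mulVf// expf_neq0// gt_eqF.
  have := integral_le_capC h sigma1.
  rewrite sigmaI// rhoI// nutI// hmu0 -(fineK fin) -(fineK hfin) -/c -/I.
  rewrite -(EFinM t I) -(EFinD c) -(EFinM s^-1%R) lee_fin ler_pdivrMl// => /le_trans; apply.
  rewrite mulrC ler_wpM2l//.
  have y0 : (0 <= t ^+ 2 * N / 2)%R by rewrite divr_ge0.
  have w0 : (0 <= 1 + t * e + t ^+ 2 * N / 2)%R by lra.
  (* With [z = t * e] and [y = t ^+ 2 * N], this is [sqrt (1 + 2 z + y) <= 1 + z + y / 2], checked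
     by squaring. *)
  rewrite -(@ler_pXn2r _ 2%N)// ?nnegrE//; last exact: ltW.
  rewrite ss /q; move: te y0.
  set z := (t * e)%R; set y := (t ^+ 2 * N)%R => te y0; nra.
apply/ler_addgt0Pr => d; move: (d : R) => {}d d0.
(* This makes the remainder [t * (c * N) / 2], left after division by [t], at most [d]; the [+ 1]
   covers [c * N = 0]. *)
pose t : R := (d / (c * N + 1))%R.
have cN : (0 <= c * N)%R by rewrite mulr_ge0.
have t0 : (0 < t)%R by rewrite divr_gt0//; lra.
have td : (t * (c * N + 1) = d)%R by rewrite /t divfK// gt_eqF//; lra.
have H := var t t0.
have HE : (c * (1 + t * e + t ^+ 2 * N / 2) =
  c + t * (c * e) + t * (t * (c * N) / 2))%R by ring.
rewrite HE in H; rewrite -(ler_pM2l t0) mulrDr.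
have : (t * (t * (c * N) / 2) <= t * d)%R.
  by rewrite ler_pM2l// -td mulrDr; have : (0 <= t * (c * N))%R; [rewrite mulr_ge0// ltW|lra].
by move: H; lra.
Qed.

(** If no [C * mu] with [mu] in [Eplus1] dominates all the [F i], each [mu] fails against some [F i]
    at some [nu]. For that [nu] failure is an open condition on [mu], and the failing sets increase
    with [i]; compactness yields one [i] at which every [mu] fails, against the dominant supplied
    for it. The [F i] are arbitrary functionals of [nu], which admits lower integrals. *)
Lemma dominant_directed (I : Type) (D : set I)
    (F : I -> radon_measure R X -> \bar R) (C : R) : (0 < C)%R -> D !=set0 ->
  (forall i j, D i -> D j -> exists2 k, D k & forall nu, Eplus G nu ->
    F i nu <= F k nu /\ F j nu <= F k nu) ->
  (forall i, D i -> exists lambda, enorm G lambda <= C%:E /\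
    forall nu, Eplus G nu -> F i nu <= energy lambda nu) ->
  exists lambda, enorm G lambda <= C%:E /\
    forall i nu, D i -> Eplus G nu -> F i nu <= energy lambda nu.
Proof.
move=> C0 D0 dirF HF; apply: contrapT => no.
have [||i Di Ei] := @compact_directed _ _ (Eplus1 G) D
  (fun i => [set mu : radon_measure R X | exists2 nu, Eplus G nu & C%:E * energy mu nu < F i nu])
  (Eplus1_compact hausX lcX kerG) D0.
- move=> i j Di Dj; have [k Dk ijk] := dirF _ _ Di Dj; exists k => //.
  by move=> mu [] [nu Enu lt]; exists nu => //;
    apply: (lt_le_trans lt); case: (ijk nu Enu).
- move=> mu mu1.
  have [lambda [lambdaE lambdaP _]] := energy_scale hausX lcX kerG mu (ltW C0).
  have lC : enorm G lambda <= C%:E.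
    rewrite enorm_le ?(ltW C0)// lambdaE.
    rewrite -[leRHS]mule1 lee_wpmul2l ?lee_fin ?sqr_ge0//.
    exact: (Eplus1P G mu).1.
  have [i [nu [Di Enu lt]]] : exists i nu, [/\ D i, Eplus G nu &
      C%:E * energy mu nu < F i nu].
    apply: contrapT => H; apply: no; exists lambda; split => // i nu Di Enu.
    by rewrite leNgt lambdaP; apply/negP => lt; apply: H; exists i, nu.
  exists i => //.
  have fin := energy_fin (Eplus1_Eplus kerG mu1) Enu.
  have [b eb bF] : exists2 b : R, energy nu mu < b%:E & (C * b)%:E <= F i nu.
    rewrite (mutual_energyC hausX lcX kerG nu mu); move: fin lt.
    case: (energy mu nu) => // r _; rewrite -EFinM.
    case: (F i nu) => [s||]//; last first.
      by move=> _; exists (r + 1)%R; rewrite ?leey// lte_fin; lra.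
    rewrite lte_fin => rs; exists (s / C)%R.
      by rewrite lte_fin ltr_pdivlMr// mulrC.
    by rewrite lee_fin mulrC divfK// gt_eqF.
  have [U Umu UP] := energy_nbhs_lt Enu mu1 eb.
  exists U => // mu' [Umu' mu'1]; exists nu => //; apply: lt_le_trans bF.
  rewrite (mutual_energyC hausX lcX kerG mu' nu) EFinM lte_pmul2l//.
  exact: UP.
have [lambda [lC ldom]] := HF _ Di.
have Ci0 : (0 <= C^-1)%R by rewrite invr_ge0 ltW.
have [mu [muE muP _]] := energy_scale hausX lcX kerG lambda Ci0.
have mu1 : Eplus1 G mu.
  apply/Eplus1P => //; rewrite muE.
  apply: (@le_trans _ _ ((C^-1 ^+ 2)%:E * (C ^+ 2)%:E)).
    by rewrite lee_wpmul2l ?lee_fin ?sqr_ge0// -enorm_le// ltW.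
  by rewrite -EFinM exprVn mulVf// expf_neq0// gt_eqF.
have [nu Enu] := Ei _ mu1; rewrite muP muleA -EFinM mulfV ?gt_eqF// mul1e.
by rewrite ltNge ldom.
Qed.

(** The continuous minorants are directed under maximum, and their integrals approach
    [energy lambda mu] for each [mu]; continuity of this limit on [Eplus1] makes the approach
    uniform. *)
Lemma potential_dini lambda (e : R) : Eplus G lambda -> (0 < e)%R ->
  exists f : X -> R, [/\ cc f, forall x, (0 <= f x)%R,
    forall x, (f x)%:E <= pot lambda x & forall mu, Eplus1 G mu ->
    energy lambda mu <= (\int[mu]_x f x + e)%:E].
Proof.
move=> El e0.
have loc mu : Eplus1 G mu -> exists f : X -> R, [/\ cc f,
    forall x, (0 <= f x)%R, forall x, (f x)%:E <= pot lambda x &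
    energy lambda mu < (\int[mu]_x f x + e / 2)%:E].
  move=> mu1; have fin := energy_fin El (Eplus1_Eplus kerG mu1).
  have [|f [cf f0 fl ef]] := @lsc_inner_cc R X hausX lcX mu (pot lambda)
    (fine (energy lambda mu) - e / 2)%R (potential_lscF hausX lcX kerG lambda).
    by rewrite EFinB fineK// lteBlDr// lteDl// lte_fin divr_gt0.
  by exists f; split => //; rewrite -(fineK fin) lte_fin; lra.
have [|||f [cf f0 fl] fE] := @compact_directed _ _ (Eplus1 G)
  [set f : X -> R | [/\ cc f, forall x, (0 <= f x)%R &
    forall x, (f x)%:E <= pot lambda x]]
  (fun f => [set mu : radon_measure R X | energy lambda mu < (\int[mu]_x f x + e)%:E])
  (Eplus1_compact hausX lcX kerG).
- by exists (fun=> 0%R); split => // [|x]; [exact: cc0|exact: potential_ge0].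
- move=> f g [cf f0 fl] [cg g0 gl].
  have cm : cc (fun x => Num.max (f x) (g x)) by exact: cc_max.
  exists (fun x => Num.max (f x) (g x)).
    split => // x; first by rewrite le_max f0.
    by rewrite EFin_max ge_max fl gl.
  by move=> mu [] /lt_le_trans /=; apply; rewrite lee_fin lerD2r;
    apply: cc_le_integral => // x; rewrite le_max lexx ?orbT.
- move=> mu mu1; have [f [cf f0 fl ef]] := loc mu mu1; exists f => //.
  have [U Umu UP] := energy_nbhs_lt El mu1 ef.
  exists (U `&` [set nu : radon_measure R X | \int[mu]_x f x - e / 2 < \int[nu]_x f x]%R).
    apply: filterI => //; apply: vague_nbhs_gt => //.
    by rewrite ltrBlDr ltrDl divr_gt0.
  move=> nu [[/UP Unu /= fnu] nu1]; apply: (lt_le_trans (Unu nu1)).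
  by rewrite lee_fin; lra.
by exists f; split => // mu mu1; apply: ltW; exact: fE.
Qed.

End dominants.

Lemma lte_addSinv (R : realType) (x y : \bar R) : 0 <= x -> x < y ->
  exists n : nat, x + (n.+1%:R^-1)%:E < y.
Proof.
case: x => [x||]// _; last by rewrite ltNge leey.
move=> xy; have [e e0] := lte_add_slack xy ler01; rewrite mulr1 => xey.
exists (Num.truncn e^-1); apply: le_lt_trans xey; rewrite -EFinD lee_fin lerD2l.
rewrite -[leRHS]invrK lef_pV2 ?posrE ?invr_gt0//.
exact/ltW/truncnS_gt.
Qed.

(** Chebyshev's inequality for [g - f], stated without subtraction because [g] may be infinite; the
    integral of [f], being finite, can be cancelled. *)
Lemma measure_gap_le d (T : measurableType d) (R : realType)
    (mu : {measure set T -> \bar R}) (A : set T) (f g : T -> \bar R) (c e : R) :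
  measurable A -> measurable_fun setT f -> measurable_fun setT g ->
  (forall x, 0 <= f x) -> (forall x, 0 <= g x) ->
  \int[mu]_(x in A) f x \is a fin_num -> (0 < c)%R ->
  (forall x, A x -> f x + c%:E <= g x) ->
  \int[mu]_(x in A) g x <= \int[mu]_(x in A) f x + e%:E -> mu A <= (e / c)%:E.
Proof.
move=> mA mf mg f0 g0 fin c0 fg gf.
have : \int[mu]_(x in A) f x + c%:E * mu A <= \int[mu]_(x in A) f x + e%:E.
  have mfA : measurable_fun A f by exact: measurable_funTS.
  have mgA : measurable_fun A g by exact: measurable_funTS.
  have c0' x : A x -> 0 <= (fun=> c%:E) x by rewrite lee_fin ltW.
  apply: le_trans gf; rewrite -integral_cst//.
  rewrite -(ge0_integralD mu mA (fun x _ => f0 x) mfA c0' (measurable_cst _)).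
  apply: ge0_le_integral => //.
  - by move=> x _; rewrite adde_ge0// lee_fin ltW.
  - exact: emeasurable_funD.
rewrite leeD2lE//; case: (mu A) => [m||]; last by rewrite leNye.
  by rewrite -EFinM !lee_fin ler_pdivlMr// mulrC.
by rewrite gt0_muley ?lte_fin// leye_eq.
Qed.

(** * Lower integrals and monotone convergence *)

Section lower_integrals.
Context (R : realType) (X : ptopologicalType).
Hypotheses (hausX : hausdorff_space X) (lcX : locally_compact [set: X]).
Implicit Types (nu : radon_measure R X).

Lemma le_lower_integral nu (f : X -> \bar R) (g : borel X -> \bar R) :
  measurable_fun setT g -> (forall x, 0 <= g x <= f x) ->
  \int[nu]_x g x <= lower_integral nu f.
Proof. by move=> mg gf; apply: ereal_sup_ubound; exists g. Qed.

Lemma lower_integral_inner_usc nu (f : X -> \bar R) (a : \bar R) :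
  a < lower_integral nu f -> exists h : X -> \bar R,
    [/\ uscH0 h, forall x, h x <= f x & a < \int[nu]_x h x].
Proof.
move=> /ereal_sup_gt[_ [g [mg gf] <-] ag].
have [|h [hH hg ah]] := borel_inner_usc hausX mg _ ag.
  by move=> x; case/andP: (gf x).
by exists h; split => // x; apply: le_trans (hg x) _; case/andP: (gf x).
Qed.

(** The left-hand side is approached by integrals of functions [h] in H_0, each carried by a compact
    [C]. There every [f_ n] agrees with a Borel function off a null set, and monotone convergence
    applies to the [f_ n] cut off to [C] minus a common null set [N]. *)
Lemma lower_integral_sup nu (f_ : nat -> X -> \bar R) :
  (forall n x, 0 <= f_ n x) -> (forall n, radon_measurable nu (f_ n)) ->
  (forall n x, f_ n x <= f_ n.+1 x) ->
  lower_integral nu (fun x => ereal_sup [set f_ n x | n in setT]) <=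
  ereal_sup [set lower_integral nu (f_ n) | n in setT].
Proof.
move=> f0 mf ndf; set S := ereal_sup [set lower_integral _ _ | _ in _].
rewrite leNgt; apply/negP => /lower_integral_inner_usc[h [hH hf]].
apply/negP; rewrite -leNgt.
have [h0 _ _ [C cC hC]] := (uscH0P hausX h).1 hH.
have mC := compact_borel hausX cC.
have [g_ gP] : {g_ : nat -> borel X -> \bar R & forall n,
    measurable_fun setT (g_ n) /\ {ae nu, forall x, C x -> f_ n x = g_ n x}}.
  apply: (@choice _ _ (fun n g => measurable_fun [set: borel X] g /\
    {ae nu, forall x, C x -> f_ n x = g x})) => n.
  by have [g mg fg] := mf n C cC; exists g.
have [N [mN N0 fgN]] : nu.-negligible (~` [set x | forall n, C x -> f_ n x = g_ n x]).
  by apply: ae_foralln => n; case: (gP n).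
have {}fgN x n : ~ N x -> C x -> f_ n x = g_ n x.
  by move=> nNx; apply: contrapT => H; apply: nNx; apply: fgN => /= /(_ n).
pose B : set (borel X) := C `\` N; have mB : measurable B by exact: measurableD.
pose u n : borel X -> \bar R := f_ n \_ B.
have mu_ n : measurable_fun setT (u n).
  rewrite (_ : u n = g_ n \_ B).
    by apply: (measurable_restrictT _ mB).1; apply: measurable_funTS; case: (gP n).
  apply/funext => x; rewrite /u /patch; case: ifPn => // /set_mem[Cx nNx].
  exact: fgN.
have u0 n x : 0 <= u n x by rewrite /u /patch; case: ifPn.
have ndu x : {homo u^~ x : n m / (n <= m)%N >-> n <= m}.
  apply/nondecreasing_seqP => n; rewrite /u /patch; case: (x \in B) => //.
have uS n : \int[nu]_x u n x <= S.
  apply: le_ereal_sup_tmp; exists (lower_integral nu (f_ n)); first by exists n.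
  apply: le_lower_integral => // x; rewrite u0 /=.
  by rewrite /u /patch; case: ifPn.
have mh := uscH0_measurable hH.
rewrite (ge0_negligible_integral mN measurableT mh (fun x _ => h0 x) N0).
apply: (@le_trans _ _ (\int[nu]_x (limn (u^~ x)))); last first.
  rewrite (monotone_convergence _ measurableT mu_ (fun n x _ => u0 n x) (fun x _ => ndu x)).
  apply: lime_le; last by apply: nearW.
  apply: ereal_nondecreasing_is_cvgn => n m nm.
  by apply: ge0_le_integralT => // x; exact: ndu.
rewrite integral_mkcond; apply: ge0_le_integralT.
- by apply: (measurable_restrictT _ _).1; [exact: measurableD|exact: measurable_funTS].
- apply: emeasurable_fun_cvg mu_ _ => x _.
  by apply: ereal_nondecreasing_is_cvgn; exact: ndu.
- by move=> x; rewrite /patch; case: ifPn.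
move=> x; have -> : limn (u^~ x) = ereal_sup (range (u^~ x)).
  by apply/cvg_lim => //; apply: ereal_nondecreasing_cvgn; exact: ndu.
have us0 : 0 <= ereal_sup (range (u^~ x)).
  by apply: le_ereal_sup_tmp; exists (u 0%N x) => //; exists 0%N.
rewrite /patch; case: ifPn => // /set_mem[_ nNx].
have [Cx|nCx] := pselect (C x); last by rewrite hC.
apply: (le_trans (hf x)); apply: ge_ereal_sup => _ [n _ <-].
apply: le_ereal_sup_tmp; exists (u n x); first by exists n.
by rewrite /u /patch mem_set.
Qed.

End lower_integrals.

(** * From domination in the mean to domination quasi-everywhere *)

Section quasi_everywhere.
Context (R : realType) (X : ptopologicalType).
Hypotheses (hausX : hausdorff_space X) (lcX : locally_compact [set: X]).
Variable G : X -> X -> \bar R.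
Hypotheses (kerG : is_kernel G) (consG : consistent G)
  (posG : positive_definite G).
Implicit Types (lambda mu nu : radon_measure R X).

Local Notation pot := (potential G).
Local Notation energy := (mutual_energy G).

Lemma quasi_everywhereP (P : X -> Prop) :
  quasi_everywhere G P <-> cap_null G [set x | ~ P x].
Proof.
split=> [[E /(upper_cap_set_eq0 hausX lcX G E) nE EP]|nP].
  by apply: sub_cap_null nE => x nPx; apply: contrapT => /EP.
exists [set x | ~ P x]; first exact/upper_cap_set_eq0.
by move=> x /contrapT.
Qed.

Lemma cap_null0 : cap_null G set0.
Proof.
by apply: cap_null_compact => //; exact: compact0.
Qed.

(* The exceptional set [pot lambda + d < g] is covered by the open set
   [f + d < g], whose measure is small uniformly over Eplus1. *)
Lemma lsc_dominant_qe lambda (g : X -> \bar R) : Eplus G lambda -> lscF g ->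
  (forall nu, Eplus G nu -> \int[nu]_x g x <= energy lambda nu) ->
  quasi_everywhere G (fun x => g x <= pot lambda x).
Proof.
move=> El lg dom; apply/quasi_everywhereP.
pose E n := [set x | pot lambda x + (n.+1%:R^-1)%:E < g x].
apply: (@sub_cap_null _ _ _ _ (\bigcup_n E n)).
  move=> x /= /negP; rewrite -ltNge => /lte_addSinv[|n En]; last by exists n.
  exact: potential_ge0.
apply: cap_null_bigcup => // n; apply: cap_null_approx => // e e0.
set d : R := n.+1%:R^-1%R; have d0 : (0 < d)%R by rewrite invr_gt0.
(* Accuracy [e * d], divided by the gap [d], gives mass at most [e]. *)
have [f [cf f0 fl fE]] := potential_dini hausX lcX kerG consG posG El (mulr_gt0 e0 d0).
(* [f] stands in for [pot lambda], which is only lower semicontinuous: with [f] continuous, [g - f]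
   is lower semicontinuous and [V] is open. *)
pose V := [set x | d%:E < g x - (f x)%:E].
have VE x : V x <-> (f x)%:E + d%:E < g x by rewrite addeC -lteBrDr.
have oV : open V.
  apply: ((lower_semicontinuousP _).1 _ d); apply: lscD; first exact: lg.2.
  - exact: continuous_usc cf.1.
  - by move=> x; rewrite gt_eqF// (lt_le_trans (ltNy0) (lg.1 x)).
  - by [].
have mV := open_borel oV.
have mf : measurable_fun [set: borel X] (EFin \o f).
  by apply/measurable_EFinP; exact: cc_measurable.
have f0' x : 0 <= (f x)%:E by rewrite lee_fin.
exists set0, V; split => //; first exact: cap_null0.
  move=> x Enx; right; apply/VE; apply: le_lt_trans Enx.
  by rewrite leeD2r.
move=> mu mu1.
have [rho [rho1 rhoI]] := energy_restrict hausX lcX kerG mu mV.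
have fV : \int[mu]_(x in V) (f x)%:E = (\int[rho]_x f x)%R%:E.
  by rewrite -cc_integralE// rhoI.
rewrite (_ : e = e * d / d)%R; last by rewrite mulfK// gt_eqF.
apply: (@measure_gap_le _ _ _ mu V (EFin \o f) g d) => //.
- exact: lscF_measurable.
- exact: lg.1.
- by rewrite fV.
- by move=> x /VE/ltW.
rewrite fV -rhoI; [|exact: lscF_measurable|exact: lg.1].
by apply: (le_trans (dom _ (Eplus1_Eplus kerG (rho1 mu1)))); exact: fE (rho1 mu1).
Qed.

(* A countable infimum of potentials is, up to a potential-type error of small
   capacity, upper semicontinuous of compact support, so that the exceptional
   set is covered by a compact set and a small open set. *)
Lemma inf_potential_dominant_qe lambda (lam : nat -> radon_measure R X) n :
  Eplus G lambda -> (forall k, Eplus G (lam k)) ->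
  (forall nu, Eplus G nu ->
    \int[nu]_x einfs (fun k => pot (lam k) x) n <= energy lambda nu) ->
  quasi_everywhere G (fun x => einfs (fun k => pot (lam k) x) n <= pot lambda x).
Proof.
move=> El Elam dom; apply/quasi_everywhereP.
set v := fun x => einfs (fun k => pot (lam k) x) n.
have v0 x : 0 <= v x.
  by apply: le_ereal_inf_tmp => _ [k _ <-]; exact: potential_ge0.
have mv : measurable_fun [set: borel X] v.
  by apply: measurable_fun_einfs => k; exact: potential_measurable.
have v_le k x : (n <= k)%N -> v x <= pot (lam k) x.
  by move=> nk; apply: ereal_inf_lbound; exists k.
pose E m := [set x | pot lambda x + (m.+1%:R^-1)%:E < v x].
apply: (@sub_cap_null _ _ _ _ (\bigcup_m E m)).
  move=> x /= /negP; rewrite -ltNge => /lte_addSinv[|m Em]; last by exists m.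
  exact: potential_ge0.
apply: cap_null_bigcup => // m; apply: cap_null_approx => // e e0.
(* The gap defining [E m] is [d + d]: one half is spent on the compact set [K], the other on the
   open set [W]. *)
set d : R := (m.+1%:R^-1 / 2)%R; have d0 : (0 < d)%R by rewrite divr_gt0// invr_gt0.
have dd : m.+1%:R^-1%R = (d + d)%R by exact: splitr.
(* These errors sum to [e * d], whence mass at most [e] for [W], where the total error exceeds
   [d]. *)
pose ek k := (e * d / (2 ^ k.+1)%:R)%R.
have ek0 k : (0 < ek k)%R by rewrite divr_gt0// mulr_gt0.
have [f fP] : {f : nat -> X -> R & forall k, [/\ cc (f k), forall x, (0 <= f k x)%R,
    forall x, (f k x)%:E <= pot (lam k) x & forall mu, Eplus1 G mu ->
    energy (lam k) mu <= (\int[mu]_x f k x + ek k)%:E]}.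
  apply: (@choice _ _ (fun k (f : X -> R) => [/\ cc f, forall x, (0 <= f x)%R,
    forall x, (f x)%:E <= pot (lam k) x & forall mu, Eplus1 G mu ->
    energy (lam k) mu <= (\int[mu]_x f x + ek k)%:E])) => k.
  exact: potential_dini.
have cf k : cc (f k) by case: (fP k).
have f0 k x : (0 <= f k x)%R by case: (fP k).
have fpot k x : (f k x)%:E <= pot (lam k) x by case: (fP k).
(* As an infimum of continuous functions [h] is upper semicontinuous, and [f n] bounds its support;
   it replaces [v], which is in general semicontinuous in neither sense. *)
pose h x : \bar R := ereal_inf [set (f k x)%:E | k in [set k | (n <= k)%N]].
have h_le k x : (n <= k)%N -> h x <= (f k x)%:E.
  by move=> nk; apply: ereal_inf_lbound; exists k.
have [_ [C cC fC]] := cf n.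
have h0 x : 0 <= h x by apply: le_ereal_inf_tmp => _ [k _ <-]; rewrite lee_fin.
have hfin x : h x \is a fin_num.
  by rewrite ge0_fin_numE// (le_lt_trans (h_le n x _))// ltry.
have hH : uscH0 h.
  apply/uscH0P => //; split => //.
  - by move=> x; rewrite -ge0_fin_numE.
  - apply/uscP => x a /ereal_inf_lt[_ [k nk <-] ka].
    exists [set y | f k y < a]%R.
      by apply: (cvgr_lt (f k x) ((cf k).1 x)); rewrite -lte_fin.
    by move=> y fy; apply: le_lt_trans (h_le k y nk) _; rewrite lte_fin.
  - exists C => // x nCx; apply/eqP; rewrite eq_le h0 andbT.
    by apply: (le_trans (h_le n x _)) => //; rewrite fC.
(* [K] is the set where [pot lambda + d <= h], as [Kh] shows; this form exhibits it as closed in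
   [C], because [pot lambda - h] is lower semicontinuous. *)
pose K := C `&` ~` [set x | (- d)%:E < pot lambda x - h x].
have cK : compact K.
  apply: compact_closedI => //; apply: open_closedC.
  apply: ((lower_semicontinuousP _).1 _ (- d)%R); apply: lscD.
  - exact: (potential_lscF hausX lcX kerG lambda).2.
  - exact: hH.2.2.1.
  - by move=> x; rewrite gt_eqF// (lt_le_trans (ltNy0))// potential_ge0.
  - by move=> x; move: (hfin x); case: (h x).
have Kh x : K x <-> pot lambda x + d%:E <= h x.
  have E1 : ((- d)%:E < pot lambda x - h x) = (h x < pot lambda x + d%:E).
    move: (hfin x); case: (h x) => // r _; rewrite lteBrDr//.
    case: (pot lambda x) (potential_ge0 kerG lambda x) => [p||]// _.
      by rewrite -!EFinD !lte_fin; apply/idP/idP; lra.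
    by rewrite !addye// !ltry.
  split=> [[_ /= /negP]|Kx]; first by rewrite E1 -leNgt.
  split; last by apply/negP; rewrite E1 -leNgt.
  apply: contrapT => nCx; have := h_le n x (leqnn n); rewrite fC// => /(le_trans Kx).
  apply/negP; rewrite -ltNge; apply: (@lt_le_trans _ _ d%:E); first by rewrite lte_fin.
  by rewrite leeDr// potential_ge0.
pose w k x : \bar R := pot (lam k) x - (f k x)%:E.
have lw k : lscF (w k).
  split; first by move=> x; rewrite /w leeBrDr// add0e.
  apply: lscD; first exact: (potential_lscF hausX lcX kerG (lam k)).2.
  - exact: continuous_usc (cf k).1.
  - by move=> x; rewrite gt_eqF// (lt_le_trans (ltNy0))// potential_ge0.
  - by [].
pose W := [set x | d%:E < \sum_(k <oo) w k x].
have lsw := lscF_nneseries lw.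
have oW : open W by apply: ((lower_semicontinuousP _).1 _ d); exact: lsw.2.
have w_le k x : w k x <= \sum_(k <oo) w k x.
  apply: (@le_trans _ _ (\sum_(0 <= i < k.+1) w i x)).
    rewrite big_nat_recr//= leeDr//; apply: sume_ge0 => i _; exact: (lw i).1.
  by apply: nneseries_lim_ge => i _ _; exact: (lw i).1.
have mh := uscH0_measurable hH.
have mpot mu := potential_measurable hausX lcX kerG mu.
exists K, W; split => //.
(* On [K] one has [pot lambda + d <= h <= v]; integrated over [K], this contradicts domination in
   the mean unless [mu K = 0]. *)
- apply: cap_null_compact => // mu mu1.
  have mK := compact_borel hausX cK.
  have [rho [/(_ mu1) rho1 rhoI]] := energy_restrict hausX lcX kerG mu mK.
  have Erho := Eplus1_Eplus kerG rho1.
  have potK : \int[mu]_(x in K) pot lambda x = energy lambda rho.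
    rewrite -rhoI => [//||]; first exact: mpot.
    by move=> x; exact: potential_ge0.
  suff : mu K <= (0 / d)%:E.
    by rewrite mul0r => muK; apply/eqP; rewrite eq_le muK measure_ge0.
  apply: (@measure_gap_le _ _ _ mu K (pot lambda) h d) => //.
  + by move=> x; exact: potential_ge0.
  + by rewrite potK; exact: energy_fin.
  + by move=> x /Kh.
  rewrite adde0 potK; apply: le_trans (dom _ Erho); rewrite -rhoI//.
  apply: ge0_le_integralT => // x; apply: le_ereal_inf_tmp => _ [k nk <-].
  by apply: le_trans (fpot k x); exact: h_le.
(* Off [W] every [pot (lam k)] is within [d] of [f k], so a gap [d + d] between [pot lambda] and [v]
   leaves a gap [d] between [pot lambda] and [h]. *)
- move=> x Ex; have [Wx|nWx] := pselect (W x); [by right|left].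
  apply/Kh; apply: le_ereal_inf_tmp => _ [k nk <-].
  have wd : w k x <= d%:E.
    by apply: (le_trans (w_le k x)); rewrite leNgt; exact/negP.
  have {}wd : pot (lam k) x <= d%:E + (f k x)%:E by rewrite -leeBlDr.
  have {}Ex : pot lambda x + (d + d)%:E < v x by rewrite -dd.
  have := lt_le_trans Ex (le_trans (v_le k x nk) wd).
  case: (pot lambda x) (potential_ge0 kerG lambda x) => [p||]// _.
  by rewrite -!EFinD lte_fin lee_fin; lra.
- move=> mu mu1; have mW := open_borel oW.
  have wI k : \int[mu]_x w k x <= (ek k)%:E.
    have mf : measurable_fun [set: borel X] (EFin \o f k).
      by apply/measurable_EFinP; exact: cc_measurable.
    have f0' x : 0 <= (f k x)%:E by rewrite lee_fin.
    have wE : \int[mu]_x w k x + (\int[mu]_x f k x)%R%:E = energy (lam k) mu.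
      rewrite -cc_integralE//.
      rewrite -(ge0_integralTD mu (lscF_measurable (lw k)) mf (lw k).1 f0').
      by apply: eq_integral => x _; rewrite /w subeK.
    have [_ _ _ /(_ mu mu1)] := fP k; rewrite -wE EFinD addeC leeD2lE//.
  rewrite (_ : e = e * d / d)%R; last by rewrite mulfK// gt_eqF.
  apply: (@measure_gap_le _ _ _ mu W (cst 0) (fun x => \sum_(k <oo) w k x) d) => //.
  + exact: lscF_measurable lsw.
  + exact: lsw.1.
  + by rewrite integral0.
  + by move=> x Wx; rewrite add0e ltW.
  rewrite integral0 add0e; apply: (@le_trans _ _ (\int[mu]_x \sum_(k <oo) w k x)).
    apply: ge0_subset_integral => //; first exact: lscF_measurable lsw.
    by move=> x _; exact: lsw.1.
  rewrite integral_nneseries//; last 2 first.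
  + by move=> k; exact: lscF_measurable (lw k).
  + by move=> k x _; exact: (lw k).1.
  have ed0 : (0 <= e * d)%R by rewrite mulr_ge0// ltW.
  apply: le_trans (epsilon_trick0 xpredT ed0); apply: lee_nneseries => k *.
    by apply: integral_ge0 => x _; exact: (lw k).1.
  exact: wI.
Qed.

End quasi_everywhere.

(** * Dual capacities *)

Section dual_capacities.
Context (R : realType) (X : ptopologicalType).
Hypotheses (hausX : hausdorff_space X) (lcX : locally_compact [set: X]).
Variable G : X -> X -> \bar R.
Hypotheses (kerG : is_kernel G) (consG : consistent G)
  (posG : positive_definite G).
Implicit Types (lambda mu nu : radon_measure R X).

Local Notation pot := (potential G).
Local Notation energy := (mutual_energy G).

(** [dominant_directed] is applied to the continuous minorants of [g], and [lsc_inner_cc] recovers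
    [g]. Taking [C] strictly above the capacity makes it positive. *)
Lemma lsc_dominant (g : X -> \bar R) (C : R) : lscF g -> capC G g < C%:E ->
  exists lambda, enorm G lambda <= C%:E /\
    forall nu, Eplus G nu -> \int[nu]_x g x <= energy lambda nu.
Proof.
move=> lg gC.
have C0 : (0 < C)%R.
  by rewrite -lte_fin; apply: le_lt_trans gC; apply: capC_ge0 => //; exact: lg.1.
have mg := lscF_measurable lg.
have mcc (f : X -> R) : cc f -> measurable_fun [set: borel X] (EFin \o f).
  by move=> cf; apply/measurable_EFinP; exact: cc_measurable.
have [|||lambda [lC dom]] := @dominant_directed R X hausX lcX G kerG consG posG _
  [set f : X -> R | [/\ cc f, forall x, (0 <= f x)%R & forall x, (f x)%:E <= g x]]
  (fun f nu => \int[nu]_x (f x)%:E) C C0.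
- by exists (fun=> 0%R); split => // [|x]; [exact: cc0|exact: lg.1].
- move=> f k [cf f0 fg] [ck k0 kg].
  have cm : cc (fun x => Num.max (f x) (k x)) by exact: cc_max.
  exists (fun x => Num.max (f x) (k x)).
    split => // x; first by rewrite le_max f0.
    by rewrite EFin_max ge_max fg kg.
  by move=> nu _; split; (apply: ge0_le_integralT; [exact: mcc|exact: mcc| |]) => x;
    rewrite lee_fin// le_max lexx ?orbT.
- move=> f [cf f0 fg].
  have [lambda [lf dom]] := dominant_exists hausX lcX kerG posG (cc_C0plus hausX cf f0).2.
  exists lambda; split => //; apply: (le_trans lf); apply: le_trans (ltW gC).
  by apply: le_capC => //; exact: mcc.
exists lambda; split => // nu Enu; rewrite leNgt; apply/negP => lt.
have fin := energy_fin kerG posG (enorm_le_Eplus lC) Enu.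
have [|f [cf f0 fg]] := @lsc_inner_cc R X hausX lcX nu g (fine (energy lambda nu)) lg.
  by rewrite fineK.
apply/negP; rewrite -leNgt -lee_fin (fineK fin) -cc_integralE//.
exact: dom.
Qed.

Lemma lower_dominant (f : X -> \bar R) (C : R) : Fplus f ->
  lower_cap G f < C%:E -> exists lambda, enorm G lambda <= C%:E /\
    forall nu, Eplus G nu -> lower_integral nu f <= energy lambda nu.
Proof.
move=> f0 fC.
have cap_le h : uscH0 h -> (forall x, h x <= f x) -> capC G h <= lower_cap G f.
  move=> hH hf; rewrite -(capHE hausX lcX kerG hH); apply: ereal_sup_ubound.
  by exists h.
have C0 : (0 < C)%R.
  rewrite -lte_fin; apply: le_lt_trans fC; apply: le_trans (cap_le _ (@uscH0_0 R X hausX) f0).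
  exact: capC_ge0.
have [|||lambda [lC dom]] := @dominant_directed R X hausX lcX G kerG consG posG _
  [set h : X -> \bar R | uscH0 h /\ forall x, h x <= f x]
  (fun h nu => \int[nu]_x h x) C C0.
- by exists (fun=> 0); split => //; exact: uscH0_0.
- move=> h k [hH hf] [kH kf]; have mH := uscH0_max hausX hH kH.
  exists (fun x => maxe (h x) (k x)).
    by split => // x; rewrite ge_max hf kf.
  move=> nu _; split; (apply: ge0_le_integralT;
    [exact: uscH0_measurable|exact: uscH0_measurable| |]) => x.
  + exact: hH.1.
  + by rewrite le_max lexx.
  + exact: kH.1.
  + by rewrite le_max lexx orbT.
- move=> h [hH hf].
  have [lambda [lh dom]] := dominant_exists hausX lcX kerG posG hH.
  exists lambda; split => //; apply: (le_trans lh); apply: le_trans (ltW fC).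
  exact: cap_le.
exists lambda; split => // nu Enu; rewrite leNgt; apply/negP.
move=> /(lower_integral_inner_usc hausX)[h [hH hf]].
by apply/negP; rewrite -leNgt; exact: dom.
Qed.

(** The exceptional set is absorbed by adding to the potential a series of functions that are at
    least 1 on it: the sum is infinite there and has capacity at most [e]. The potential itself has
    capacity at most [enorm G lambda], by positive definiteness. *)
Lemma upper_cap_le_gamma (f : X -> \bar R) : upper_cap G f <= upper_gamma G f.
Proof.
apply: le_ereal_inf_tmp => _ [lambda [El /quasi_everywhereP nE] <-].
have {}nE := nE hausX lcX.
apply/lee_addgt0Pr => e e0.
have [g gP] : {g : nat -> X -> \bar R & forall n, [/\ lscF (g n),
    forall x, ~ (f x <= pot lambda x) -> 1 <= g n x &
    capC G (g n) <= (e / (2 ^ n.+1)%:R)%:E]}.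
  apply: (@choice _ _ (fun n (g : X -> \bar R) => [/\ lscF g,
    forall x, ~ (f x <= pot lambda x) -> 1 <= g x &
    capC G g <= (e / (2 ^ n.+1)%:R)%:E])) => n.
  by apply: nE; rewrite divr_gt0.
have lg n : lscF (g n) by case: (gP n).
have lsg := lscF_nneseries lg; have lpot := potential_lscF hausX lcX kerG lambda.
pose s x := pot lambda x + \sum_(n <oo) g n x.
have ls : lscF s by exact: lscFD.
apply: (@le_trans _ _ (capG G s)).
  apply: ereal_inf_lbound; exists s => //; split => // x.
  have [fx|nfx] := pselect (f x <= pot lambda x).
    by apply: (le_trans fx); rewrite leeDl//; exact: lsg.1.
  suff -> : s x = +oo by exact: leey.
  rewrite /s (_ : \sum_(n <oo) _ = +oo).
    by rewrite addey// gt_eqF// (lt_le_trans (ltNy0))// potential_ge0.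
  have partial N : N%:R%:E <= \sum_(0 <= i < N) g i x.
    elim: N => [|N ih]; first by rewrite big_geq.
    by rewrite big_nat_recr//= -natr1 EFinD leeD//; case: (gP N) => _ /(_ _ nfx).
  have bound N : N%:R%:E <= \sum_(n <oo) g n x.
    apply: (le_trans (partial N)); apply: nneseries_lim_ge => i _ _.
    exact: (lg i).1.
  case: (\sum_(n <oo) g n x) bound => [r||]// bound.
    have := bound (Num.truncn r).+1; rewrite lee_fin leNgt.
    by rewrite truncnS_gt.
  by have := bound 0%N.
rewrite capGE//.
apply: (@le_trans _ _ (capC G (pot lambda) + capC G (fun x => \sum_(n <oo) g n x))).
  exact: capCD (lscF_measurable lpot) (lscF_measurable lsg) lpot.1 lsg.1.
rewrite leeD//.
  by apply: ge_ereal_sup => _ [mu mu1 <-]; exact: energy_le_enorm.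
apply: (@le_trans _ _ (\sum_(n <oo) capC G (g n))).
  by apply: capC_nneseries => n; [exact: lscF_measurable|exact: (lg n).1].
apply: le_trans (epsilon_trick0 xpredT (ltW e0)); apply: lee_nneseries => n *.
  by apply: capC_ge0 => //; exact: (lg n).1.
by case: (gP n).
Qed.

Lemma upper_cap_gamma (f : X -> \bar R) : upper_cap G f = upper_gamma G f.
Proof.
apply/eqP; rewrite eq_le upper_cap_le_gamma /=.
apply: le_ereal_inf_tmp => _ [g [lg fg] <-]; rewrite capGE//.
have [fin|] := boolP (capC G g \is a fin_num); last first.
  rewrite ge0_fin_numE ?capC_ge0//; last exact: lg.1.
  by rewrite -leNgt leye_eq => /eqP ->; rewrite leey.
apply/lee_addgt0Pr => e e0.
have [|lambda [lC dom]] := @lsc_dominant g (fine (capC G g) + e)%R lg.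
  by rewrite EFinD fineK// lteDl// lte_fin.
have El := enorm_le_Eplus lC.
apply: (@le_trans _ _ (enorm G lambda)); last first.
  by apply: (le_trans lC); rewrite EFinD fineK.
apply: ereal_inf_lbound; exists lambda => //; split => //.
have [E E0 EP] := lsc_dominant_qe hausX lcX kerG consG posG El lg dom.
by exists E => // x /EP; exact: le_trans.
Qed.

Lemma lower_cap_gamma (f : X -> \bar R) : Fplus f ->
  lower_cap G f = lower_gamma G f.
Proof.
move=> f0; apply/eqP; rewrite eq_le; apply/andP; split.
  apply: ge_ereal_sup => _ [h [hH hf] <-]; rewrite capHE//.
  apply: le_ereal_inf_tmp => _ [lambda [El dom] <-].
  apply: ge_ereal_sup => _ [mu mu1 <-].
  apply: le_trans (energy_le_enorm kerG posG El mu1).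
  apply: le_trans (dom _ (Eplus1_Eplus kerG mu1)).
  apply: le_lower_integral; first exact: uscH0_measurable hH.
  by move=> x; rewrite hf andbT; exact: hH.1.
apply/lee_addgt0Pr => e e0.
have c0 : 0 <= lower_cap G f.
  apply: le_ereal_sup_tmp; exists (capH G (fun=> 0)).
    by exists (fun=> 0) => //; split => //; exact: uscH0_0.
  by rewrite capHE//; [exact: capC_ge0|exact: uscH0_0].
have [fin|] := boolP (lower_cap G f \is a fin_num); last first.
  by rewrite ge0_fin_numE// -leNgt leye_eq => /eqP ->; rewrite addye// leey.
have [|lambda [lC dom]] := @lower_dominant f (fine (lower_cap G f) + e)%R f0.
  by rewrite EFinD fineK// lteDl// lte_fin.
apply: (@le_trans _ _ (enorm G lambda)); last first.
  by apply: (le_trans lC); rewrite EFinD fineK.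
apply: ereal_inf_lbound; exists lambda => //; split => //.
exact: enorm_le_Eplus lC.
Qed.

Lemma le_upper_cap (f g : X -> \bar R) : (forall x, f x <= g x) ->
  upper_cap G f <= upper_cap G g.
Proof.
move=> fg; apply: le_ereal_inf_tmp => _ [k [lk gk] <-].
apply: ereal_inf_lbound; exists k => //; split => // x.
exact: le_trans (gk x).
Qed.

Lemma le_lower_cap (f g : X -> \bar R) : (forall x, f x <= g x) ->
  lower_cap G f <= lower_cap G g.
Proof.
move=> fg; apply: ge_ereal_sup => _ [h [hH hf] <-].
apply: ereal_sup_ubound; exists h => //; split => // x.
exact: le_trans (hf x) _.
Qed.

(** The [f_ n] may be non-measurable and are never integrated. Off a null set
    [f_ n <= f_ k <= pot (lam k)] for all [k >= n], hence [f_ n <= v n]; each [v n] is Borel and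
    dominated by [lam n], with the bound [C] on the norm uniform in [n]. *)
Lemma upper_cap_sup (f_ : nat -> X -> \bar R) : (forall n, Fplus (f_ n)) ->
  (forall n x, f_ n x <= f_ n.+1 x) ->
  upper_cap G (fun x => ereal_sup [set f_ n x | n in setT]) =
  ereal_sup [set upper_cap G (f_ n) | n in setT].
Proof.
move=> f0 ndf; set S := ereal_sup [set upper_cap _ _ | _ in _].
have ndf' n k x : (n <= k)%N -> f_ n x <= f_ k x.
  by move=> nk; move: n k nk; apply/nondecreasing_seqP => n; exact: ndf.
apply/eqP; rewrite eq_le; apply/andP; split; last first.
  apply: ge_ereal_sup => _ [n _ <-]; apply: le_upper_cap => x.
  by apply: ereal_sup_ubound; exists n.
have fS n : upper_cap G (f_ n) <= S by apply: ereal_sup_ubound; exists n.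
have S0 : 0 <= S.
  apply: le_trans (fS 0%N); apply: le_ereal_inf_tmp => _ [g [lg _] <-].
  by rewrite capGE//; apply: capC_ge0 => //; exact: lg.1.
have [fin|] := boolP (S \is a fin_num); last first.
  by rewrite ge0_fin_numE// -leNgt leye_eq => /eqP ->; rewrite leey.
apply/lee_addgt0Pr => e e0; pose C := (fine S + e)%R.
have C0 : (0 < C)%R by rewrite ltr_wpDl// fine_ge0.
have SC : S + e%:E = C%:E by rewrite EFinD fineK.
have [lam lamP] : {lam : nat -> radon_measure R X & forall n,
    upper_Gamma G (f_ n) (lam n) /\ enorm G (lam n) <= C%:E}.
  apply: (@choice _ _ (fun n l => upper_Gamma G (f_ n) l /\ enorm G l <= C%:E)) => n.
  have : upper_gamma G (f_ n) < C%:E.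
    by rewrite -upper_cap_gamma -SC (le_lt_trans (fS n))// lteDl// lte_fin.
  by move=> /ereal_inf_lt[_ [l lG <-] /ltW lC]; exists l.
have Elam n : Eplus G (lam n) by exact: enorm_le_Eplus (lamP n).2.
pose v n x := einfs (fun k => pot (lam k) x) n.
have mv n : measurable_fun [set: borel X] (v n).
  by apply: measurable_fun_einfs => k; exact: potential_measurable.
have v0 n x : 0 <= v n x.
  by apply: le_ereal_inf_tmp => _ [k _ <-]; exact: potential_ge0.
have ndv n k x : (n <= k)%N -> v n x <= v k x by exact: nondecreasing_einfs.
have [|||lambda [lC dom]] := @dominant_directed R X hausX lcX G kerG consG posG _
  [set: nat] (fun n nu => \int[nu]_x v n x) C C0.
- by exists 0%N.
- move=> n k _ _; exists (maxn n k) => // nu _.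
  by split; apply: ge0_le_integralT => // x; apply: ndv; rewrite leq_max leqnn ?orbT.
- move=> n _; exists (lam n); split; first exact: (lamP n).2.
  move=> nu _; apply: ge0_le_integralT => //; first exact: potential_measurable.
  by move=> x; apply: ereal_inf_lbound; exists n => /=.
have El := enorm_le_Eplus lC.
apply: (@le_trans _ _ (enorm G lambda)); last by rewrite SC.
rewrite upper_cap_gamma; apply: ereal_inf_lbound; exists lambda => //; split => //.
apply/(quasi_everywhereP hausX lcX).
pose E k := [set x | ~ (f_ k x <= pot (lam k) x)].
pose A n := [set x | ~ (v n x <= pot lambda x)].
have nE k : cap_null G (E k).
  by apply/(quasi_everywhereP hausX lcX); case: (lamP k) => -[].
have nA n : cap_null G (A n).
  apply/(quasi_everywhereP hausX lcX); apply: inf_potential_dominant_qe => //.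
  by move=> nu Enu; exact: dom.
apply: (sub_cap_null _ (cap_nullU hausX (cap_null_bigcup hausX nE)
  (cap_null_bigcup hausX nA))).
move=> x /= nf; apply: contrapT => /not_orP[nEx nAx]; apply: nf.
apply: ge_ereal_sup => _ [n _ <-].
apply: (@le_trans _ _ (v n x)); last first.
  by apply: contrapT => nv; apply: nAx; exists n.
apply: le_ereal_inf_tmp => _ [k nk <-]; apply: (le_trans (ndf' n k x nk)).
by apply: contrapT => nv; apply: nEx; exists k.
Qed.

(** Membership in [lower_Gamma] is already an inequality in the mean, so no return to
    quasi-everywhere is needed. Measurability of the [f_ n] serves to pass to the limit under the
    lower integral, through [lower_integral_sup]. *)
Lemma lower_cap_sup (f_ : nat -> X -> \bar R) : (forall n, Fplus (f_ n)) ->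
  (forall n, Eplus_measurable G (f_ n)) ->
  (forall n x, f_ n x <= f_ n.+1 x) ->
  lower_cap G (fun x => ereal_sup [set f_ n x | n in setT]) =
  ereal_sup [set lower_cap G (f_ n) | n in setT].
Proof.
move=> f0 mf ndf; set S := ereal_sup [set lower_cap _ _ | _ in _].
have ndf' n k x : (n <= k)%N -> f_ n x <= f_ k x.
  by move=> nk; move: n k nk; apply/nondecreasing_seqP => n; exact: ndf.
have supf0 : Fplus (fun x => ereal_sup [set f_ n x | n in setT]).
  by move=> x; apply: le_ereal_sup_tmp; exists (f_ 0%N x); [exists 0%N|exact: f0].
apply/eqP; rewrite eq_le; apply/andP; split; last first.
  apply: ge_ereal_sup => _ [n _ <-]; apply: le_lower_cap => x.
  by apply: ereal_sup_ubound; exists n.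
have fS n : lower_cap G (f_ n) <= S by apply: ereal_sup_ubound; exists n.
have S0 : 0 <= S.
  apply: le_trans (fS 0%N); apply: le_ereal_sup_tmp; exists (capH G (fun=> 0)).
    by exists (fun=> 0) => //; split => //; [exact: uscH0_0|exact: f0].
  by rewrite capHE//; [exact: capC_ge0|exact: uscH0_0].
have [fin|] := boolP (S \is a fin_num); last first.
  by rewrite ge0_fin_numE// -leNgt leye_eq => /eqP ->; rewrite leey.
apply/lee_addgt0Pr => e e0; pose C := (fine S + e)%R.
have C0 : (0 < C)%R by rewrite ltr_wpDl// fine_ge0.
have SC : S + e%:E = C%:E by rewrite EFinD fineK.
have [|||lambda [lC dom]] := @dominant_directed R X hausX lcX G kerG consG posG _
  [set: nat] (fun n nu => lower_integral nu (f_ n)) C C0.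
- by exists 0%N.
- move=> n k _ _; exists (maxn n k) => // nu _.
  have le i : (i <= maxn n k)%N ->
      lower_integral nu (f_ i) <= lower_integral nu (f_ (maxn n k)).
    move=> ik; apply: ge_ereal_sup => _ [g [mg gf] <-].
    apply: le_lower_integral => // x; case/andP: (gf x) => -> /= /le_trans; apply.
    exact: ndf'.
  by split; apply: le; rewrite leq_max leqnn ?orbT.
- move=> n _; apply: lower_dominant; first exact: f0.
  by rewrite -SC (le_lt_trans (fS n))// lteDl// lte_fin.
have El := enorm_le_Eplus lC.
rewrite lower_cap_gamma// -SC in lC *.
apply: le_trans lC; apply: ereal_inf_lbound; exists lambda => //; split => // nu Enu.
apply: (le_trans (lower_integral_sup hausX _ _ _)) => //.
- by move=> n; exact: mf.
by apply: ge_ereal_sup => _ [n _ <-]; exact: dom.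
Qed.

End dual_capacities.

Unset Implicit Arguments.

Theorem corollary3p13 (R : realType) (X : ptopologicalType)
    (hausX : hausdorff_space X) (lcX : locally_compact [set: X])
    (G : X -> X -> \bar R) (kerG : is_kernel G)
    (consG : consistent G) (posG : positive_definite G) :
  (forall f : X -> \bar R, Fplus f ->
     upper_cap G f = upper_gamma G f /\ lower_cap G f = lower_gamma G f) /\
  (forall f_ : nat -> X -> \bar R,
     (forall n, Fplus (f_ n)) ->
     (forall n x, f_ n x <= f_ n.+1 x) ->
     upper_cap G (fun x => ereal_sup [set f_ n x | n in [set: nat]]) =
       ereal_sup [set upper_cap G (f_ n) | n in [set: nat]]) /\
  (forall f_ : nat -> X -> \bar R,
     (forall n, Fplus (f_ n)) ->
     (forall n, Eplus_measurable G (f_ n)) ->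
     (forall n x, f_ n x <= f_ n.+1 x) ->
     lower_cap G (fun x => ereal_sup [set f_ n x | n in [set: nat]]) =
       ereal_sup [set lower_cap G (f_ n) | n in [set: nat]]).
Proof.
split; [move=> f f0; split|split].
- exact: upper_cap_gamma.
- exact: lower_cap_gamma.
- exact: upper_cap_sup.
- exact: lower_cap_sup.
Qed.
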